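(* Let $\gamma>0$, let $\rho$ be an admissible spatial weight and let $\phi$ be an admissible time weight (of type (A) or of type (B)), as defined in the context. Let $u_0\in H^2(\mathbb{R})\cap H^1_{\rho^2}(\mathbb{R})$, and assume that $f,f_t\in L^{\infty}(\mathbb{R}^+,L^2_{\rho^2}(\mathbb{R}))$ and that $$\int_0^{\infty}\int_{\mathbb{R}}\phi^2(t)|f(x,t)|^2\,dx\,dt<\infty .$$ Let $u$ be the solution of $$\mathrm{i}u_t+\tfrac12 u_{xx}+|u|^2u=f-\mathrm{i}\gamma u,\quad x\in\mathbb{R},\ t>0,\qquad u(x,0)=u_0(x),\qquad \lim_{|x|\to\infty}u(x,t)=0\ \text{ for all } t\ge 0 .$$ Then the following spatial and temporal decay estimates are simultaneously valid: 1. There exists a constant $K_1>0$ such that $|u(x,t)|^2\le \dfrac{K_1}{\rho^2(x)}$ for all $x\in\mathbb{R}$ and all $t\ge 0$. 2. If $\phi$ is of type (A) (with any $\gamma>0$), or if $\phi$ is of type (B) with constant $\delta_2'$ and $\gamma\ge\delta_2'$, then there exists a constant $K_2>0$ independent of $t$ such that $|u(x,t)|^2\le \dfrac{K_2}{\phi(t)}$ for all $x\in\mathbb{R}$ and all $t>0$.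
   Context: Functions $u,u_0,f$ are complex valued. Admissible spatial weight: a locally Lipschitz function $\rho:\mathbb{R}\to(0,\infty)$ with $\lim_{|x|\to\infty}\rho(x)=+\infty$ for which there are constants $\beta_1,\beta_2$ with $0<\beta_1<|\rho'(x)|<\beta_2$ for almost every $x\in\mathbb{R}$ (example: $\rho(x)=1+|x/x_0|$, $x_0>0$). Weighted spaces: $L^2_{\rho^2}(\mathbb{R})$ is the space of $v:\mathbb{R}\to\mathbb{C}$ with $\|v\|_{0,\rho^2}^2=\int_{\mathbb{R}}\rho^2|v|^2dx<\infty$; $H^1_{\rho^2}(\mathbb{R})$ is the space of $v$ with $\|v\|_{1,\rho^2}^2=\int_{\mathbb{R}}\rho^2|v|^2dx+\int_{\mathbb{R}}\rho^2|v_x|^2dx<\infty$. Admissible time weight: a differentiable function $\phi:[0,\infty)\to(0,\infty)$ with $\lim_{t\to\infty}\phi(t)=+\infty$, which is either of type (A): there are constants $\delta_1,\delta_2$ with $0<\delta_1<|\dot\phi(t)|<\delta_2$ for all $t\ge 0$; or of type (B): there are constants $\delta_1',\delta_2'$ with $0<\delta_1'<|\dot\phi(t)|<\delta_2'|\phi(t)|$ for all $t\ge 0$. Here $f_t$ is the (weak) time derivative of $f$. The solution $u$ is the unique $u\in C([0,\infty),H^2(\mathbb{R}))$ with $u_t\in C([0,\infty),L^2(\mathbb{R}))$ satisfying the equation in $L^2(\mathbb{R})$ and the initial condition. *)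

(* Defs.v *)
(* MathComp-Analysis; complex numbers are R[i] from mathcomp-real-closed. *)
From HB Require Import structures.
From mathcomp Require Import all_boot all_order all_algebra.
From mathcomp Require Import complex.
From mathcomp Require Import all_classical all_reals all_analysis.

Set Implicit Arguments.
Unset Strict Implicit.
Unset Printing Implicit Defensive.
Import Order.TTheory GRing.Theory Num.Theory.
Import numFieldNormedType.Exports.
Export ComplexField.Normc.

Local Open Scope ring_scope.
Local Open Scope complex_scope.
Local Open Scope classical_set_scope.

Section Defs.
Variable R : realType.
Local Notation mu := (@lebesgue_measure R).

Implicit Types (rho phi theta : R -> R) (v w : R -> R[i]).
(* Space-time functions are written [u x t], so that [u^~ t] is u(., t). *)
Implicit Types (u f g : R -> R -> R[i]).

Definition admissible_space_weight rho : Prop :=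
  [/\ forall x, 0 < rho x,
      forall x : R, exists2 A : set R, nbhs x A & [lipschitz rho y | y in A],
      rho x @[x --> +oo] --> +oo /\ rho x @[x --> -oo] --> +oo
    & exists beta1 beta2 : R, 0 < beta1 /\
        {ae mu, forall x,
           derivable rho x 1 /\ beta1 < `|derive1 rho x| < beta2} ].

(* Time weights live on [0, oo): derivatives are relative to that interval,
   hence one-sided at 0, and values at negative times are irrelevant. *)
Definition time_quotient phi (t s : R) : R := (s - t)^-1 * (phi s - phi t).

Definition time_derivable phi (t : R) : Prop :=
  cvg (time_quotient phi t s @[s --> within `[0, +oo[ t^']).

Definition time_deriv phi (t : R) : R :=
  lim (time_quotient phi t s @[s --> within `[0, +oo[ t^']).

Definition typeA phi (delta1 delta2 : R) : Prop :=
  0 < delta1 /\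
  forall t, 0 <= t -> delta1 < `|time_deriv phi t| < delta2.

Definition typeB phi (delta1 delta2 : R) : Prop :=
  0 < delta1 /\
  forall t, 0 <= t -> delta1 < `|time_deriv phi t| < delta2 * `|phi t|.

Definition admissible_time_weight phi : Prop :=
  [/\ forall t, 0 <= t -> 0 < phi t,
      forall t, 0 <= t -> time_derivable phi t,
      phi t @[t --> +oo] --> +oo
    & (exists delta1 delta2, typeA phi delta1 delta2) \/
      (exists delta1 delta2, typeB phi delta1 delta2) ].

(* The measurable sets of the library's real line are the Borel sets; every
   Lebesgue-measurable function is a.e. equal to a Borel one. *)
Definition cmeasurable v : Prop :=
  measurable_fun setT (fun x => complex.Re (v x)) /\
  measurable_fun setT (fun x => complex.Im (v x)).

(* Squared norm of v in L^2 with weight rho^2. *)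
Definition sqnormL2w rho v : \bar R :=
  (\int[mu]_x ((rho x) ^+ 2 * (normc (v x)) ^+ 2)%:E)%E.

Definition sqnormL2 v : \bar R := sqnormL2w (cst 1) v.

Definition inL2w rho v : Prop := cmeasurable v /\ (sqnormL2w rho v < +oo)%E.

Definition inL2 v : Prop := inL2w (cst 1) v.

Definition cintegral (D : set R) v : R[i] :=
  (\int[mu]_(x in D) complex.Re (v x)) +i*
  (\int[mu]_(x in D) complex.Im (v x)).

(* C^1 functions with compact support in I. *)
Definition C1c (I : set R) theta : Prop :=
  [/\ forall x, derivable theta x 1,
      continuous (derive1 theta)
    & exists K : set R,
        [/\ compact K, K `<=` I & forall x, ~ K x -> theta x = 0] ].

(* Weak derivative in one variable with C^1_c test functions, as in Brezis,
   "Functional Analysis, Sobolev Spaces and PDE", Section 8.2. It is only used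
   for v and w that are (locally) integrable. *)
Definition weak_deriv v w : Prop :=
  forall theta, C1c setT theta ->
    cintegral setT (fun x => (derive1 theta x)%:C * v x) =
    - cintegral setT (fun x => (theta x)%:C * w x).

Definition inH1w rho v : Prop :=
  inL2w rho v /\ exists w, weak_deriv v w /\ inL2w rho w.

(* v is in H^2(R), with first and second derivatives v1 and v2. *)
Definition H2_with_derivs v v1 v2 : Prop :=
  [/\ inL2 v, inL2 v1, inL2 v2, weak_deriv v v1 & weak_deriv v1 v2].

Definition inH2 v : Prop := exists v1 v2, H2_with_derivs v v1 v2.

(* u is in C([0, oo), L^2(R)). *)
Definition cont_L2 u : Prop :=
  forall t, 0 <= t -> inL2 (u^~ t) /\
    sqnormL2 (fun x => u x s - u x t)
      @[s --> within `[0, +oo[ (nbhs t)] --> 0%E.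

(* u is in C([0, oo), H^2(R)), with spatial derivatives ux and uxx. *)
Definition cont_H2 u (ux uxx : R -> R -> R[i]) : Prop :=
  [/\ forall t, 0 <= t -> H2_with_derivs (u^~ t) (ux^~ t) (uxx^~ t),
      cont_L2 u, cont_L2 ux & cont_L2 uxx].

(* ut is the time derivative of u as a function [0, oo) -> L^2(R). *)
Definition deriv_L2 u (ut : R -> R -> R[i]) : Prop :=
  forall t, 0 <= t ->
    sqnormL2 (fun x => ((s - t)^-1)%:C * (u x s - u x t) - ut x t)
      @[s --> within `[0, +oo[ t^'] --> 0%E.

Definition jointly_measurable g : Prop :=
  let D : set (R * R) := [set: R] `*` `]0, +oo[ in
  measurable_fun D (fun p : R * R => complex.Re (g p.1 p.2)) /\
  measurable_fun D (fun p : R * R => complex.Im (g p.1 p.2)).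

(* g is in L^oo((0, oo), L^2 with weight rho^2). Elements of this Bochner space
   are the classes of jointly measurable functions whose time sections have an
   essentially bounded norm. *)
Definition inLoo_L2w rho g : Prop :=
  jointly_measurable g /\
  exists M : R, {ae mu, forall t, 0 < t -> (sqnormL2w rho (g^~ t) <= M%:E)%E}.

(* ft is the weak time derivative of f on (0, oo): the equality of the
   L^2(R)-valued integrals of theta' f and - theta ft, which are evaluated
   pointwise for almost every x. *)
Definition weak_time_deriv f (ft : R -> R -> R[i]) : Prop :=
  forall theta, C1c `]0, +oo[ theta ->
    {ae mu, forall x,
       cintegral `]0, +oo[ (fun t => (derive1 theta t)%:C * f x t) =
       - cintegral `]0, +oo[ (fun t => (theta t)%:C * ft x t)}.

(* Solutions in C([0, oo), H^2) with u_t in C([0, oo), L^2). For each t,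
   [u^~ t] is the continuous representative of the H^2 class. As f is only
   given up to null sets of times, the equation is required in L^2(R) for
   almost every t > 0. *)
Definition nls_solution (gamma : R) (u0 : R -> R[i]) f u : Prop :=
  exists ux uxx ut : R -> R -> R[i],
    [/\ cont_H2 u ux uxx,
        deriv_L2 u ut /\ cont_L2 ut,
        forall t, 0 <= t ->
          [/\ continuous (fun x => complex.Re (u x t)),
              continuous (fun x => complex.Im (u x t)),
              normc (u x t) @[x --> +oo] --> (0 : R)
            & normc (u x t) @[x --> -oo] --> (0 : R)],
        {ae mu, forall t, 0 < t -> {ae mu, forall x,
          'i * ut x t + 2^-1 * uxx x t + ((normc (u x t)) ^+ 2)%:C * u x t
          = f x t - 'i * gamma%:C * u x t}}
      & {ae mu, forall x, u x 0 = u0 x} ].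

End Defs.

(* Main.v *)
(** Everything is an energy estimate with one-sided derivatives. The forcing is replaced by
    the path G = i u_t + u_xx / 2 + |u|^2 u + i gamma u, which is continuous in L^2 and agrees
    with f at almost every time; testing the weak derivative f_t against eta^2 (G(t) - G(s))
    shows that G is Lipschitz in time, also in the weighted norm.

    Without weight, the mass |u|^2 is bounded by the damping and tends to 0 because f is in
    L^2(R^+, L^2). The energy |u_x|^2 - |u^2|^2 + 4 <G, u> bounds u_x. For large times the
    cubic term is dominated by the damping in the equation for u(t + h) - u(t), which bounds
    u_t, hence u_xx.

    For part 1, the mass and the energy are weighted by eta^2, where eta <= rho is a bump of
    height rho(x0) / 2 at x0 whose slope is bounded independently of x0; all the constants are
    uniform in x0, and eta(x0)^2 |u(x0)|^2 <= 2 |eta u| |(eta u)_x|.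

    For part 2, let psi = sqrt phi. Eventually phi' <= gamma phi, so the derivative of
    psi^3 |u|^2 is at most C phi^2 |f|^2, which is integrable; moreover
    |u|_oo^2 <= 2 |u|^(3/2) |u_xx|^(1/2). *)
Require Import Defs.
From HB Require Import structures.
From mathcomp Require Import all_boot all_order all_algebra.
From mathcomp Require Import complex.
From mathcomp Require Import all_classical all_reals all_analysis.
From mathcomp Require Import measurable_realfun lra ring.
Import Order.TTheory GRing.Theory Num.Theory.
Import numFieldNormedType.Exports.
Local Open Scope ring_scope.
Local Open Scope complex_scope.
Local Open Scope classical_set_scope.
Set Implicit Arguments.
Unset Strict Implicit.
Unset Printing Implicit Defensive.

(** * One-sided derivatives *)

Section Dini.
Context {R : realType}.
Implicit Types (G H : R -> R) (a b c d e k s t : R).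

(** The order of the bounds is forced by commutators. Weighting the mass by [eta^2] leaves a term in
    [deta * u_x], and weighting the energy leaves terms in [deta * u] and [deta * u_t], where [deta]
    is the slope of [eta]. As [deta] is only bounded, these terms call for unweighted bounds on [u],
    [u_x] and [u_t] uniform in time, so the unweighted theory precedes part 1. Bounded cut-offs
    replace [rho] because [rho u] and [rho u_x] are known to be in L^2 at time 0 only: with [eta]
    every functional is finite at all times, and it remains to keep the constants independent of
    [eta].

    One-sided derivatives are used because [G] is merely Lipschitz in time, so that [<G, u>] has no
    derivative but only a bound on its growth. The coefficients of the energy are those for which
    all terms in [u_t] without [deta] can be eliminated by the equation. *)

Definition cont0 G := forall t, 0 <= t ->
  G s @[s --> within `[0, +oo[ (nbhs t)] --> G t.

Definition rder G t (l : R) := (G s - G t) / (s - t) @[s --> t^'+] --> l.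

(* [c] bounds the upper right Dini derivative of [G] at [t]. *)
Definition udini G t c := forall e, 0 < e ->
  \forall s \near t^'+, G s <= G t + (c + e) * (s - t).

Lemma near_right_gt t : \forall s \near t^'+, t < s.
Proof. exact: nbhs_right_gt. Qed.

Lemma cont0P G : cont0 G -> forall t, 0 <= t -> forall e, 0 < e ->
  exists2 d : R, 0 < d & forall s, 0 <= s -> `|s - t| < d -> `|G s - G t| < e.
Proof.
move=> cG t t0 e e0.
have /cvgrPdist_lt /(_ e e0) := cG t t0.
rewrite near_withinE => -[d /= d0 H]; exists d => // s s0 sd.
rewrite distrC; apply: H; rewrite /= ?in_itv/= ?s0//.
by rewrite /ball_/= distrC.
Qed.

(** Continuation argument: for every [e > 0] the bound [G s <= e * (s - a)] propagates. At the
    supremum [T] of the times up to which it holds, the Dini hypothesis carries it further if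
    [0 <= G T], and continuity does if [G T < 0]. Asking for the hypothesis only where [0 <= G t] is
    what allows barriers. *)
Lemma dini_le0 G a b : 0 <= a -> a <= b -> cont0 G -> G a <= 0 ->
  (forall t, a <= t < b -> 0 <= G t -> udini G t 0) -> G b <= 0.
Proof.
move=> a0 ab cG Ga dG.
suff H (e : R) : 0 < e -> G b <= e * (b - a).
  have [<-//|neq] := eqVneq a b.
  apply/ler_addgt0Pl => e e0; rewrite addr0.
  have ba : 0 < b - a by rewrite subr_gt0 lt_neqAle neq.
  by have := H (e / (b - a)) (divr_gt0 e0 ba); rewrite divfK ?gt_eqF.
move=> e0.
pose S := [set t | a <= t <= b /\ forall s, a <= s <= t -> G s <= e * (s - a)].
have Sa : S a.
  split; first by rewrite lexx.
  by move=> s /le_anti <-; rewrite subrr mulr0.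
have Sub : has_ubound S by exists b => x [/andP[]].
have hS : has_sup S by split => //; exists a.
pose T := sup S.
have aT : a <= T by apply: ub_le_sup.
have Tb : T <= b by apply: ge_sup; [exists a|move=> x [/andP[]]].
have ltT s : a <= s -> s < T -> G s <= e * (s - a).
  move=> as_ sT; have Ts0 : 0 < T - s by rewrite subr_gt0.
  have [x [_ Sx] sx] := sup_adherent Ts0 hS.
  by apply: Sx; rewrite as_ ltW//; rewrite opprB addrCA subrr addr0 in sx.
(* Left continuity: a violation at [T] would already occur at some [s < T]. *)
have GT : G T <= e * (T - a).
  rewrite leNgt; apply/negP => GT.
  have neq : a < T.
    by rewrite lt_neqAle aT andbT; apply: contraTneq GT => <-; rewrite subrr mulr0 -leNgt.
  have GT' : 0 < G T - e * (T - a) by rewrite subr_gt0.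
  have [d d0 dH] := cont0P cG (le_trans a0 aT) GT'.
  pose s := Num.max a (T - d / 2).
  have sT : s < T by rewrite gt_max neq/=; lra.
  have as_ : a <= s by rewrite le_max lexx.
  have sd : T - d / 2 <= s by rewrite le_max lexx orbT.
  have := dH s (le_trans a0 as_); rewrite !ltr_norml.
  have -> : - d < s - T < d by apply/andP; split; lra.
  move=> /(_ isT)/andP[h _]; have := ltT s as_ sT.
  have : e * (s - a) <= e * (T - a) by rewrite ler_pM2l// lerD2r ltW.
  lra.
have [TB|] := leP b T.
  by have <- : T = b by apply/le_anti; rewrite Tb.
move=> Tltb; exfalso.
suff [d d0 dH] : exists2 d : R, 0 < d & forall s, T < s < T + d -> G s <= e * (s - a).
  pose s := Num.min b (T + d / 2).
  have : S s.
    split; first by rewrite ge_min lexx/= le_min; apply/andP; split; lra.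
    move=> x /andP[ax xs]; have [xT|Tx|->//] := ltgtP x T; first exact: ltT.
    apply: dH; rewrite Tx/= (le_lt_trans xs)//.
    by apply: (@le_lt_trans _ _ (T + d/2)); [rewrite ge_min lexx orbT|lra].
  move=> /(ub_le_sup Sub); apply/negP; rewrite -ltNge lt_min Tltb/=; rewrite -/T; lra.
have [GT0|GT0] := leP 0 (G T).
  have aTb : a <= T < b by rewrite aT.
  have := dG T aTb GT0 e e0.
  rewrite !nearE /at_right /within/= => -[d d0 dH]; exists d => // s /andP[Ts sd].
  apply: le_trans (dH s _ Ts) _.
    by rewrite /ball_/= ltr_norml; apply/andP; split; lra.
  rewrite add0r (_ : e * (s - a) = e * (T - a) + e * (s - T)); last ring.
  by rewrite lerD2r.
have GT' : 0 < - G T by rewrite oppr_gt0.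
have [d d0 dH] := cont0P cG (le_trans a0 aT) GT'.
exists d => // s /andP[Ts sd].
have s0 : 0 <= s by apply: le_trans (ltW Ts); exact: le_trans aT.
have := dH s s0; rewrite !ltr_norml => /(_ _)/andP[]; first by apply/andP; split; lra.
move=> _ h; apply: (@le_trans _ _ 0); first lra.
by apply: mulr_ge0; [exact: ltW|lra].
Qed.

Lemma udini_le G t c c' : c <= c' -> udini G t c -> udini G t c'.
Proof.
move=> cc dG e e0; near=> s; have ts : t < s by near: s; exact: near_right_gt.
apply: (@le_trans _ _ (G t + (c + e) * (s - t))).
  by near: s; exact: dG.
by rewrite lerD2l ler_pM2r ?subr_gt0// lerD2r.
Unshelve. all: by end_near. Qed.

Lemma udiniD G H t c c' : udini G t c -> udini H t c' ->
  udini (fun s => G s + H s) t (c + c').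
Proof.
move=> dG dH e e0; have e2 : 0 < e / 2 by lra.
near=> s; have : G s <= G t + (c + e/2) * (s - t) by near: s; exact: dG.
have : H s <= H t + (c' + e/2) * (s - t) by near: s; exact: dH.
lra.
Unshelve. all: by end_near. Qed.

Lemma udini_cst k t : udini (fun=> k) t 0.
Proof.
move=> e e0; near=> s; rewrite add0r lerDl mulr_ge0 ?ltW// subr_gt0.
near: s; exact: near_right_gt.
Unshelve. all: by end_near. Qed.

Lemma rder_udini G t l : rder G t l -> udini G t l.
Proof.
move=> /cvgrPdist_lt dG e e0; near=> s.
have ts : 0 < s - t by rewrite subr_gt0; near: s; exact: near_right_gt.
have : `|l - (G s - G t) / (s - t)| < e by near: s; exact: dG.
rewrite ltr_norml => /andP[h _].
have : (G s - G t) / (s - t) <= l + e by lra.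
by rewrite ler_pdivrMr//; lra.
Unshelve. all: by end_near. Qed.

Lemma rder_cvg G t l : rder G t l -> G s @[s --> t^'+] --> G t.
Proof.
move=> dG; have h : G t + (G s - G t) / (s - t) * (s - t) @[s --> t^'+] --> G t + l * 0.
  apply: cvgD; first exact: cvg_cst.
  apply: cvgM => //; rewrite -(subrr t).
  by apply: cvgB; [exact: cvg_at_right_filter|exact: cvg_cst].
rewrite mulr0 addr0 in h; apply: cvg_trans h; apply: near_eq_cvg; near=> s.
have ts : s - t != 0 by rewrite gt_eqF// subr_gt0; near: s; exact: near_right_gt.
by rewrite divfK// addrC subrK.
Unshelve. all: by end_near. Qed.

Lemma rder_cst k t : rder (fun=> k) t 0.
Proof. by rewrite /rder; under eq_fun do rewrite subrr mul0r; exact: cvg_cst. Qed.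

Lemma rderD G H t l m : rder G t l -> rder H t m ->
  rder (fun s => G s + H s) t (l + m).
Proof.
move=> dG dH; rewrite /rder.
have -> : (fun s => (G s + H s - (G t + H t)) / (s - t)) =
  (fun s => (G s - G t) / (s - t) + (H s - H t) / (s - t)).
  by apply/funext => s; ring.
exact: cvgD.
Qed.

Lemma rderM G H t l m : rder G t l -> rder H t m ->
  rder (fun s => G s * H s) t (l * H t + G t * m).
Proof.
move=> dG dH; rewrite /rder.
have -> : (fun s => (G s * H s - (G t * H t)) / (s - t)) =
  (fun s => (G s - G t) / (s - t) * H s + G t * ((H s - H t) / (s - t))).
  by apply/funext => s; ring.
apply: cvgD; first by apply: cvgM => //; exact: rder_cvg dH.
by apply: cvgM => //; exact: cvg_cst.
Qed.

Lemma rderZ G t k l : rder G t l -> rder (fun s => k * G s) t (k * l).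
Proof.
move=> dG; have := rderM (rder_cst k t) dG.
by rewrite mul0r add0r.
Qed.

Lemma cont0D G H : cont0 G -> cont0 H -> cont0 (fun s => G s + H s).
Proof. by move=> cG cH t t0; apply: cvgD; [exact: cG|exact: cH]. Qed.

Lemma cont0M G H : cont0 G -> cont0 H -> cont0 (fun s => G s * H s).
Proof. by move=> cG cH t t0; apply: cvgM; [exact: cG|exact: cH]. Qed.

Lemma cont0_cst k : cont0 (fun=> k).
Proof. by move=> t t0; exact: cvg_cst. Qed.

Lemma cont0Z k G : cont0 G -> cont0 (fun s => k * G s).
Proof. by move=> cG; apply: cont0M => //; exact: cont0_cst. Qed.

Lemma cont0N G : cont0 G -> cont0 (fun s => - G s).
Proof. by move=> cG t t0; apply: cvgN; exact: cG. Qed.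

Lemma cont0_id : cont0 id.
Proof.
move=> t t0 /=; apply: cvg_within_filter; exact: cvg_id.
Qed.

Lemma dini_barrier G a C : 0 <= a -> cont0 G ->
  (forall t, a <= t -> C <= G t -> udini G t 0) ->
  forall t, a <= t -> G t <= Num.max (G a) C.
Proof.
move=> a0 cG dG t at_; pose m := Num.max (G a) C; rewrite -/m.
rewrite -subr_le0; apply: (@dini_le0 (fun s => G s + - m) a t) => //.
- by apply: cont0D => //; exact: cont0_cst.
- by rewrite subr_le0 le_max lexx.
move=> s /andP[as_ _] Gs; rewrite -[0]addr0; apply: udiniD; last exact: udini_cst.
by apply: dG => //; apply: (@le_trans _ _ m); [rewrite le_max lexx orbT|rewrite -subr_ge0].
Qed.

Lemma dini_noninc G a : 0 <= a -> cont0 G ->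
  (forall t, a <= t -> udini G t 0) -> forall t, a <= t -> G t <= G a.
Proof.
move=> a0 cG dG t at_; rewrite -[leRHS]maxxx.
by apply: dini_barrier => // s as_ _; exact: dG.
Qed.

(** While [G] exceeds [e] it falls at rate at least [k * e], so [e] is reached by the time
    [a + (G a - e) / (k * e)]; from then on [e] is a barrier. *)
Lemma dini_decay G a k e : 0 <= a -> 0 < k -> 0 < e -> cont0 G ->
  (forall t, a <= t -> udini G t (- k * G t)) ->
  exists2 T, a <= T & forall t, T <= t -> G t <= e.
Proof.
move=> a0 k0 e0 cG dG.
have ke : 0 < k * e by exact: mulr_gt0.
have stay T : a <= T -> G T <= e -> forall t, T <= t -> G t <= e.
  move=> aT GT t Tt.
  have -> : e = Num.max (G T) e by rewrite max_r.
  apply: (@dini_barrier _ T) => // [|s Ts es]; first exact: le_trans aT.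
  apply: udini_le (dG s (le_trans aT Ts)).
  by rewrite mulNr oppr_le0 mulr_ge0 ?ltW// (lt_le_trans e0).
have [Ga|Ga] := leP (G a) e; first by exists a => //; exact: stay.
pose T := a + (G a - e) / (k * e).
have aT : a <= T by rewrite lerDl divr_ge0 ?(ltW ke)// subr_ge0 ltW.
exists T => //; apply: stay => //.
(* Height of [G] above the line of slope [- k * e] through [G a], which meets the level [e] at time
   [T]. Where [B] is nonnegative before [T], [G] is still at least [e]. *)
pose B s := G s + (k * e * (s - a) - G a).
suff : B T <= 0.
  rewrite /B /T addrAC subrr add0r [k * e * _]mulrC divfK ?gt_eqF//; lra.
apply: (@dini_le0 B a T) => //.
- apply: cont0D => //; apply: cont0D; last exact: cont0_cst.
  apply: cont0Z; apply: cont0D; [exact: cont0_id|exact: cont0_cst].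
- by rewrite /B subrr mulr0 add0r subrr.
move=> t /andP[at_ tT] Bt; rewrite -[0](subrr (k * e)) addrC.
have eG : e <= G t.
  move: Bt; rewrite /B => Bt; suff : k * e * (t - a) <= G a - e by lra.
  rewrite mulrC -ler_pdivlMr//; rewrite /T in tT; lra.
apply: udiniD.
  apply: udini_le (dG t at_); rewrite mulNr lerN2 ler_pM2l//.
rewrite -[X in udini _ _ X]addr0; apply: udiniD; last exact: udini_cst.
apply: rder_udini; rewrite -[X in rder _ _ X]mulr1; apply: rderZ.
rewrite /rder; apply: cvg_trans (_ : cst 1 @ t^'+ `=>` _); last exact: cvg_cst.
apply: near_eq_cvg; near=> s.
have ts : s - t != 0 by rewrite gt_eqF// subr_gt0; near: s; exact: near_right_gt.
by rewrite /cst opprD opprK addrACA addNr addr0 divff.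
Unshelve. all: by end_near. Qed.

End Dini.

(** * Integration on the line *)

Section RealL2.
Context {R : realType}.
Local Notation mu := (@lebesgue_measure R).
Implicit Types (a b f g m : R -> R) (c d k x y C M L : R).

Lemma aeS (P Q : R -> Prop) : (forall x, P x -> Q x) -> {ae mu, forall x, P x} -> {ae mu, forall x, Q x}.
Proof. move=> PQ. apply: (@filterS _ _ (ae_filter_ringOfSetsType mu)). exact: PQ. Qed.
Lemma aeI (P Q : R -> Prop) : {ae mu, forall x, P x} -> {ae mu, forall x, Q x} -> {ae mu, forall x, P x /\ Q x}.
Proof. move=> hP hQ. exact: (@filterI _ _ (ae_filter_ringOfSetsType mu)). Qed.
Lemma ae_ex (P : R -> Prop) (A : set R) : measurable A -> (0 < mu A)%E -> {ae mu, forall x, P x} -> exists2 x, A x & P x.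
Proof.
move=> mA A0 [N [mN N0 PN]]. apply: contrapT => H.
suff : (mu A <= mu N)%E by rewrite N0 leNgt A0.
apply: le_measure; rewrite ?inE//.
move=> x Ax; apply: PN => /= Px; apply: H; by exists x.
Qed.

Definition itg f := mu.-integrable setT (EFin \o f).
(** Total: the value is 0 by default when the extended integral is infinite. *)
Definition rint f : R := \int[mu]_x f x.

Lemma itg_meas f : itg f -> measurable_fun setT f.
Proof. by move=> /measurable_int/measurable_EFinP. Qed.

Lemma itg_le f g : measurable_fun setT f -> (forall x, `|f x| <= g x) ->
  itg g -> itg f.
Proof.
move=> mf fg ig; apply: (le_integrable measurableT _ _ ig).
  exact/measurable_EFinP.
by move=> x _ /=; rewrite lee_fin (le_trans (fg x))// ler_norm.
Qed.

Lemma itgD f g : itg f -> itg g -> itg (fun x => f x + g x).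
Proof. by move=> hf hg; have := integrableD measurableT hf hg. Qed.

Lemma itgN f : itg f -> itg (fun x => - f x).
Proof. by move=> hf; have := integrableN hf. Qed.

Lemma itgB f g : itg f -> itg g -> itg (fun x => f x - g x).
Proof. by move=> hf hg; apply: itgD => //; exact: itgN. Qed.

Lemma itgZ k f : itg f -> itg (fun x => k * f x).
Proof. by move=> hf; have := integrableZl measurableT k hf. Qed.

Lemma itg_norm f : itg f -> itg (fun x => `|f x|).
Proof. by move=> hf; have := integrable_norm hf. Qed.

Lemma itg0 : itg (fun=> 0).
Proof. exact: integrable0. Qed.

Lemma rintD f g : itg f -> itg g -> rint (fun x => f x + g x) = rint f + rint g.
Proof. by move=> *; rewrite /rint RintegralD. Qed.

Lemma rintB f g : itg f -> itg g -> rint (fun x => f x - g x) = rint f - rint g.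
Proof. by move=> *; rewrite /rint RintegralB. Qed.

Lemma rintZ k f : itg f -> rint (fun x => k * f x) = k * rint f.
Proof. by move=> *; rewrite /rint RintegralZl. Qed.

Lemma rintN f : itg f -> rint (fun x => - f x) = - rint f.
Proof.
move=> hf; rewrite -mulN1r -rintZ//; congr rint; apply/funext => x.
by rewrite mulN1r.
Qed.

Lemma rint_le f g : itg f -> itg g -> (forall x, f x <= g x) -> rint f <= rint g.
Proof. by move=> *; apply: le_Rintegral. Qed.

Lemma rint_ge0 f : (forall x, 0 <= f x) -> 0 <= rint f.
Proof. by move=> *; apply: Rintegral_ge0. Qed.

Lemma rint_norm f : itg f -> `|rint f| <= rint (fun x => `|f x|).
Proof. by move=> *; apply: le_normr_Rintegral. Qed.

Lemma EFin_rint f : itg f -> (rint f)%:E = (\int[mu]_x (f x)%:E)%E.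
Proof. by move=> hf; rewrite fineK//; exact: integrable_fin_num. Qed.

Lemma rint0 : rint (fun=> 0) = 0.
Proof. by rewrite /rint /Rintegral integral0. Qed.

Lemma ae_eq_rint f g : measurable_fun setT f -> measurable_fun setT g ->
  {ae mu, forall x, f x = g x} -> rint f = rint g.
Proof.
move=> mf mg fg; congr fine; apply: ae_eq_integral => //; try exact/measurable_EFinP.
by apply: aeS fg => x /= -> _.
Qed.

Lemma itg_restrictP f (D : set R) : measurable D ->
  mu.-integrable D (EFin \o f) <-> itg (f \_ D).
Proof.
move=> mD; have h := integrable_restrict mu mD measurableT (EFin \o f).
by rewrite /itg -restrict_EFin -h setTI.
Qed.

Definition L2r a := measurable_fun setT a /\ itg (fun x => a x ^+ 2).

Lemma L2r_M a b : L2r a -> L2r b -> itg (fun x => a x * b x).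
Proof.
move=> [ma ia] [mb ib]; apply: (itg_le _ _ (itgD ia ib)).
  exact: measurable_funM.
move=> x; rewrite ler_norml; apply/andP; split.
  have := sqr_ge0 (a x + b x); have := sqr_ge0 (a x); have := sqr_ge0 (b x).
  rewrite sqrrD; lra.
have := sqr_ge0 (a x - b x); have := sqr_ge0 (a x); have := sqr_ge0 (b x).
rewrite sqrrB; lra.
Qed.

Lemma L2r_le a b : measurable_fun setT a -> (forall x, `|a x| <= `|b x|) ->
  L2r b -> L2r a.
Proof.
move=> ma ab [mb ib]; split => //; apply: (itg_le _ _ ib).
  exact: measurable_funX.
by move=> x; rewrite normrX -(real_normK (num_real (b x))) ler_pXn2r ?nnegrE.
Qed.

Lemma L2rD a b : L2r a -> L2r b -> L2r (fun x => a x + b x).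
Proof.
move=> ha hb; have [[ma ia] [mb ib]] := (ha, hb); split.
  exact: measurable_funD.
have -> : (fun x => (a x + b x) ^+ 2) =
   (fun x => a x ^+ 2 + (2 * (a x * b x) + b x ^+ 2)).
  by apply/funext => x; ring.
by apply: itgD => //; apply: itgD => //; apply: itgZ; exact: L2r_M.
Qed.

Lemma L2rM m a C : measurable_fun setT m -> (forall x, `|m x| <= C) -> L2r a ->
  L2r (fun x => m x * a x).
Proof.
move=> mm mC [ma ia]; split; first exact: measurable_funM.
apply: (itg_le _ _ (itgZ (C ^+ 2) ia)).
  by apply: measurable_funX; exact: measurable_funM.
move=> x; rewrite normrX normrM exprMn.
rewrite [leRHS](_ : _ = C ^+ 2 * `|a x| ^+ 2).
  apply: ler_wpM2r; first exact: sqr_ge0.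
  by rewrite ler_pXn2r ?nnegrE// (le_trans _ (mC x)).
by rewrite real_normK ?num_real.
Qed.

Lemma L2rZ k a : L2r a -> L2r (fun x => k * a x).
Proof. by apply: (@L2rM (fun=> k) a `|k|). Qed.

Lemma L2rN a : L2r a -> L2r (fun x => - a x).
Proof.
move=> /(L2rZ (-1)); congr L2r; apply/funext => x; by rewrite mulN1r.
Qed.

Lemma L2r0 : L2r (fun=> 0).
Proof. by split => //; under eq_fun do rewrite expr0n; exact: itg0. Qed.

Definition locint a := measurable_fun setT a /\
  forall c, mu.-integrable `[- c, c] (EFin \o a).

(** On a bounded interval [|a| <= 1 + a^2] is integrable. *)
Lemma L2r_locint a : L2r a -> locint a.
Proof.
move=> [ma ia]; split => // c.
pose q x := a x ^+ 2; pose l (x : R) : R := 1.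
have h : mu.-integrable `[- c, c]
    ((EFin \o l) \+ (EFin \o q))%E.
  apply: integrableD => //.
    apply: measurable_bounded_integrable => //.
      exact: compact_finite_measure (@segment_compact _ _ _).
      exact: measurable_cst.
    exact: bounded_cst.
  exact: integrableS ia.
apply: (le_integrable _ _ _ h) => //.
- by apply/measurable_EFinP; apply: measurable_funS ma.
- move=> x _ /=; rewrite lee_fin [leRHS]ger0_norm; last by rewrite addr_ge0// sqr_ge0.
  have := sqr_ge0 (`|a x| - 1); have := sqr_ge0 (`|a x|).
  rewrite /l /q sqrrB -[a x ^+ 2]real_normK ?num_real// expr1n; lra.
Qed.

Lemma locint_itv a c d : locint a -> mu.-integrable `[c, d] (EFin \o a).
Proof.
move=> [ma ia]; apply: integrableS (ia (`|c| + `|d|)) => //.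
move=> x /=; rewrite !in_itv/= => /andP[cx xd]; apply/andP; split.
  by rewrite lerNl; have := ler_norm (- c); rewrite normrN; have := normr_ge0 d; lra.
by have := ler_norm d; have := normr_ge0 c; lra.
Qed.

Lemma locint_locally a : locint a -> locally_integrable setT a.
Proof.
move=> ha; split => //; [exact: ha.1|exact: openT|] => K _ cK.
have [M [_ /(_ (M + 1))]] := compact_bounded cK.
rewrite ltrDl ltr01 => /(_ isT) KM.
have /integrableP[_] := ha.2 (M + 1).
apply: le_lt_trans; apply: ge0_subset_integral => //=.
- exact: compact_measurable.
- apply/measurable_EFinP; apply: measurableT_comp => //; apply: measurable_funS ha.1 => //.
- by move=> x /KM; rewrite /= in_itv/= -ler_norml.
Qed.

(** One constant [C] bounds both the values and the support of [m], the form in which [C1c_bound]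
    describes a test function. *)
Lemma locint_bddM m a C : measurable_fun setT m -> (forall x, `|m x| <= C) ->
  (forall x, C < `|x| -> m x = 0) -> locint a -> itg (fun x => m x * a x).
Proof.
move=> mm mC m0 [ma ia].
apply: (@itg_le _ (fun x => C * `|(a \_ `[- C, C]) x|)).
- exact: measurable_funM.
- move=> x; rewrite normrM /patch; case: ifPn => [_|].
    by rewrite ler_wpM2r.
  rewrite notin_setE/= in_itv/= -ler_norml => /negP; rewrite -ltNge => Cx.
  by rewrite m0// normr0 mul0r mulr_ge0// (le_trans _ (mC x)).
apply: itgZ; apply: itg_norm; exact: ((itg_restrictP _ _).1 (ia C)).
Qed.

End RealL2.

(** * Weak derivatives in one variable *)

Section Box.
Context {R : realType}.
Implicit Types (F : R -> R) (x y c k p q l C : R).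

Lemma lip_continuous F C : (forall x y, `|F y - F x| <= C * `|y - x|) ->
  continuous F.
Proof.
move=> lF x; apply/cvgrPdist_lt => /= e e0.
have C0 : 0 < `|C| + 1 by rewrite ltr_wpDl.
exists (e / (`|C| + 1)) => /=; first exact: divr_gt0.
move=> y /=; rewrite ltr_pdivlMr// => yx; rewrite distrC.
apply: le_lt_trans (lF x y) _; apply: le_lt_trans yx.
rewrite mulrC distrC; apply: ler_wpM2l => //; have := ler_norm C; lra.
Qed.

(** A quadratic remainder is an inequality that can be checked by cases on signs; the cut-offs,
    built from absolute values, are differentiated in this way. *)
Lemma quad_is_derive F x l C :
  (forall y, `|F y - F x - l * (y - x)| <= C * (y - x) ^+ 2) -> is_derive x 1 F l.
Proof.
move=> qF.
have H : (fun h => h^-1 *: ((F \o shift x) (h *: (1 : R)) - F x)) @ 0^' --> l.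
  have C0 : 0 < `|C| + 1 by rewrite ltr_wpDl.
  apply/cvgrPdist_lt => /= e e0; exists (e / (`|C| + 1)) => /=; first exact: divr_gt0.
  move=> h /=; rewrite sub0r normrN ltr_pdivlMr// => he h0.
  have h0' : 0 < `|h| by rewrite normr_gt0.
  rewrite -(ltr_pM2r h0') -normrM.
  rewrite (_ : _ * h = - (F (h + x) - F x - l * (h + x - x))); last first.
    rewrite /GRing.scale/= mulr1 mulrBl [h^-1 * _]mulrC divfK// addrK; ring.
  rewrite normrN; apply: le_lt_trans (qF _) _.
  rewrite addrK -(real_normK (num_real h)) expr2 mulrA ltr_pM2r//.
  apply: le_lt_trans he; rewrite mulrC; apply: ler_wpM2l => //.
  have := ler_norm C; lra.
by apply: DeriveDef; [apply: cvgP H|exact: cvg_lim H].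
Qed.

(** An antiderivative of [|x|]. Half the second difference of [|x|] is the hat function [tent],
    supported in [[-1, 1]] with height and integral 1; the same operation on [halfsq] gives, up to a
    constant, its primitive [step], a C^1 passage from 0 to 1. *)
Definition halfsq x : R := x * `|x| / 2.
Definition tent x : R := (`|x + 1| - 2 * `|x| + `|x - 1|) / 2.
Definition step x : R := (1 + (halfsq (x + 1) - 2 * halfsq x + halfsq (x - 1))) / 2.

Lemma halfsq_quad x y :
  `|halfsq y - halfsq x - `|x| * (y - x)| <= (y - x) ^+ 2 / 2.
Proof.
rewrite ler_norml /halfsq.
have := sqr_ge0 x; have := sqr_ge0 y; have := sqr_ge0 (y - x); rewrite !expr2.
have [x0|x0] := leP 0 x; have [y0|y0] := leP 0 y;
  rewrite ?(ger0_norm x0) ?(ltr0_norm x0) ?(ger0_norm y0) ?(ltr0_norm y0) => ? ? ?.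
- by apply/andP; split; lra.
- by have := mulr_ge0_le0 x0 (ltW y0) => ?; apply/andP; split; lra.
- by have := mulr_ge0_le0 y0 (ltW x0) => ?; apply/andP; split; lra.
- by apply/andP; split; lra.
Qed.

Lemma step_quad x y : `|step y - step x - tent x * (y - x)| <= (y - x) ^+ 2.
Proof.
have := halfsq_quad x y; have := halfsq_quad (x + 1) (y + 1).
have := halfsq_quad (x - 1) (y - 1).
have -> : y - 1 - (x - 1) = y - x by ring.
have -> : y + 1 - (x + 1) = y - x by ring.
rewrite /step /tent !ler_norml => /andP[h1 h2] /andP[h3 h4] /andP[h5 h6].
by apply/andP; split; lra.
Qed.

Lemma tent_lip x y : `|tent y - tent x| <= 2 * `|y - x|.
Proof.
have n1 c : `| `|y + c| - `|x + c| | <= `|y - x|.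
  apply: le_trans (ler_dist_dist _ _) _; rewrite (_ : y + c - (x + c) = y - x)//; ring.
have := n1 0; have := n1 1; have := n1 (- 1); rewrite !addr0 /tent !ler_norml.
move=> /andP[h1 h2] /andP[h3 h4] /andP[h5 h6].
by apply/andP; split; lra.
Qed.

Lemma tent_ge0 x : 0 <= tent x.
Proof.
rewrite /tent; have := ler_normD (x + 1) (x - 1).
rewrite (_ : x + 1 + (x - 1) = 2 * x); last by ring.
rewrite normrM ger0_norm//; lra.
Qed.

Lemma tent_le1 x : tent x <= 1.
Proof.
rewrite /tent; have := ler_normD x 1; have := ler_normD x (- 1).
rewrite normrN normr1; lra.
Qed.

Lemma tent0 x : 1 <= `|x| -> tent x = 0.
Proof.
rewrite /tent; have [x0|x0] := leP 0 x.
  by rewrite (ger0_norm x0) => h; rewrite !ger0_norm; lra.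
by rewrite (ltr0_norm x0) => h; rewrite !ler0_norm; lra.
Qed.

Lemma step1 x : 1 <= x -> step x = 1.
Proof. by move=> h; rewrite /step /halfsq !ger0_norm; lra. Qed.

Lemma step0 x : x <= -1 -> step x = 0.
Proof. by move=> h; rewrite /step /halfsq !ler0_norm; lra. Qed.

Lemma step_is_derive x : is_derive x 1 step (tent x).
Proof.
by apply: (@quad_is_derive _ _ _ 1) => y; rewrite mul1r; exact: step_quad.
Qed.

Lemma step_homo x y : x <= y -> step x <= step y.
Proof.
have d z : derivable step z 1 by have [] := step_is_derive z.
move=> xy; apply: (@ger0_derive1_le_cc _ step x y) => //.
- by move=> z _; rewrite derive1E (@derive_val _ _ _ _ _ _ _ (step_is_derive z)) tent_ge0.
- by apply: derivable_within_continuous => z _; exact: d.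
- by rewrite in_itv/= lexx.
- by rewrite in_itv/= lexx xy.
Qed.

Lemma step_ge0 x : 0 <= step x.
Proof.
have [x1|x1] := leP x (-1); first by rewrite step0.
by rewrite -(@step0 (-1))//; apply: step_homo; exact: ltW.
Qed.

Lemma step_le1 x : step x <= 1.
Proof.
have [x1|x1] := leP 1 x; first by rewrite step1.
by rewrite -(@step1 1)//; apply: step_homo; exact: ltW.
Qed.

(* Equals 1 on [p, q] and 0 outside [p - 2/k, q + 2/k]. *)
Definition box p q k x : R := step (k * (x - p) + 1) - step (k * (x - q) - 1).
Definition dbox p q k x : R :=
  k * tent (k * (x - p) + 1) - k * tent (k * (x - q) - 1).

Lemma box_is_derive p q k x : is_derive x 1 (box p q k) (dbox p q k x).
Proof.
apply: (@quad_is_derive _ _ _ (2 * k ^+ 2)) => y.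
have := step_quad (k * (x - p) + 1) (k * (y - p) + 1).
have := step_quad (k * (x - q) - 1) (k * (y - q) - 1).
have -> : (k * (y - p) + 1) - (k * (x - p) + 1) = k * (y - x) by ring.
have -> : (k * (y - q) - 1) - (k * (x - q) - 1) = k * (y - x) by ring.
rewrite /box /dbox !ler_norml exprMn => /andP[h1 h2] /andP[h3 h4].
by apply/andP; split; lra.
Qed.

Lemma derive1_box p q k : derive1 (box p q k) = dbox p q k.
Proof.
apply/funext => x; rewrite derive1E.
exact: (@derive_val _ _ _ _ _ _ _ (box_is_derive p q k x)).
Qed.

Lemma dbox_continuous p q k : continuous (dbox p q k).
Proof.
apply: (@lip_continuous _ (4 * k ^+ 2)) => x y; rewrite /dbox.
have := tent_lip (k * (x - p) + 1) (k * (y - p) + 1).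
have := tent_lip (k * (x - q) - 1) (k * (y - q) - 1).
have -> : (k * (y - p) + 1) - (k * (x - p) + 1) = k * (y - x) by ring.
have -> : (k * (y - q) - 1) - (k * (x - q) - 1) = k * (y - x) by ring.
move=> h1 h2.
rewrite [X in `|X|](_ : _ = k * (tent (k * (y - p) + 1) - tent (k * (x - p) + 1))
  - k * (tent (k * (y - q) - 1) - tent (k * (x - q) - 1))); last by ring.
apply: le_trans (ler_normB _ _) _; rewrite !normrM.
rewrite -(real_normK (num_real k)).
rewrite normrM in h1; rewrite normrM in h2.
have := ler_wpM2l (normr_ge0 k) h1; have := ler_wpM2l (normr_ge0 k) h2; lra.
Qed.

Lemma box1 p q k x : 0 < k -> p <= x <= q -> box p q k x = 1.
Proof.
move=> k0 /andP[px xq]; rewrite /box step1 ?step0 ?subr0//.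
  have : k * (x - q) <= 0 by rewrite pmulr_rle0// subr_le0.
  lra.
by rewrite lerDr mulr_ge0 ?subr_ge0// ltW.
Qed.

Lemma box0 p q k x : 0 < k -> p <= q -> x <= p - 2 / k \/ q + 2 / k <= x ->
  box p q k x = 0.
Proof.
move=> k0 pq [xp|qx]; rewrite /box.
  have h : k * (x - p) <= -2 by rewrite mulrC -ler_pdivlMr//; lra.
  rewrite !step0 ?subrr//; last by lra.
  have : k * (x - q) <= k * (x - p) by rewrite ler_pM2l//; lra.
  lra.
have h : 2 <= k * (x - q) by rewrite mulrC -ler_pdivrMr//; lra.
rewrite !step1 ?subrr//; first by lra.
have : k * (x - q) <= k * (x - p) by rewrite ler_pM2l//; lra.
lra.
Qed.

Lemma box_ge0 p q k x : 0 < k -> p <= q -> 0 <= box p q k x.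
Proof.
move=> k0 pq; rewrite subr_ge0; apply: step_homo.
have : k * (x - q) <= k * (x - p) by rewrite ler_pM2l//; lra.
lra.
Qed.

Lemma box_le1 p q k x : box p q k x <= 1.
Proof. by rewrite /box; have := step_le1 (k * (x - p) + 1); have := step_ge0 (k * (x - q) - 1); lra. Qed.

Lemma dbox_le p q k x : 0 <= k -> `|dbox p q k x| <= k.
Proof.
move=> k0; rewrite /dbox ler_norml.
have := ler_wpM2l k0 (tent_ge0 (k * (x - p) + 1)).
have := ler_wpM2l k0 (tent_ge0 (k * (x - q) - 1)).
have := ler_wpM2l k0 (tent_le1 (k * (x - p) + 1)).
have := ler_wpM2l k0 (tent_le1 (k * (x - q) - 1)).
by move=> h1 h2 h3 h4; apply/andP; split; lra.
Qed.

Lemma dbox0 p q k x : 0 < k -> p <= x <= q -> dbox p q k x = 0.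
Proof.
move=> k0 /andP[px xq].
have : 0 <= k * (x - p) by rewrite mulr_ge0 ?subr_ge0// ltW.
have : k * (x - q) <= 0 by rewrite pmulr_rle0// subr_le0.
move=> h1 h2; rewrite /dbox !tent0 ?mulr0 ?subrr//.
  by rewrite ler_normr; apply/orP; right; lra.
by rewrite ler_normr; apply/orP; left; lra.
Qed.

Lemma box_C1c (Om : set R) p q k : 0 < k -> p <= q ->
  `[p - 2 / k, q + 2 / k] `<=` Om -> C1c Om (box p q k).
Proof.
move=> k0 pq sub; split.
- by move=> x; have [] := box_is_derive p q k x.
- by rewrite derive1_box; exact: dbox_continuous.
exists `[p - 2 / k, q + 2 / k]; split => //; first exact: segment_compact.
move=> x; rewrite /= in_itv/= => /negP; rewrite negb_and -!ltNge => /orP[h|h].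
  by apply: box0 => //; left; exact: ltW.
by apply: box0 => //; right; exact: ltW.
Qed.

End Box.

(** * Test functions, and kernels that recover values at Lebesgue points *)

Section WeakDerivative.
Context {R : realType}.
Local Notation mu := (@lebesgue_measure R).
Implicit Types (a b : R -> R) (x y s t c d k C : R) (Om : set R).

Lemma continuous_measurableT (f : R -> R) : continuous f -> measurable_fun setT f.
Proof. exact: continuous_measurable_fun. Qed.

Lemma C1c_cont Om (th : R -> R) : C1c Om th -> continuous th.
Proof.
move=> [dth _ _] x; apply: differentiable_continuous; apply/derivable1_diffP.
exact: dth.
Qed.

Lemma derive1_out (K : set R) (th : R -> R) x : compact K ->
  (forall y, ~ K y -> th y = 0) -> ~ K x -> derive1 th x = 0.
Proof.
move=> cK th0 nK; rewrite derive1E.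
have oK : open (~` K) by apply: closed_openC; apply: compact_closed.
have : \near x, th x = (cst 0 : R -> R) x.
  have := open_nbhs_nbhs (conj oK nK); apply: filterS => y /= ny; exact: th0.
by move=> /near_eq_derive -> //; rewrite derive_cst.
Qed.

Lemma C1c_out Om (th : R -> R) x : C1c Om th -> ~ Om x -> th x = 0 /\ derive1 th x = 0.
Proof.
move=> [_ _ [K [cK KO th0]]] nO; have nK : ~ K x by move=> /KO.
by split; [exact: th0|exact: derive1_out th0 nK].
Qed.

Lemma C1c_bound Om (th : R -> R) : C1c Om th -> exists2 C, 0 < C &
  [/\ forall x, `|th x| <= C, forall x, `|derive1 th x| <= C,
      forall x, C < `|x| -> th x = 0 & forall x, C < `|x| -> derive1 th x = 0].
Proof.
move=> cth; have [dth cdth [K [cK _ th0]]] := cth.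
have bnd (f : R -> R) : continuous f -> exists M : R, forall x, K x -> `|f x| <= M.
  move=> cf; have cf' : {within K, continuous f} by apply: continuous_subspaceT.
  have [M [_ HM]] := compact_bounded (continuous_compact cf' cK).
  by exists (M + 1) => x Kx; apply: HM; [rewrite ltrDl|exists x].
have [M1 H1] := bnd _ (C1c_cont cth).
have [M2 H2] := bnd _ cdth.
have [M3 H3] := bnd id (fun x => cvg_id).
have dth0 x : ~ K x -> derive1 th x = 0 by exact: derive1_out.
exists (`|M1| + `|M2| + `|M3| + 1); first by rewrite ltr_wpDl.
have [[n1 n2] n3] := (ler_norm M1, ler_norm M2, ler_norm M3).
have [[p1 p2] p3] := (normr_ge0 M1, normr_ge0 M2, normr_ge0 M3).
split=> x.
- have [Kx|nKx] := pselect (K x); first by have := H1 x Kx; lra.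
  rewrite th0// normr0; lra.
- have [Kx|nKx] := pselect (K x); first by have := H2 x Kx; lra.
  rewrite dth0// normr0; lra.
- move=> h; apply: th0 => Kx; have := H3 x Kx; lra.
- move=> h; apply: dth0 => Kx; have := H3 x Kx; lra.
Qed.

(** For [|c| <= 1] this kernel has mass 1 and is supported within [2 / k] of [s]. With [c = 1] it
    lies to the left of [s] and with [c = -1] to the right, as the two halves of [dbox] do; the
    centred kernel [c = 0] serves in [sup_bound]. *)
Lemma tentk_cont k s c : continuous (fun x => k * tent (k * (x - s) + c)).
Proof.
apply: (@lip_continuous _ _ (2 * k ^+ 2)) => x y.
rewrite -mulrBr normrM -(real_normK (num_real k)) expr2.
have := tent_lip (k * (x - s) + c) (k * (y - s) + c).
have -> : (k * (y - s) + c) - (k * (x - s) + c) = k * (y - x) by ring.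
rewrite normrM => h; have := ler_wpM2l (normr_ge0 k) h; lra.
Qed.

Lemma tentk0 k s c x : 0 < k -> `|c| <= 1 -> 2 / k <= `|x - s| ->
  k * tent (k * (x - s) + c) = 0.
Proof.
move=> k0 c1 h; rewrite tent0 ?mulr0//.
have h' : 2 <= `|k * (x - s)|.
  by rewrite normrM gtr0_norm// mulrC -ler_pdivrMr.
have := ler_normB (k * (x - s) + c) c; rewrite addrK; lra.
Qed.

Lemma tentk_itg k s c a : 0 < k -> `|c| <= 1 -> locint a ->
  itg (fun x => k * tent (k * (x - s) + c) * a x).
Proof.
move=> k0 c1 la.
apply: (@locint_bddM _ _ _ (k + `|s| + 2 / k)) => //.
- by apply: continuous_measurableT; exact: tentk_cont.
- move=> x; rewrite ger0_norm; last by rewrite mulr_ge0 ?tent_ge0// ltW.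
  have := ler_wpM2l (ltW k0) (tent_le1 (k * (x - s) + c)).
  have := normr_ge0 s; have : 0 <= 2 / k by rewrite divr_ge0// ltW.
  lra.
move=> x h; apply: tentk0 => //.
have := ler_normD (x - s) s; rewrite subrK; lra.
Qed.

Lemma tentk_int k s c : 0 < k -> `|c| <= 1 ->
  rint (fun x => k * tent (k * (x - s) + c)) = 1.
Proof.
move=> k0 c1.
have sk : s - 2 / k < s + 2 / k.
  have : 0 < 2 / k by rewrite divr_gt0.
  lra.
pose D : set R := `[s - 2 / k, s + 2 / k].
have -> : rint (fun x => k * tent (k * (x - s) + c)) =
   \int[mu]_(x in D) (k * tent (k * (x - s) + c)).
  rewrite Rintegral_mkcond; congr rint; apply/funext => x; rewrite /patch.
  case: ifPn => //; rewrite notin_setE /D /= in_itv/= => /negP.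
  rewrite -ler_distl -ltNge => h; by rewrite tentk0// ltW.
have d x : is_derive x 1 (fun x => step (k * (x - s) + c)) (k * tent (k * (x - s) + c)).
  apply: (@quad_is_derive _ _ _ _ (k ^+ 2)) => y.
  have := step_quad (k * (x - s) + c) (k * (y - s) + c).
  have -> : (k * (y - s) + c) - (k * (x - s) + c) = k * (y - x) by ring.
  by rewrite exprMn mulrA [tent _ * k]mulrC.
rewrite /Rintegral (@continuous_FTC2 _ _ (fun x => step (k * (x - s) + c)))//.
- rewrite -EFinB/= step1 ?step0 ?subr0//.
    rewrite addrAC subrr add0r mulrN mulrC divfK ?gt_eqF//.
    by move: c1; rewrite ler_norml => /andP[]; lra.
  rewrite addrAC subrr add0r mulrC divfK ?gt_eqF//.
  by move: c1; rewrite ler_norml => /andP[]; lra.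
- by apply: continuous_subspaceT; exact: tentk_cont.
- have cs x : {for x, continuous (fun x => step (k * (x - s) + c))}.
    apply: differentiable_continuous; apply/derivable1_diffP.
    by have [] := d x.
  split; [by move=> x _; have [] := d x| |].
    by apply: cvg_at_right_filter; exact: cs.
  by apply: cvg_at_left_filter; exact: cs.
- by move=> x _; rewrite derive1E; exact: (@derive_val _ _ _ _ _ _ _ (d x)).
Qed.

Lemma locint_cst c : locint (fun=> c).
Proof.
split; first exact: measurable_cst.
move=> r; apply: measurable_bounded_integrable => //.
- exact: compact_finite_measure (@segment_compact _ _ _).
- exact: bounded_cst.
Qed.

(** The kernel is at most [k] and vanishes outside the ball of radius [3 / k], whose measure is
    [6 / k]. Its pairing with [a - a s] is thus at most 6 times the mean oscillation of [a] on that
    ball, which tends to 0 at a Lebesgue point. *)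
Lemma tentk_cvg a s c : locint a -> lebesgue_pt a s -> `|c| <= 1 ->
  rint (fun x => n.+1%:R * tent (n.+1%:R * (x - s) + c) * a x)
    @[n --> \oo] --> a s.
Proof.
move=> la ls c1; apply/cvgrPdist_le => e e0.
have e6 : 0 < e / 6 by rewrite divr_gt0.
have : \forall r \near (0:R)^'+, (davg a s r <= (e / 6)%:E)%E.
  have := ls; rewrite /lebesgue_pt => /fine_cvgP[finA].
  move=> /cvgrPdist_le /(_ _ e6) H; near=> r.
  have fA : davg a s r \is a fin_num by near: r.
  rewrite -(fineK fA) lee_fin.
  have : `|fine 0%E - fine (davg a s r)| <= e / 6 by near: r.
  by rewrite /= sub0r normrN; apply: le_trans; exact: ler_norm.
rewrite /at_right near_withinE => -[d /= d0 H].
have : \forall n \near \oo, 3 / d < n%:R :> R by exact: nbhs_infty_gtr.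
apply: filterS => n hn.
set k : R := n.+1%:R; have k0 : 0 < k by rewrite ltr0n.
have kd : 3 / k < d.
  rewrite ltr_pdivrMr// mulrC -ltr_pdivrMr//; apply: (lt_trans hn).
  by rewrite ltr_nat.
have k3 : 0 < 3 / k by rewrite divr_gt0.
clearbody k.
have la' : locint (fun x => a x - a s).
  split; first by apply: measurable_funB; [exact: la.1|exact: measurable_cst].
  move=> r; exact: (integrableB _ (la.2 r) ((locint_cst (a s)).2 r)).
have one := locint_cst 1.
have ik : itg (fun x => k * tent (k * (x - s) + c)).
  by have := tentk_itg s k0 c1 one; under eq_fun do rewrite mulr1.
have -> : a s - rint (fun x => k * tent (k * (x - s) + c) * a x) =
   - rint (fun x => k * tent (k * (x - s) + c) * (a x - a s)).
  rewrite -[X in X - _ = _]mulr1 -(tentk_int s k0 c1) -rintZ// -rintB; last 2 first.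
  - exact: itgZ.
  - exact: tentk_itg.
  rewrite -rintN; first by congr rint; apply/funext => x; ring.
  exact: tentk_itg.
rewrite normrN; apply: le_trans (rint_norm _) _; first exact: tentk_itg.
pose B := ball s (3 / k).
have mB : measurable B by exact: measurable_ball.
have iB : mu.-integrable B (EFin \o (fun x => a x - a s)).
  have key x : `|x - s| < 3 / k -> `|x| <= `|s| + 3 / k.
    by have := ler_normD (x - s) s; rewrite subrK; lra.
  have := la'.2 (`|s| + 3 / k); apply: integrableS => //.
  by move=> x; rewrite /B /ball/= in_itv/= -ler_norml distrC; exact: key.
have iB' : itg (fun x => k * `|((fun x => a x - a s) \_ B) x|).
  by apply: itgZ; apply: itg_norm; apply: (itg_restrictP _ mB).1.
apply: (@le_trans _ _ (rint (fun x => k * `|((fun x => a x - a s) \_ B) x|))).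
  apply: rint_le => //; first by apply: itg_norm; exact: tentk_itg.
  move=> x; rewrite normrM /patch; case: ifPn => [_|].
    rewrite ger0_norm; last by rewrite mulr_ge0 ?tent_ge0// ltW.
    apply: ler_wpM2r => //.
    by have := ler_wpM2l (ltW k0) (tent_le1 (k * (x - s) + c)); rewrite mulr1.
  rewrite notin_setE /B /ball/= distrC => /negP; rewrite -leNgt => h.
  rewrite tentk0 ?normr0 ?mul0r ?mulr_ge0//; first exact: ltW.
  apply: le_trans h; rewrite ler_pM2r ?invr_gt0//; lra.
rewrite rintZ; last by apply: itg_norm; apply: (itg_restrictP _ mB).1.
have := H (3 / k); rewrite /= sub0r normrN gtr0_norm// => /(_ kd k3).
rewrite /davg /iavg lebesgue_measure_ball; last exact: ltW.
rewrite -/B.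
set X := (\int[mu]_(y in B) _)%E.
have -> : X = (rint (fun x => `|((fun x => a x - a s) \_ B) x|))%:E.
  rewrite EFin_rint; last by apply: itg_norm; apply: (itg_restrictP _ mB).1.
  rewrite /X integral_mkcond; apply: eq_integral => x _ /=.
  rewrite /patch; case: ifP => //= _.
  by rewrite (_ : point = 0 :> R)// normr0.
rewrite inver mulrn_eq0/= gt_eqF// -EFinM lee_fin.
have -> : (3 / k *+ 2)^-1 = k / 6 by field; rewrite gt_eqF.
lra.
Unshelve. all: by end_near. Qed.

End WeakDerivative.

(** * Dominated convergence and Fubini for real-valued integrals *)

Section IntegralTools.
Context {R : realType}.
Local Notation mu := (@lebesgue_measure R).

Lemma rint_dct (f_ : nat -> R -> R) (f g : R -> R) :
  (forall n, measurable_fun setT (f_ n)) -> measurable_fun setT f ->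
  (forall x, f_ n x @[n --> \oo] --> f x) -> itg g ->
  (forall n x, `|f_ n x| <= g x) -> rint (f_ n) @[n --> \oo] --> rint f.
Proof.
move=> mf_ mf ff ig fg.
have [||||h1 _ h3] := @dominated_convergence _ _ _ mu setT measurableT
  (fun n => EFin \o f_ n) (EFin \o f) (EFin \o g) _ _ _ ig.
- by move=> n; apply/measurable_EFinP; exact: mf_.
- exact/measurable_EFinP.
- apply: aeW => x _; apply/fine_cvgP; split; first exact: nearW.
  exact: ff.
- by apply: aeW => x n _; exact: fg.
move: h3; rewrite -(EFin_rint h1) => /fine_cvgP[_]; exact.
Qed.

(** The inner real-valued integral is known to agree with the extended one for almost every section
    only, since [fine] sends an infinite value to 0; hence the comparison almost everywhere on both
    sides. *)
Lemma rint_fubini (K : R * R -> R) :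
  ((mu \x mu)%E).-integrable setT (EFin \o K) ->
  rint (fun x => rint (fun y => K (x, y))) = rint (fun y => rint (fun x => K (x, y))).
Proof.
move=> iK.
have key1 : (\int[mu]_x \int[mu]_y (K (x, y))%:E)%E =
    (\int[mu]_x (rint (fun y => K (x, y)))%:E)%E.
  have ae1 := ae_integrable1 iK.
  have mF : measurable_fun setT (fun x => \int[mu]_y (K (x, y))%:E)%E.
    exact: (measurable_fubini_F iK).
  apply: ae_eq_integral => //.
    apply/measurable_EFinP; apply: measurableT_comp => //.
  apply: aeS ae1 => x ix _; rewrite EFin_rint//.
have key2 : (\int[mu]_y \int[mu]_x (K (x, y))%:E)%E =
    (\int[mu]_y (rint (fun x => K (x, y)))%:E)%E.
  have ae1 := ae_integrable2 iK.
  have mF : measurable_fun setT (fun y => \int[mu]_x (K (x, y))%:E)%E.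
    exact: (measurable_fubini_G iK).
  apply: ae_eq_integral => //.
    apply/measurable_EFinP; apply: measurableT_comp => //.
  apply: aeS ae1 => x ix _; rewrite EFin_rint//.
by rewrite {1}/rint /Rintegral -key1 (Fubini iK) key2.
Qed.

Lemma itg_fubini (K : R * R -> R) :
  ((mu \x mu)%E).-integrable setT (EFin \o K) ->
  itg (fun x => rint (fun y => K (x, y))).
Proof.
move=> iK; have iF := integrable_fubini_F iK.
have mF := measurable_fubini_F iK.
apply: (le_integrable measurableT _ _ iF).
  by apply/measurable_EFinP; apply: measurableT_comp.
move=> y _ /=; rewrite /rint /Rintegral /fubini_F /=; by case: (X in fine X) => //=; rewrite leey.
Qed.

Lemma itg_prod (K : R * R -> R) (f g : R -> R) :
  measurable_fun setT K -> itg f -> itg g ->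
  (forall x y, `|K (x, y)| <= `|f x| * `|g y|) ->
  ((mu \x mu)%E).-integrable setT (EFin \o K).
Proof.
move=> mK hf hg le.
apply/integrable12ltyP; first exact/measurable_EFinP.
have ig := itg_norm hg; have if_ := itg_norm hf.
have h x : (\int[mu]_y (`|f x| * `|g y|)%:E = (`|f x| * rint (fun y => `|g y|))%:E)%E.
  by rewrite -EFin_rint ?rintZ//; exact: itgZ.
apply: (@le_lt_trans _ _ (\int[mu]_x (`|f x| * rint (fun y => `|g y|))%:E)%E).
  have mK' : measurable_fun setT (fun p => `|(EFin \o K) p|)%E.
    by apply: measurableT_comp => //; exact/measurable_EFinP.
  apply: ge0_le_integral => //.
  - by move=> x _; apply: integral_ge0.
  - by apply: (@measurable_fun_fubini_tonelli_F _ _ _ _ _ mu _ mK').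
  - by apply/measurable_EFinP; apply: measurable_funM => //; exact: itg_meas if_.
  move=> x _; rewrite -h; apply: ge0_le_integral => //.
  - exact: (measurableT_comp mK' (pair1_measurable x)).
  - by apply/measurable_EFinP; apply: measurable_funM => //; exact: itg_meas ig.
  by move=> y _; rewrite /= lee_fin.
under eq_integral do rewrite mulrC.
by rewrite -EFin_rint ?ltry//; exact: itgZ.
Qed.

End IntegralTools.

(** * The fundamental theorem of calculus for weak derivatives *)

Section FTC.
Context {R : realType}.
Local Notation mu := (@lebesgue_measure R).
Implicit Types (a b : R -> R) (x y s t c d k C : R) (Om : set R).

(** The test functions are the plateaus [box s t k]: their derivatives are a kernel at [s] minus a
    kernel at [t] and recover [a s - a t], while the plateaus themselves tend to the indicator of
    [[s, t]]. The margin [d] keeps their supports inside [Om], which is the whole line for space and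
    a bounded interval for time. *)
Lemma wd_FTC Om a a' s t d : 0 < d -> s < t -> `[s - d, t + d] `<=` Om ->
  locint a -> locint a' -> lebesgue_pt a s -> lebesgue_pt a t ->
  (forall th, C1c Om th ->
     rint (fun x => derive1 th x * a x) = - rint (fun x => th x * a' x)) ->
  a t - a s = \int[mu]_(x in `[s, t]) a' x.
Proof.
move=> d0 st sub la la' ls lt wk.
pose k n : R := n.+1%:R.
have k0 n : 0 < k n by rewrite ltr0n.
have k1 n : 1 <= k n by rewrite ler1n.
have ic n : itg (fun x => k n * tent (k n * (x - s) + 1) * a x).
  by apply: tentk_itg => //; rewrite normr1.
have id_ n : itg (fun x => k n * tent (k n * (x - t) - 1) * a x).
  by apply: tentk_itg => //; rewrite normrN normr1.
have c1 : rint (fun x => k n * tent (k n * (x - s) + 1) * a x)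
    - rint (fun x => k n * tent (k n * (x - t) - 1) * a x) @[n --> \oo] --> a s - a t.
  by apply: cvgB; apply: tentk_cvg => //; rewrite ?normrN normr1.
have kn n : n%:R < k n by rewrite ltr_nat.
clearbody k.
(* Since [1 <= k n], this interval contains the supports of all the plateaus; [a'] cut to it is the
   dominating function. *)
pose D : set R := `[s - 2, t + 2].
have mD : measurable D by exact: measurable_itv.
have iD : itg (a' \_ D) by apply: (itg_restrictP _ mD).1; exact: locint_itv.
have c2 : - rint (fun x => box s t (k n) x * a' x) @[n --> \oo] -->
    - \int[mu]_(x in `[s, t]) a' x.
  apply: cvgN; rewrite Rintegral_mkcond.
  have mE : measurable (`[s, t] : set R) by exact: measurable_itv.
  apply: (@rint_dct _ _ _ (fun x => `|(a' \_ D) x|)).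
  - move=> n; apply: measurable_funM; last exact: la'.1.
    apply: continuous_measurableT => x; apply: differentiable_continuous.
    by apply/derivable1_diffP; have [] := box_is_derive s t (k n) x.
  - have h : itg (a' \_ `[s, t]) by apply: (itg_restrictP _ mE).1; exact: locint_itv.
    exact: itg_meas h.
  - move=> x; rewrite /patch; case: ifPn => [|].
      rewrite inE /= in_itv/= => xst.
      by under eq_fun do rewrite box1// mul1r; exact: cvg_cst.
    rewrite notin_setE /= in_itv/= => /negP; rewrite negb_and -!ltNge => xst.
    have [e e0 He] : exists2 e : R, 0 < e & x <= s - e \/ t + e <= x.
      case/orP: xst => h; [exists (s - x)|exists (x - t)]; rewrite ?subr_gt0//.
        by left; lra.
      by right; lra.
    rewrite (_ : point = 0 :> R)//.
    apply: cvg_trans (_ : cst (0 : R) @ \oo `=>` _); last exact: cvg_cst.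
    apply: near_eq_cvg.
    have : \forall n \near \oo, 2 / e < n%:R :> R by exact: nbhs_infty_gtr.
    apply: filterS => n hn.
    have ke : 2 / k n < e.
      rewrite ltr_pdivrMr// mulrC -ltr_pdivrMr//; apply: (lt_trans hn).
      exact: kn.
    rewrite /cst box0 ?mul0r//; first exact: ltW.
    by case: He => h; [left|right]; lra.
  - exact: itg_norm.
  move=> n x; rewrite normrM.
  have b1 : `|box s t (k n) x| <= 1.
    by rewrite ger0_norm ?box_le1// box_ge0// ltW.
  rewrite /patch; case: ifPn => [_|]; first by rewrite ler_piMl.
  rewrite notin_setE /D/= in_itv/= => /negP; rewrite negb_and -!ltNge => xst.
  have k2 : 2 / k n <= 2 by rewrite ler_pdivrMr// ler_peMr.
  rewrite box0 ?normr0 ?mul0r//; first exact: ltW.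
  by case/orP : xst => h; [left|right]; lra.
apply: oppr_inj; rewrite opprB; apply: cvg_unique c1 _; first exact: norm_hausdorff.
apply: cvg_trans c2; apply: near_eq_cvg.
have : \forall n \near \oo, 2 / d < n%:R :> R by exact: nbhs_infty_gtr.
apply: filterS => n hn.
have kd : 2 / k n < d.
  rewrite ltr_pdivrMr// mulrC -ltr_pdivrMr//; apply: (lt_trans hn).
  exact: kn.
have cb : C1c Om (box s t (k n)).
  apply: box_C1c => //; first exact: ltW.
  apply: subset_trans sub => x; rewrite /= !in_itv/= => /andP[h1 h2].
  by apply/andP; split; lra.
rewrite -(wk _ cb) derive1_box -rintB//; congr rint; apply/funext => x.
by rewrite /dbox mulrBl.
Qed.

Definition wd a a' := forall th, C1c setT th ->
  rint (fun x => derive1 th x * a x) = - rint (fun x => th x * a' x).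

(** The good points are the Lebesgue points of [a], which have full measure; no continuous
    representative is chosen. *)
Lemma wd_FTC_ae a a' : L2r a -> L2r a' -> wd a a' ->
  exists2 S : set R, {ae mu, forall x, S x} &
    forall s t, S s -> S t -> s < t -> a t - a s = \int[mu]_(x in `[s, t]) a' x.
Proof.
move=> /L2r_locint la /L2r_locint la' wda.
exists (lebesgue_pt a); first exact: lebesgue_differentiation (locint_locally la).
move=> s t ls lt st; apply: (@wd_FTC setT _ _ _ _ 1) => //.
Qed.

End FTC.

(** * Multipliers and the product rule for weak derivatives *)

Section WeakDerivativeCalculus.
Context {R : realType}.
Local Notation mu := (@lebesgue_measure R).
Implicit Types (a b m th : R -> R) (x y s t c d k r C : R).

Lemma C1c_L2r (Om : set R) th : C1c Om th -> L2r th /\ L2r (derive1 th).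
Proof.
move=> cth; have [C C0 [b1 b2 z1 z2]] := C1c_bound cth.
have [_ cd _] := cth.
have l1 := @locint_cst R 1.
have sq (f : R -> R) : measurable_fun setT f -> (forall x, `|f x| <= C) ->
    (forall x, C < `|x| -> f x = 0) -> L2r f.
  move=> mf fC f0; split => //.
  apply: (@itg_le _ _ (fun x => C * `|f x|)).
  - exact: measurable_funX.
  - by move=> x; rewrite normrX expr2 ler_wpM2r.
  apply: itgZ; apply: itg_norm.
  by have := locint_bddM mf fC f0 l1; under eq_fun do rewrite mulr1.
by split; apply: sq => //; apply: continuous_measurableT => //; exact: C1c_cont cth.
Qed.

Lemma is_derive1_eq m m' x : is_derive x 1 m (m' x) -> derive1 m x = m' x.
Proof. by move=> h; rewrite derive1E; exact: (@derive_val _ _ _ _ _ _ _ h). Qed.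

(** The class of multipliers: it contains the constants and the cut-offs, is stable under products,
    and preserves L^2 as well as the test functions. *)
Definition C1b m m' := [/\ forall x, is_derive x 1 m (m' x), continuous m' &
  exists C : R, forall x, `|m x| <= C /\ `|m' x| <= C].

Lemma C1b_cont m m' : C1b m m' -> continuous m.
Proof.
move=> [dm _ _] x; apply: differentiable_continuous; apply/derivable1_diffP.
by have [] := dm x.
Qed.

Lemma C1b_L2r m m' a : C1b m m' -> L2r a ->
  L2r (fun x => m x * a x) /\ L2r (fun x => m' x * a x).
Proof.
move=> hm la; have [_ cm' [C bC]] := hm; split; apply: (@L2rM _ _ _ C) => //.
- by apply: continuous_measurableT; exact: C1b_cont hm.
- by move=> x; have [] := bC x.
- exact: continuous_measurableT.
- by move=> x; have [] := bC x.
Qed.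

Lemma C1bM m m' n n' : C1b m m' -> C1b n n' ->
  C1b (fun x => m x * n x) (fun x => m' x * n x + m x * n' x).
Proof.
move=> hm hn; have [dm cm' [C bC]] := hm; have [dn cn' [D bD]] := hn; split.
- move=> x; have := @is_deriveM _ _ m n x 1 _ _ (dm x) (dn x).
  by rewrite addrC /GRing.scale/= [n x * m' x]mulrC.
- move=> x; apply: cvgD; apply: cvgM => //; try exact: cm'; try exact: cn'.
    exact: (C1b_cont hn).
  exact: (C1b_cont hm).
have C0 : 0 <= C by have [h _] := bC 0; exact: le_trans h.
have D0 : 0 <= D by have [h _] := bD 0; exact: le_trans h.
exists (2 * (C * D)) => x; have [h1 h2] := bC x; have [h3 h4] := bD x.
have CD : 0 <= C * D by exact: mulr_ge0.
split.
  rewrite normrM; apply: le_trans (ler_pM _ _ h1 h3) _ => //; lra.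
apply: le_trans (ler_normD _ _) _; rewrite !normrM.
have := ler_pM (normr_ge0 _) (normr_ge0 _) h2 h3.
have := ler_pM (normr_ge0 _) (normr_ge0 _) h1 h4.
lra.
Qed.

Lemma C1b_cst c : C1b (fun=> c) (fun=> 0).
Proof.
split; [by move=> x; exact: is_derive_cst|by move=> x; exact: cvg_cst|].
by exists `|c| => x; rewrite normr0.
Qed.

Lemma box_C1b p q k : 0 < k -> p <= q -> C1b (box p q k) (dbox p q k).
Proof.
move=> k0 pq; split.
- exact: box_is_derive.
- exact: dbox_continuous.
exists (1 + k) => x; split.
  by rewrite ger0_norm ?box_ge0//; have := box_le1 p q k x; lra.
by have := dbox_le p q x (ltW k0); lra.
Qed.

Lemma C1c_C1bM (Om : set R) th m m' : C1c Om th -> C1b m m' ->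
  C1c Om (fun x => th x * m x) /\
  derive1 (fun x => th x * m x) = (fun x => derive1 th x * m x + th x * m' x).
Proof.
move=> cth hm; have [dth cd [K [cK KO th0]]] := cth; have [dm cm' _] := hm.
have d x : is_derive x 1 (fun x => th x * m x) (derive1 th x * m x + th x * m' x).
  have dthx : is_derive x 1 th (derive1 th x).
    by rewrite derive1E; apply: DeriveDef => //; exact: dth.
  have := @is_deriveM _ _ th m x 1 _ _ dthx (dm x).
  by rewrite addrC /GRing.scale/= [m x * _]mulrC.
have E : derive1 (fun x => th x * m x) = (fun x => derive1 th x * m x + th x * m' x).
  by apply/funext => x; apply: (is_derive1_eq (m' := fun x => derive1 th x * m x + th x * m' x)).
split => //; split.
- by move=> x; have [] := d x.
- rewrite E => x; apply: cvgD; apply: cvgM.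
  + exact: cd.
  + exact: (C1b_cont hm).
  + exact: (C1c_cont cth).
  + exact: cm'.
- by exists K; split => // x nK; rewrite th0// mul0r.
Qed.

Lemma wdD a a' b b' : L2r a -> L2r a' -> L2r b -> L2r b' -> wd a a' -> wd b b' ->
  wd (fun x => a x + b x) (fun x => a' x + b' x).
Proof.
move=> la la' lb lb' wa wb th cth; have [l1 l2] := C1c_L2r cth.
under eq_fun do rewrite mulrDr; rewrite rintD; [|exact: L2r_M|exact: L2r_M].
rewrite wa// wb// -opprD -rintD; [|exact: L2r_M|exact: L2r_M].
by congr (- rint _); apply/funext => x; rewrite mulrDr.
Qed.

Lemma wdN a a' : L2r a -> L2r a' -> wd a a' -> wd (fun x => - a x) (fun x => - a' x).
Proof.
move=> la la' wa th cth; have [l1 l2] := C1c_L2r cth.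
under eq_fun do rewrite mulrN; rewrite rintN; last exact: L2r_M.
rewrite wa// -rintN; last exact: L2r_M.
by congr (- rint _); apply/funext => x; rewrite mulrN.
Qed.

(** [th * m] is again a test function; inserting it into the hypothesis on [a] produces the extra
    term [th * m' * a]. *)
Lemma wdM m m' a a' : C1b m m' -> L2r a -> L2r a' -> wd a a' ->
  wd (fun x => m x * a x) (fun x => m' x * a x + m x * a' x).
Proof.
move=> hm la la' wa th cth; have [l1 l2] := C1c_L2r cth.
have [cthm E] := C1c_C1bM cth hm.
have [ma m'a] := C1b_L2r hm la; have [ma' _] := C1b_L2r hm la'.
have := wa _ cthm; rewrite E.
have -> : (fun x => (derive1 th x * m x + th x * m' x) * a x) =
   (fun x => derive1 th x * (m x * a x) + th x * (m' x * a x)).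
  by apply/funext => x; ring.
rewrite rintD; [|exact: L2r_M|exact: L2r_M] => h.
have -> : rint (fun x => th x * (m' x * a x + m x * a' x)) =
   rint (fun x => th x * (m' x * a x)) + rint (fun x => th x * m x * a' x).
  rewrite -rintD; first by congr rint; apply/funext => x; ring.
    exact: L2r_M.
  under eq_fun do rewrite -mulrA; exact: L2r_M.
lra.
Qed.

End WeakDerivativeCalculus.

(** * Integration by parts and the one-dimensional sup norm inequality *)

Section IBP.
Context {R : realType}.
Local Notation mu := (@lebesgue_measure R).
Implicit Types (a b m th : R -> R) (x y s t c d k r C : R).

(** Fubini on the triangle [y <= x]: [b x] is the integral of [b'] up to [x], and integrating [a']
    over [y <= x] first gives [a y0 - a y]. The constant [a y0] drops out because [b'] has integral
    0. *)
Lemma ibp_cpt a a' b b' r : 0 < r -> L2r a -> L2r a' -> L2r b -> L2r b' ->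
  wd a a' -> wd b b' ->
  (forall x, r < `|x| -> b x = 0) -> (forall x, r < `|x| -> b' x = 0) ->
  rint (fun x => a' x * b x) = - rint (fun x => a x * b' x).
Proof.
move=> r0 la la' lb lb' wa wb b0 b'0.
have [Sa aSa FTa] := wd_FTC_ae la la' wa.
have [Sb aSb FTb] := wd_FTC_ae lb lb' wb.
have aS := aeI aSa aSb.
have ex (p q : R) : p < q -> exists x, [/\ p < x < q, Sa x & Sb x].
  move=> pq; have [|x xpq [? ?]] := ae_ex (measurable_itv `]p, q[%R) _ aS.
    by rewrite /= lebesgue_measure_itv/= lte_fin pq -EFinB lte_fin subr_gt0.
  by exists x; split => //; move: xpq; rewrite /= in_itv.
(* [x0] and [y0] are points on either side of the support of [b] at which the fundamental theorem
   holds for both functions. *)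
have [x0 [/andP[_ x0r] ax0 bx0]] : exists x, [/\ - r - 2 < x < - r - 1, Sa x & Sb x].
  by apply: ex; lra.
have [y0 [/andP[y0r _] ay0 by0]] : exists x, [/\ r + 1 < x < r + 2, Sa x & Sb x].
  by apply: ex; lra.
pose D : set R := `[x0, y0].
have mD : measurable D by exact: measurable_itv.
pose ad := a' \_ D.
have iad : itg ad by apply: (itg_restrictP _ mD).1; apply: locint_itv; exact: L2r_locint.
have ib' : itg b'.
  have : itg (b' \_ `[- r, r]).
    by apply: (itg_restrictP _ (measurable_itv _)).1; apply: locint_itv; exact: L2r_locint.
  congr itg; apply/funext => x; rewrite /patch; case: ifPn => //.
  rewrite notin_setE /= in_itv/= -ler_norml => /negP; rewrite -ltNge => h.
  by rewrite b'0.
(* [a'] is cut to [[x0, y0]] to make the kernel integrable; nothing is lost, as [b] vanishes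
   elsewhere. *)
pose K (p : R * R) := ad p.1 * b' p.2 * (p.2 <= p.1)%R%:R.
have mK : measurable_fun setT K.
  apply: measurable_funM.
    apply: measurable_funM.
      exact: (measurableT_comp (itg_meas iad) measurable_fst).
    exact: (measurableT_comp (itg_meas ib') measurable_snd).
  apply: (@measurableT_comp _ _ _ _ _ _ (fun b : bool => b%:R : R)) => //.
  apply: measurable_fun_ler; [exact: measurable_snd|exact: measurable_fst].
have iK : ((mu \x mu)%E).-integrable setT (EFin \o K).
  apply: (itg_prod mK iad ib') => x y; rewrite /K/= !normrM.
  by rewrite ler_piMr ?mulr_ge0//; case: (y <= x); rewrite ?normr1 ?normr0.
have Hx : {ae mu, forall x, rint (fun y => K (x, y)) = a' x * b x}.
  apply: aeS aSb => x Sx.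
  have [xr|rx] := ltP x (- r).
    have nx : r < `|x| by rewrite ler0_norm; lra.
    rewrite b0// mulr0 -rint0; congr rint; apply/funext => y; rewrite /K/=.
    case: (leP y x) => yx; last by rewrite mulr0.
    by rewrite b'0 ?mulr0 ?mul0r// ler0_norm; lra.
  have [xy|yx] := leP x y0; last first.
    have nx : r < `|x| by rewrite ger0_norm; lra.
    rewrite b0// mulr0 -rint0; congr rint; apply/funext => y; rewrite /K/= /ad /patch.
    case: ifPn => [|_]; last by rewrite (_ : point = 0 :> R)// !mul0r.
    by rewrite inE /D/= in_itv/= => /andP[]; lra.
  have -> : b x = \int[mu]_(z in `[x0, x]) b' z.
    rewrite -FTb//; last by lra.
    by rewrite (b0 x0) ?subr0// ler0_norm; lra.
  rewrite Rintegral_mkcond -rintZ; last first.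
    by apply: (itg_restrictP _ (measurable_itv _)).1; apply: locint_itv; exact: L2r_locint.
  congr rint; apply/funext => y; rewrite /K/= /ad /patch.
  rewrite mem_set; last by rewrite /D/= in_itv/=; apply/andP; split; lra.
  case: ifPn => [|].
    by rewrite inE /= in_itv/= => /andP[_ ->]; rewrite mulr1.
  rewrite notin_setE /= in_itv/= => /negP; rewrite negb_and -!ltNge (_ : point = 0 :> R)//.
  case/orP => h; last by rewrite (lt_geF h) !mulr0.
  by rewrite b'0 ?mulr0 ?mul0r// ler0_norm; lra.
have Hy : {ae mu, forall y, rint (fun x => K (x, y)) = a y0 * b' y - a y * b' y}.
  apply: aeS aSa => y Sy.
  have [yr|ry] := ltP r `|y|.
    rewrite b'0// !mulr0 subr0 -rint0; congr rint; apply/funext => x; rewrite /K/=.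
    by rewrite b'0// mulr0 mul0r.
  have /andP[y1 y2] : - r <= y <= r by rewrite -ler_norml.
  rewrite -mulrBl mulrC FTa//; last by lra.
  rewrite Rintegral_mkcond -rintZ; last first.
    by apply: (itg_restrictP _ (measurable_itv _)).1; apply: locint_itv; exact: L2r_locint.
  congr rint; apply/funext => x; rewrite /K/= /ad /patch.
  have -> : (x \in (`[y, y0] : set R)) = (x \in D) && (y <= x).
    apply/idP/idP => [/set_mem|/andP[/set_mem]]; rewrite /D /= !in_itv/=.
      move=> /andP[h1 h2]; rewrite h1 andbT; apply/mem_set.
      by rewrite /= in_itv/= h2 andbT; lra.
    by move=> /andP[_ h1] h2; apply/mem_set; rewrite /= in_itv/= h1 h2.
  rewrite (_ : point = 0 :> R)//.
  case: (x \in D); case: (y <= x) => //=; ring.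
have iab : itg (fun x => a x * b' x) by exact: L2r_M.
transitivity (rint (fun x => rint (fun y => K (x, y)))).
  apply/esym; apply: ae_eq_rint => //; first exact: itg_meas (itg_fubini iK).
  by apply: measurable_funM; [exact: la'.1|exact: lb.1].
rewrite rint_fubini//.
transitivity (rint (fun y => a y0 * b' y - a y * b' y)).
  apply: ae_eq_rint => //.
    have mG := measurable_fubini_G iK.
    by apply: measurableT_comp mG.
  by apply: itg_meas; apply: itgB => //; exact: itgZ.
rewrite rintB//; last exact: itgZ.
rewrite rintZ// (_ : rint b' = 0) ?mulr0 ?sub0r//.
transitivity (\int[mu]_(z in `[x0, y0]) b' z).
  rewrite Rintegral_mkcond; congr rint; apply/funext => y; rewrite /patch.
  case: ifPn => //; rewrite notin_setE /= in_itv/= => /negP; rewrite negb_and -!ltNge.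
  rewrite (_ : point = 0 :> R)// => /orP[h|h]; rewrite b'0//.
    by rewrite ler0_norm; lra.
  by rewrite ger0_norm; lra.
rewrite -FTb//; last by lra.
rewrite !b0 ?subr0//; first by rewrite ler0_norm; lra.
by rewrite ger0_norm; lra.
Qed.

(** [b] is multiplied by plateaus equal to 1 on [[-n, n]] with slope at most 1, which dominated
    convergence then removes. *)
Lemma ibp a a' b b' : L2r a -> L2r a' -> L2r b -> L2r b' -> wd a a' -> wd b b' ->
  rint (fun x => a' x * b x) = - rint (fun x => a x * b' x).
Proof.
move=> la la' lb lb' wa wb.
pose chi n : R -> R := box (- n%:R) n%:R 1.
pose dchi n : R -> R := dbox (- n%:R) n%:R 1.
have np n : - n%:R <= n%:R :> R by have := ler0n R n; lra.
have hc n : C1b (chi n) (dchi n) by exact: box_C1b.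
have eq n : rint (fun x => a' x * (chi n x * b x)) =
   - rint (fun x => a x * (dchi n x * b x + chi n x * b' x)).
  have [l1 l2] := C1b_L2r (hc n) lb; have [l3 _] := C1b_L2r (hc n) lb'.
  have out x : n%:R + 2 < `|x| -> chi n x = 0 /\ dchi n x = 0.
    rewrite /chi /dchi => h; split.
      apply: box0 => //; rewrite divr1; move: h; have [x0|x0] := leP 0 x.
        by rewrite ger0_norm// => h; right; lra.
      by rewrite ltr0_norm// => h; left; lra.
    rewrite /dbox !mul1r !tent0 ?subrr// ler_normr; move: h; have [x0|x0] := leP 0 x.
    + by rewrite ger0_norm// => h; apply/orP; left; lra.
    + by rewrite ltr0_norm// => h; apply/orP; right; have := ler0n R n; lra.
    + by rewrite ger0_norm// => h; apply/orP; left; have := ler0n R n; lra.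
    + by rewrite ltr0_norm// => h; apply/orP; right; have := ler0n R n; lra.
  apply: (@ibp_cpt _ _ _ _ (n%:R + 2)) => //.
  - exact: L2rD.
  - exact: wdM.
  - by move=> x /out[-> _]; rewrite mul0r.
  - by move=> x /out[-> ->]; rewrite !mul0r addr0.
have chi1 n x : `|chi n x| <= 1 by rewrite ger0_norm ?box_le1// box_ge0.
have lim (x : R) : \forall n \near \oo, chi n x = 1 /\ dchi n x = 0.
  have : \forall n \near \oo, `|x| < n%:R :> R by exact: nbhs_infty_gtr.
  apply: filterS => n h.
  have hx : - n%:R <= x <= n%:R by rewrite -ler_norml ltW.
  by rewrite /chi /dchi box1// dbox0.
have mchi n : measurable_fun setT (chi n).
  by apply: continuous_measurableT; exact: C1b_cont (hc n).
have mdchi n : measurable_fun setT (dchi n).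
  by apply: continuous_measurableT; have [_ ? _] := hc n.
have c1 : rint (fun x => a' x * (chi n x * b x)) @[n --> \oo] --> rint (fun x => a' x * b x).
  apply: (@rint_dct _ _ _ (fun x => `|a' x * b x|)).
  - by move=> n; apply: measurable_funM; [exact: la'.1|apply: measurable_funM => //; exact: lb.1].
  - by apply: measurable_funM; [exact: la'.1|exact: lb.1].
  - move=> x; apply: cvg_trans (_ : cst (a' x * b x) @ \oo `=>` _); last exact: cvg_cst.
    by apply: near_eq_cvg; apply: filterS (lim x) => n [-> _]; rewrite mul1r.
  - by apply: itg_norm; exact: L2r_M.
  - move=> n x; rewrite mulrCA normrM; apply: ler_piMl => //.
have c2 : - rint (fun x => a x * (dchi n x * b x + chi n x * b' x)) @[n --> \oo] -->
    - rint (fun x => a x * b' x).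
  apply: cvgN.
  apply: (@rint_dct _ _ _ (fun x => `|a x * b x| + `|a x * b' x|)).
  - move=> n; apply: measurable_funM; first exact: la.1.
    by apply: measurable_funD; apply: measurable_funM => //; [exact: lb.1|exact: lb'.1].
  - by apply: measurable_funM; [exact: la.1|exact: lb'.1].
  - move=> x; apply: cvg_trans (_ : cst (a x * b' x) @ \oo `=>` _); last exact: cvg_cst.
    by apply: near_eq_cvg; apply: filterS (lim x) => n [-> ->]; rewrite mul1r mul0r add0r.
  - by apply: itgD; apply: itg_norm; exact: L2r_M.
  - move=> n x; rewrite mulrDr; apply: le_trans (ler_normD _ _) _; apply: lerD.
      rewrite mulrCA normrM; apply: ler_piMl => //.
      exact: dbox_le.
    rewrite mulrCA normrM; exact: ler_piMl.
apply: cvg_unique c1 _; first exact: norm_hausdorff.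
by apply: cvg_trans c2; apply: near_eq_cvg; apply: nearW => n; rewrite eq.
Qed.

(** A smoothed form of the fact that [a x ^+ 2] is twice the integral of [a a'] over []-oo, x]]:
    integrating by parts against [psi n * a], where [psi n] falls from 1 to 0 across [x], expresses
    an average of [a^2] near [x] by that integral, and the continuity of [a] identifies the
    limit. *)
Lemma sup_bound a a' x : continuous a -> L2r a -> L2r a' -> wd a a' ->
  a x ^+ 2 <= 2 * rint (fun y => `|a y * a' y|).
Proof.
move=> ca la la' wa.
(* The [+ 0] gives the argument the shape of the kernel lemmas, with [c = 0]. *)
pose psi n y : R := 1 - step (n.+1%:R * (y - x) + 0).
pose dpsi n y : R := - (n.+1%:R * tent (n.+1%:R * (y - x) + 0)).
have psi01 n y : `|psi n y| <= 1.
  have := step_ge0 (n.+1%:R * (y - x) + 0); have := step_le1 (n.+1%:R * (y - x) + 0).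
  by move=> h1 h2; rewrite /psi ler_norml; apply/andP; split; lra.
have hp n : C1b (psi n) (dpsi n).
  have k0 : 0 < n.+1%:R :> R by rewrite ltr0n.
  split.
  - move=> y; apply: (@quad_is_derive _ _ _ _ (n.+1%:R ^+ 2)) => z.
    have := step_quad (n.+1%:R * (y - x) + 0) (n.+1%:R * (z - x) + 0).
    have -> : (n.+1%:R * (z - x) + 0) - (n.+1%:R * (y - x) + 0) = n.+1%:R * (z - y) by ring.
    rewrite exprMn /psi /dpsi -normrN; congr (`|_| <= _); ring.
  - by move=> y; apply: cvgN; exact: tentk_cont.
  - exists (1 + n.+1%:R) => y; split; first by have := psi01 n y; lra.
    rewrite /dpsi normrN ger0_norm; last by rewrite mulr_ge0 ?tent_ge0.
    have := ler_wpM2l (ltW k0) (tent_le1 (n.+1%:R * (y - x) + 0)); lra.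
have le n : rint (fun y => n.+1%:R * tent (n.+1%:R * (y - x) + 0) * (a y ^+ 2)) <=
    2 * rint (fun y => `|a y * a' y|).
  have [l1 l2] := C1b_L2r (hp n) la; have [l3 _] := C1b_L2r (hp n) la'.
  have h := ibp la la' l1 (L2rD l2 l3) wa (wdM (hp n) la la' wa).
  have i1 : itg (fun y => psi n y * (a y * a' y)).
    by have := L2r_M l1 la'; under eq_fun do rewrite -mulrA.
  have E1 : rint (fun y => a' y * (psi n y * a y)) = rint (fun y => psi n y * (a y * a' y)).
    by congr rint; apply/funext => y; ring.
  have E2 : rint (fun y => a y * (dpsi n y * a y + psi n y * a' y)) =
     rint (fun y => psi n y * (a y * a' y))
     - rint (fun y => n.+1%:R * tent (n.+1%:R * (y - x) + 0) * (a y ^+ 2)).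
    rewrite -rintB//; first by congr rint; apply/funext => y; rewrite /dpsi; ring.
    have := itgN (L2r_M la l2).
    by congr itg; apply/funext => y; rewrite /dpsi; ring.
  have -> : rint (fun y => n.+1%:R * tent (n.+1%:R * (y - x) + 0) * (a y ^+ 2)) =
     2 * rint (fun y => psi n y * (a y * a' y)).
    by rewrite E1 E2 in h; lra.
  rewrite ler_pM2l//; apply: le_trans (ler_norm _) _.
  apply: le_trans (rint_norm i1) _; apply: rint_le.
  - exact: itg_norm.
  - by apply: itg_norm; exact: L2r_M.
  - by move=> y; rewrite normrM ler_piMl.
have l2 : locint (fun y => a y ^+ 2).
  have [ma ia] := la; split; first exact: measurable_funX.
  by move=> r; apply: integrableS ia.
have lp : lebesgue_pt (fun y => a y ^+ 2) x.
  apply: (@continuous_lebesgue_pt _ _ _ setT) => //.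
  - by split => //; exact: openT.
  - exact: l2.1.
  - by apply: (@cvgM _ _ _ _ a a); exact: ca.
have n0 : `|0 : R| <= 1 by rewrite normr0.
have c := tentk_cvg l2 lp n0.
have : limn (fun n => rint (fun y => n.+1%:R * tent (n.+1%:R * (y - x) + 0) * (a y ^+ 2)))
  <= 2 * rint (fun y => `|a y * a' y|).
  apply: limr_le; first by apply: cvgP c.
  by apply: nearW => n; exact: le.
by rewrite (cvg_lim _ c).
Qed.

End IBP.

(** * Complex-valued square integrable functions *)

Section ComplexL2.
Context {R : realType}.
Local Notation mu := (@lebesgue_measure R).
Local Notation Re := complex.Re.
Local Notation Im := complex.Im.
Implicit Types (v w z : R -> R[i]) (x y s t c d k C : R) (m : R -> R).

(** The inner product of C as R^2, so that [ip] is the real part of the Hermitian product. For it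
    ['i * v] is orthogonal to [v], which makes the conservative terms drop out of the balances
    below. *)
Definition cdot (a b : R[i]) : R := Re a * Re b + Im a * Im b.
Definition ip v w : R := rint (fun x => cdot (v x) (w x)).
Definition nrm v : R := Num.sqrt (ip v v).
Definition CL2 v := L2r (fun x => Re (v x)) /\ L2r (fun x => Im (v x)).

Lemma cdotC (a b : R[i]) : cdot a b = cdot b a.
Proof. by rewrite /cdot; congr (_ + _); rewrite mulrC. Qed.
Lemma cdotDl (a b e : R[i]) : cdot (a + b) e = cdot a e + cdot b e.
Proof. by case: a b e => [? ?] [? ?] [? ?]; rewrite /cdot/=; ring. Qed.
Lemma cdotBl (a b e : R[i]) : cdot (a - b) e = cdot a e - cdot b e.
Proof. by case: a b e => [? ?] [? ?] [? ?]; rewrite /cdot/=; ring. Qed.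
Lemma cdotZl k (a b : R[i]) : cdot (k%:C * a) b = k * cdot a b.
Proof. by case: a b => [? ?] [? ?]; rewrite /cdot/=; ring. Qed.
Lemma cdot_ge0 (a : R[i]) : 0 <= cdot a a.
Proof. by rewrite /cdot -!expr2 addr_ge0 ?sqr_ge0. Qed.
Lemma normc_sqr (a : R[i]) : normc a ^+ 2 = cdot a a.
Proof.
by case: a => a b; rewrite /cdot/= sqr_sqrtr ?addr_ge0 ?sqr_ge0// !expr2.
Qed.

Lemma itg_cdot v w : CL2 v -> CL2 w -> itg (fun x => cdot (v x) (w x)).
Proof. by move=> [? ?] [? ?]; apply: itgD; exact: L2r_M. Qed.

Lemma CL2D v w : CL2 v -> CL2 w -> CL2 (fun x => v x + w x).
Proof.
move=> [h1 h2] [h3 h4]; split.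
  by have := L2rD h1 h3; congr L2r; apply/funext => x; case: (v x) (w x) => [? ?] [? ?].
by have := L2rD h2 h4; congr L2r; apply/funext => x; case: (v x) (w x) => [? ?] [? ?].
Qed.

Lemma CL2N v : CL2 v -> CL2 (fun x => - v x).
Proof.
move=> [h1 h2]; split.
  by have := L2rN h1; congr L2r; apply/funext => x; case: (v x) => [? ?].
by have := L2rN h2; congr L2r; apply/funext => x; case: (v x) => [? ?].
Qed.

Lemma CL2B v w : CL2 v -> CL2 w -> CL2 (fun x => v x - w x).
Proof. by move=> hv hw; apply: CL2D => //; exact: CL2N. Qed.

Lemma CL2M m v C : measurable_fun setT m -> (forall x, `|m x| <= C) -> CL2 v ->
  CL2 (fun x => (m x)%:C * v x).
Proof.
move=> mm mC [h1 h2]; split.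
  have := L2rM mm mC h1; congr L2r; apply/funext => x; case: (v x) => [? ?] /=; ring.
have := L2rM mm mC h2; congr L2r; apply/funext => x; case: (v x) => [? ?] /=; ring.
Qed.

Lemma CL2Z k v : CL2 v -> CL2 (fun x => k%:C * v x).
Proof. by apply: (@CL2M (fun=> k) _ `|k|) => //; exact: measurable_cst. Qed.

Lemma CL2i v : CL2 v -> CL2 (fun x => 'i * v x).
Proof.
move=> [h1 h2]; split.
  have := L2rN h2; congr L2r; apply/funext => x; case: (v x) => [? ?] /=; ring.
have := h1; congr L2r; apply/funext => x; case: (v x) => [? ?] /=; ring.
Qed.

Lemma CL2_C1b m m' v : C1b m m' -> CL2 v ->
  CL2 (fun x => (m x)%:C * v x) /\ CL2 (fun x => (m' x)%:C * v x).
Proof.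
move=> hm hv; have [_ cm' [C bC]] := hm; split; apply: (@CL2M _ _ C) => //.
- by apply: continuous_measurableT; exact: C1b_cont hm.
- by move=> x; have [] := bC x.
- exact: continuous_measurableT.
- by move=> x; have [] := bC x.
Qed.

Lemma ipC v w : ip v w = ip w v.
Proof. by congr rint; apply/funext => x; exact: cdotC. Qed.

Lemma ipDl v w z : CL2 v -> CL2 w -> CL2 z ->
  ip (fun x => v x + w x) z = ip v z + ip w z.
Proof.
move=> hv hw hz; rewrite /ip -rintD; [|exact: itg_cdot|exact: itg_cdot].
by congr rint; apply/funext => x; exact: cdotDl.
Qed.

Lemma ipBl v w z : CL2 v -> CL2 w -> CL2 z ->
  ip (fun x => v x - w x) z = ip v z - ip w z.
Proof.
move=> hv hw hz; rewrite /ip -rintB; [|exact: itg_cdot|exact: itg_cdot].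
by congr rint; apply/funext => x; exact: cdotBl.
Qed.

Lemma ipZl k v w : CL2 v -> CL2 w -> ip (fun x => k%:C * v x) w = k * ip v w.
Proof.
move=> hv hw; rewrite /ip -rintZ; last exact: itg_cdot.
by congr rint; apply/funext => x; exact: cdotZl.
Qed.

Lemma ipDr v w z : CL2 v -> CL2 w -> CL2 z ->
  ip z (fun x => v x + w x) = ip z v + ip z w.
Proof. by move=> *; rewrite ipC ipDl// ![ip _ z]ipC. Qed.

Lemma ipBr v w z : CL2 v -> CL2 w -> CL2 z ->
  ip z (fun x => v x - w x) = ip z v - ip z w.
Proof. by move=> *; rewrite ipC ipBl// ![ip _ z]ipC. Qed.

Lemma ipZr k v w : CL2 v -> CL2 w -> ip v (fun x => k%:C * w x) = k * ip v w.
Proof. by move=> *; rewrite ipC ipZl// [ip _ v]ipC. Qed.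

Lemma ip_ge0 v : 0 <= ip v v.
Proof. by apply: rint_ge0 => x; exact: cdot_ge0. Qed.

Lemma nrm_ge0 v : 0 <= nrm v.
Proof. exact: sqrtr_ge0. Qed.

Lemma nrm_sqr v : nrm v ^+ 2 = ip v v.
Proof. by rewrite sqr_sqrtr// ip_ge0. Qed.

Lemma ip_CS v w : CL2 v -> CL2 w -> `|ip v w| <= nrm v * nrm w.
Proof.
move=> hv hw.
have q k : 0 <= ip v v - 2 * k * ip v w + k ^+ 2 * ip w w.
  have := ip_ge0 (fun x => v x - k%:C * w x).
  rewrite ipBl//; [|exact: CL2Z|by apply: CL2B => //; exact: CL2Z].
  rewrite ipBr//; [|exact: CL2Z]. rewrite ipZl//; [|by apply: CL2B => //; exact: CL2Z].
  rewrite ipBr//; [|exact: CL2Z]. rewrite !ipZr// [ip w v]ipC; lra.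
rewrite -(ler_pXn2r (_ : 0 < 2)%N) ?nnegrE ?mulr_ge0 ?nrm_ge0//.
rewrite real_normK ?num_real// exprMn !nrm_sqr.
have [w0|w0] := eqVneq (ip w w) 0.
  rewrite w0 mulr0; have [->|n0] := eqVneq (ip v w) 0; first by rewrite expr0n.
  (* The quadratic part is zero here, and this argument would make the affine rest equal to -1. *)
  have := q ((ip v v + 1) / (2 * ip v w)).
  rewrite w0 mulr0 addr0 (_ : 2 * _ * _ = ip v v + 1); first lra.
  by field.
have wp : 0 < ip w w by rewrite lt_neqAle eq_sym w0 ip_ge0.
have := q (ip v w / ip w w).
rewrite (_ : _ + _ = (ip v v * ip w w - ip v w ^+ 2) / ip w w); last by field.
by rewrite pmulr_lge0 ?invr_gt0// subr_ge0.
Qed.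

Lemma nrmD v w : CL2 v -> CL2 w -> nrm (fun x => v x + w x) <= nrm v + nrm w.
Proof.
move=> hv hw; rewrite -(ler_pXn2r (_ : 0 < 2)%N) ?nnegrE ?addr_ge0 ?nrm_ge0//.
rewrite nrm_sqr sqrrD !nrm_sqr ipDl//; last exact: CL2D.
rewrite !ipDr// [ip w v]ipC.
have := le_trans (ler_norm _) (ip_CS hv hw); lra.
Qed.

Lemma nrmN v : nrm (fun x => - v x) = nrm v.
Proof.
rewrite /nrm; congr (Num.sqrt _); congr rint; apply/funext => x.
by case: (v x) => [? ?]; rewrite /cdot/=; ring.
Qed.

Lemma nrmZ k v : CL2 v -> nrm (fun x => k%:C * v x) = `|k| * nrm v.
Proof.
move=> hv; rewrite /nrm ipZl//; last exact: CL2Z.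
by rewrite ipZr// mulrA -expr2 sqrtrM ?sqr_ge0// sqrtr_sqr.
Qed.

Lemma nrmi v : nrm (fun x => 'i * v x) = nrm v.
Proof.
rewrite /nrm; congr (Num.sqrt _); congr rint; apply/funext => x.
by case: (v x) => [? ?]; rewrite /cdot/=; ring.
Qed.

Lemma nrm_le v w : CL2 v -> CL2 w -> (forall x, cdot (v x) (v x) <= cdot (w x) (w x)) ->
  nrm v <= nrm w.
Proof.
by move=> hv hw h; apply: ler_wsqrtr; apply: rint_le => //; exact: itg_cdot.
Qed.

Lemma nrmM m v C : measurable_fun setT m -> (forall x, `|m x| <= C) -> CL2 v ->
  nrm (fun x => (m x)%:C * v x) <= C * nrm v.
Proof.
move=> mm mC hv; have C0 : 0 <= C by exact: le_trans (mC 0).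
rewrite -(ger0_norm C0) -nrmZ//; apply: nrm_le.
- exact: CL2M mC hv.
- exact: CL2Z.
move=> x; rewrite !cdotZl ![cdot (v x) _]cdotC !cdotZl !mulrA -!expr2.
apply: ler_wpM2r; first exact: cdot_ge0.
by rewrite -(real_normK (num_real (m x))) ler_pXn2r ?nnegrE.
Qed.

Lemma weak_derivP v w : weak_deriv v w <->
  wd (fun x => Re (v x)) (fun x => Re (w x)) /\
  wd (fun x => Im (v x)) (fun x => Im (w x)).
Proof.
have E1 (th : R -> R) v0 : (fun x => Re ((th x)%:C * v0 x)) = (fun x => th x * Re (v0 x)).
  by apply/funext => x; case: (v0 x) => [? ?] /=; ring.
have E2 (th : R -> R) v0 : (fun x => Im ((th x)%:C * v0 x)) = (fun x => th x * Im (v0 x)).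
  by apply/funext => x; case: (v0 x) => [? ?] /=; ring.
split=> [h|[h1 h2] th cth].
  split=> th cth; have := h th cth; rewrite /cintegral !E1 !E2 => -[]//.
rewrite /cintegral !E1 !E2; have := h1 th cth; have := h2 th cth.
by rewrite /rint => -> ->.
Qed.

Lemma weak_derivD v v' w w' : CL2 v -> CL2 v' -> CL2 w -> CL2 w' ->
  weak_deriv v v' -> weak_deriv w w' ->
  weak_deriv (fun x => v x + w x) (fun x => v' x + w' x).
Proof.
move=> [? ?] [? ?] [? ?] [? ?] /weak_derivP[a1 a2] /weak_derivP[b1 b2].
have ER v0 w0 : (fun x => Re (v0 x + w0 x)) = (fun x => Re (v0 x) + Re (w0 x)).
  by apply/funext => x; case: (v0 x) (w0 x) => [? ?] [? ?].
have EI v0 w0 : (fun x => Im (v0 x + w0 x)) = (fun x => Im (v0 x) + Im (w0 x)).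
  by apply/funext => x; case: (v0 x) (w0 x) => [? ?] [? ?].
by apply/weak_derivP; split; rewrite ?ER ?EI; exact: wdD.
Qed.

Lemma weak_derivN v v' : CL2 v -> CL2 v' -> weak_deriv v v' ->
  weak_deriv (fun x => - v x) (fun x => - v' x).
Proof.
move=> [? ?] [? ?] /weak_derivP[a1 a2].
have ER v0 : (fun x => Re (- v0 x)) = (fun x => - Re (v0 x)).
  by apply/funext => x; case: (v0 x) => [? ?].
have EI v0 : (fun x => Im (- v0 x)) = (fun x => - Im (v0 x)).
  by apply/funext => x; case: (v0 x) => [? ?].
by apply/weak_derivP; split; rewrite ?ER ?EI; exact: wdN.
Qed.

Lemma weak_deriv_i v v' : CL2 v -> CL2 v' -> weak_deriv v v' ->
  weak_deriv (fun x => 'i * v x) (fun x => 'i * v' x).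
Proof.
move=> [? ?] [? ?] /weak_derivP[a1 a2].
have ER v0 : (fun x => Re ('i * v0 x)) = (fun x => - Im (v0 x)).
  by apply/funext => x; case: (v0 x) => [? ?] /=; ring.
have EI v0 : (fun x => Im ('i * v0 x)) = (fun x => Re (v0 x)).
  by apply/funext => x; case: (v0 x) => [? ?] /=; ring.
by apply/weak_derivP; split; rewrite ?ER ?EI//; exact: wdN.
Qed.

Lemma weak_derivM m m' v v' : C1b m m' -> CL2 v -> CL2 v' -> weak_deriv v v' ->
  weak_deriv (fun x => (m x)%:C * v x) (fun x => (m' x)%:C * v x + (m x)%:C * v' x).
Proof.
move=> hm [? ?] [? ?] /weak_derivP[a1 a2].
have ER (n : R -> R) v0 : (fun x => Re ((n x)%:C * v0 x)) = (fun x => n x * Re (v0 x)).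
  by apply/funext => x; case: (v0 x) => [? ?] /=; ring.
have EI (n : R -> R) v0 : (fun x => Im ((n x)%:C * v0 x)) = (fun x => n x * Im (v0 x)).
  by apply/funext => x; case: (v0 x) => [? ?] /=; ring.
have FR : (fun x => Re ((m' x)%:C * v x + (m x)%:C * v' x)) =
   (fun x => m' x * Re (v x) + m x * Re (v' x)).
  by apply/funext => x; case: (v x) (v' x) => [? ?] [? ?] /=; ring.
have FI : (fun x => Im ((m' x)%:C * v x + (m x)%:C * v' x)) =
   (fun x => m' x * Im (v x) + m x * Im (v' x)).
  by apply/funext => x; case: (v x) (v' x) => [? ?] [? ?] /=; ring.
by apply/weak_derivP; split; rewrite ?ER ?EI ?FR ?FI; exact: wdM.
Qed.

Lemma cibp v v' w w' : CL2 v -> CL2 v' -> CL2 w -> CL2 w' ->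
  weak_deriv v v' -> weak_deriv w w' -> ip v' w = - ip v w'.
Proof.
move=> [? ?] [? ?] [? ?] [? ?] /weak_derivP[a1 a2] /weak_derivP[b1 b2].
rewrite /ip /cdot rintD; [|exact: L2r_M|exact: L2r_M].
rewrite rintD; [|exact: L2r_M|exact: L2r_M].
by rewrite opprD; congr (_ + _); apply: ibp.
Qed.

(** The bounds for the two components are added first; Cauchy-Schwarz is then applied once, to the
    functions with components [|Re|] and [|Im|], which have the norms of [v] and [v']. *)
Lemma csup_bound v v' x : continuous (fun x => Re (v x)) ->
  continuous (fun x => Im (v x)) -> CL2 v -> CL2 v' -> weak_deriv v v' ->
  cdot (v x) (v x) <= 2 * (nrm v * nrm v').
Proof.
move=> c1 c2 hv hv' /weak_derivP[a1 a2].
have [l1 l2] := hv; have [l3 l4] := hv'.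
have h1 := sup_bound x c1 l1 l3 a1; have h2 := sup_bound x c2 l2 l4 a2.
pose ab w y : R[i] := `|Re (w y)| +i* `|Im (w y)|.
have lab w : CL2 w -> CL2 (ab w).
  move=> [[m1 i1] [m2 i2]]; split; split => /=; try exact: measurableT_comp.
    by under eq_fun do rewrite real_normK ?num_real//.
  by under eq_fun do rewrite real_normK ?num_real//.
have nab w : nrm (ab w) = nrm w.
  rewrite /nrm; congr (Num.sqrt _); congr rint; apply/funext => y.
  by rewrite /cdot/= -!expr2 !real_normK ?num_real.
have := le_trans (ler_norm _) (ip_CS (lab _ hv) (lab _ hv')).
rewrite !nab {1}/ip /cdot/= rintD; last 2 first.
- by under eq_fun do rewrite -normrM; apply: itg_norm; exact: L2r_M.
- by under eq_fun do rewrite -normrM; apply: itg_norm; exact: L2r_M.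
under eq_fun do rewrite -normrM.
under [in X in _ + X]eq_fun do rewrite -normrM.
by rewrite -!expr2; lra.
Qed.

End ComplexL2.

(** * Paths in L^2 *)

Section Paths.
Context {R : realType}.
Local Notation mu := (@lebesgue_measure R).
Local Notation Re := complex.Re.
Local Notation Im := complex.Im.
Implicit Types (v w z : R -> R[i]) (x y s t c d k e C M : R) (m : R -> R).
(* A path [A : R -> R -> R[i]] has the time as its first argument. *)
Implicit Types (A B : R -> R -> R[i]).

Lemma cvg0_le (F : set_system R) {FF : Filter F} (f g : R -> R) :
  (\forall s \near F, `|f s| <= g s) -> g s @[s --> F] --> 0 -> f s @[s --> F] --> 0.
Proof.
move=> fg g0; apply/cvgrPdist_lt => e e0; move/cvgrPdist_lt : g0 => /(_ e e0) g0.
near=> s; rewrite sub0r normrN; apply: (@le_lt_trans _ _ (g s)); first by near: s.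
have : `|0 - g s| < e by near: s.
by rewrite sub0r normrN; apply: le_lt_trans; exact: ler_norm.
Unshelve. all: by end_near. Qed.

Lemma ip_cvg (F : set_system R) {FF : Filter F} A B v w :
  (\forall s \near F, CL2 (A s)) -> (\forall s \near F, CL2 (B s)) -> CL2 v -> CL2 w ->
  nrm (fun x => A s x - v x) @[s --> F] --> 0 ->
  nrm (fun x => B s x - w x) @[s --> F] --> 0 ->
  ip (A s) (B s) @[s --> F] --> ip v w.
Proof.
move=> hA hB hv hw cA cB.
pose a s := nrm (fun x => A s x - v x); pose b s := nrm (fun x => B s x - w x).
have c : a s * b s + (a s * nrm w + nrm v * b s) @[s --> F] --> 0.
  rewrite [X in _ --> X](_ : 0 = 0 * 0 + (0 * nrm w + nrm v * 0)); last by ring.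
  by apply: cvgD; [exact: cvgM|apply: cvgD; apply: cvgM => //; exact: cvg_cst].
suff h : ip (A s) (B s) - ip v w @[s --> F] --> 0.
  rewrite -[X in _ --> X]add0r.
  under eq_fun do rewrite -[ip _ _](subrK (ip v w)).
  by apply: cvgD => //; exact: cvg_cst.
apply: cvg0_le c; near=> s.
have hAs : CL2 (A s) by near: s.
have hBs : CL2 (B s) by near: s.
have hd := CL2B hAs hv; have he := CL2B hBs hw.
have -> : ip (A s) (B s) - ip v w =
  ip (fun x => A s x - v x) (fun x => B s x - w x) +
  (ip (fun x => A s x - v x) w + ip v (fun x => B s x - w x)).
  by rewrite ipBl// !ipBr//  ipBl//; ring.
apply: le_trans (ler_normD _ _) _; apply: lerD; first exact: ip_CS.
by apply: le_trans (ler_normD _ _) _; apply: lerD; exact: ip_CS.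
Unshelve. all: by end_near. Qed.

Lemma nrmB_cvg (F : set_system R) {FF : Filter F} A v :
  (\forall s \near F, CL2 (A s)) -> CL2 v ->
  nrm (fun x => A s x - v x) @[s --> F] --> 0 -> nrm (A s) @[s --> F] --> nrm v.
Proof.
move=> hA hv cA; have h := @ip_cvg F FF _ _ _ _ hA hA hv hv cA cA.
exact: (cvg_comp _ _ h (@sqrt_continuous R _)).
Qed.

Lemma ipE_sqnorm v : ip v v = fine (sqnormL2 v).
Proof.
rewrite /ip /rint /Rintegral /sqnormL2 /sqnormL2w; congr fine.
by apply: eq_integral => x _; rewrite expr1n mul1r normc_sqr.
Qed.

Lemma inL2P v : inL2 v <-> CL2 v.
Proof.
rewrite /inL2 /inL2w /sqnormL2w; split.
  move=> [[m1 m2] fin].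
  have ii : itg (fun x => cdot (v x) (v x)).
    apply/integrableP; split.
      apply/measurable_EFinP; rewrite /cdot; apply: measurable_funD; exact: measurable_funM.
    apply: le_lt_trans fin; rewrite le_eqVlt; apply/orP; left; apply/eqP.
    apply: eq_integral => x _ /=.
    by rewrite expr1n mul1r normc_sqr ger0_norm// cdot_ge0.
  split; split => //; apply: (itg_le _ _ ii).
  - exact: measurable_funX.
  - move=> x; rewrite ger0_norm ?sqr_ge0// /cdot -!expr2 lerDl sqr_ge0//.
  - exact: measurable_funX.
  - move=> x; rewrite ger0_norm ?sqr_ge0// /cdot -!expr2 lerDr sqr_ge0//.
move=> hv; have [[m1 _] [m2 _]] := hv; split; first by [].
have /integrableP[_] := itg_cdot hv hv; apply: le_lt_trans.
rewrite le_eqVlt; apply/orP; left; apply/eqP.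
by apply: eq_integral => x _ /=; rewrite expr1n mul1r normc_sqr ger0_norm// cdot_ge0.
Qed.

Lemma sqnorm_cvg_nrm (F : set_system R) {FF : Filter F} A :
  sqnormL2 (A s) @[s --> F] --> 0%E -> nrm (A s) @[s --> F] --> 0.
Proof.
move=> /fine_cvgP[_ h].
have -> : (fun s => nrm (A s)) = (fun s => Num.sqrt (fine (sqnormL2 (A s)))).
  by apply/funext => s; rewrite /nrm ipE_sqnorm.
rewrite -[X in _ --> X]sqrtr0.
exact: (cvg_comp _ _ h (@sqrt_continuous R _)).
Qed.

Definition L2path A := forall s, 0 <= s -> CL2 (A s).
Definition L2cont A := forall t, 0 <= t ->
  nrm (fun x => A s x - A t x) @[s --> within `[0, +oo[ (nbhs t)] --> 0.
(** Right difference quotients are all that a Dini argument asks for, and with them time 0 is not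
    exceptional. *)
Definition L2der A B := forall t, 0 <= t ->
  nrm (fun x => ((s - t)^-1)%:C * (A s x - A t x) - B t x) @[s --> t^'+] --> 0.

Lemma right_within (P : R -> Prop) t : 0 <= t ->
  (\forall s \near within `[0, +oo[ (nbhs t), P s) -> \forall s \near t^'+, P s.
Proof.
move=> t0; rewrite /at_right !near_withinE; apply: filterS => s h ts; apply: h.
by rewrite /= in_itv/= andbT (le_trans t0)// ltW.
Qed.

Lemma right_within' (P : R -> Prop) t : 0 <= t ->
  (\forall s \near within `[0, +oo[ t^', P s) -> \forall s \near t^'+, P s.
Proof.
move=> t0; rewrite /at_right /dnbhs !near_withinE; apply: filterS => s h ts; apply: h.
  by rewrite gt_eqF.
by rewrite /= in_itv/= andbT (le_trans t0)// ltW.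
Qed.

Lemma cont_L2P (u : R -> R -> R[i]) : cont_L2 u ->
  L2path (fun s => u^~ s) /\ L2cont (fun s => u^~ s).
Proof.
move=> cu; split=> t t0; have [h1 h2] := cu t t0; first exact/inL2P.
exact: sqnorm_cvg_nrm h2.
Qed.

Lemma deriv_L2P (u ut : R -> R -> R[i]) : deriv_L2 u ut ->
  L2der (fun s => u^~ s) (fun s => ut^~ s).
Proof.
move=> du t t0; have h := sqnorm_cvg_nrm (du t t0).
by move=> P /h; exact: right_within'.
Qed.

Lemma near_ge0 t : 0 <= t -> \forall s \near t^'+, 0 <= s.
Proof.
move=> t0; near=> s; apply: (le_trans t0); apply: ltW; near: s; exact: near_right_gt.
Unshelve. all: by end_near. Qed.

Lemma near_within_ge0 t : \forall s \near within `[0, +oo[ (nbhs t), 0 <= s.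
Proof.
rewrite near_withinE; apply: nearW => s; by rewrite /= in_itv/= andbT.
Qed.

Lemma L2path_near A t : L2path A -> \forall s \near within `[0, +oo[ (nbhs t), CL2 (A s).
Proof. by move=> pA; apply: filterS (near_within_ge0 t) => s; exact: pA. Qed.

Lemma L2path_right A t : 0 <= t -> L2path A -> \forall s \near t^'+, CL2 (A s).
Proof. by move=> t0 pA; apply: filterS (near_ge0 t0) => s; exact: pA. Qed.

Lemma L2cont_right A t : 0 <= t -> L2cont A ->
  nrm (fun x => A s x - A t x) @[s --> t^'+] --> 0.
Proof. by move=> t0 cA P /(cA t t0); exact: right_within. Qed.

Lemma cont0_ip A B : L2path A -> L2path B -> L2cont A -> L2cont B ->
  cont0 (fun s => ip (A s) (B s)).
Proof.
move=> pA pB cA cB t t0; apply: ip_cvg.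
- exact: L2path_near.
- exact: L2path_near.
- exact: pA.
- exact: pB.
- exact: cA.
- exact: cB.
Qed.

Lemma cont0_nrm A : L2path A -> L2cont A -> cont0 (fun s => nrm (A s)).
Proof.
by move=> pA cA t t0; apply: nrmB_cvg; [exact: L2path_near|exact: pA|exact: cA].
Qed.

Lemma L2contD A B : L2path A -> L2path B -> L2cont A -> L2cont B ->
  L2cont (fun s x => A s x + B s x).
Proof.
move=> pA pB cA cB t t0.
apply: (@cvg0_le _ _ _ (fun s => nrm (fun x => A s x - A t x) + nrm (fun x => B s x - B t x))).
  apply: filterS (near_within_ge0 t) => s s0; rewrite ger0_norm ?nrm_ge0//.
  have -> : (fun x => A s x + B s x - (A t x + B t x)) =
    (fun x => (A s x - A t x) + (B s x - B t x)) by apply/funext => x; ring.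
  by apply: nrmD; apply: CL2B; (exact: pA || exact: pB).
by rewrite -[X in _ --> X](addr0 0); apply: cvgD; [exact: cA|exact: cB].
Qed.

Lemma L2contM A m C : measurable_fun setT m -> (forall x, `|m x| <= C) ->
  L2path A -> L2cont A -> L2cont (fun s x => (m x)%:C * A s x).
Proof.
move=> mm mC pA cA t t0.
apply: (@cvg0_le _ _ _ (fun s => C * nrm (fun x => A s x - A t x))).
  apply: filterS (near_within_ge0 t) => s s0; rewrite ger0_norm ?nrm_ge0//.
  under eq_fun do rewrite -mulrBr.
  by apply: nrmM => //; apply: CL2B; exact: pA.
by rewrite -[X in _ --> X](mulr0 C); apply: cvgM; [exact: cvg_cst|exact: cA].
Qed.

Lemma L2contN A : L2cont A -> L2cont (fun s x => - A s x).
Proof.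
move=> cA t t0; have := cA t t0; apply: cvg_trans; apply: near_eq_cvg; apply: nearW => s.
by rewrite -nrmN; congr nrm; apply/funext => x; ring.
Qed.

Lemma L2conti A : L2cont A -> L2cont (fun s x => 'i * A s x).
Proof.
move=> cA t t0; have := cA t t0; apply: cvg_trans; apply: near_eq_cvg; apply: nearW => s.
by rewrite -nrmi; congr nrm; apply/funext => x; rewrite mulrBr.
Qed.

Lemma L2derM A B m C : measurable_fun setT m -> (forall x, `|m x| <= C) ->
  L2path A -> L2path B -> L2der A B ->
  L2der (fun s x => (m x)%:C * A s x) (fun s x => (m x)%:C * B s x).
Proof.
move=> mm mC pA pB dA t t0.
apply: (@cvg0_le _ _ _ (fun s => C * nrm (fun x => ((s - t)^-1)%:C * (A s x - A t x) - B t x))).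
  apply: filterS (near_ge0 t0) => s s0; rewrite ger0_norm ?nrm_ge0//.
  have -> : (fun x => ((s - t)^-1)%:C * ((m x)%:C * A s x - (m x)%:C * A t x) - (m x)%:C * B t x)
    = (fun x => (m x)%:C * (((s - t)^-1)%:C * (A s x - A t x) - B t x)).
    by apply/funext => x; ring.
  apply: nrmM => //; apply: CL2B; last exact: pB.
  by apply: CL2Z; apply: CL2B; exact: pA.
by rewrite -[X in _ --> X](mulr0 C); apply: cvgM; [exact: cvg_cst|exact: dA].
Qed.

(** The increment is split as [<A s - A t, B s> + <A t, B s - B t>]; the continuity of [B] settles
    the first pairing. *)
Lemma rder_ip A A' B B' t : 0 <= t -> L2path A -> L2path A' -> L2path B -> L2path B' ->
  L2cont B -> L2der A A' -> L2der B B' ->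
  rder (fun s => ip (A s) (B s)) t (ip (A' t) (B t) + ip (A t) (B' t)).
Proof.
move=> t0 pA pA' pB pB' cB dA dB.
pose DA s x := ((s - t)^-1)%:C * (A s x - A t x).
pose DB s x := ((s - t)^-1)%:C * (B s x - B t x).
have hDA : \forall s \near t^'+, CL2 (DA s).
  by apply: filterS (near_ge0 t0) => s s0; apply: CL2Z; apply: CL2B; exact: pA.
have hDB : \forall s \near t^'+, CL2 (DB s).
  by apply: filterS (near_ge0 t0) => s s0; apply: CL2Z; apply: CL2B; exact: pB.
have c1 : ip (DA s) (B s) @[s --> t^'+] --> ip (A' t) (B t).
  apply: ip_cvg => //; [exact: L2path_right|exact: pA'|exact: pB|exact: dA|exact: L2cont_right].
have c2 : ip (A t) (DB s) @[s --> t^'+] --> ip (A t) (B' t).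
  apply: (@ip_cvg _ _ (fun=> A t)) => //; [|exact: pA|exact: pB'| |exact: dB].
    by apply: nearW => _; exact: pA.
  under eq_fun do under eq_fun do rewrite subrr.
  rewrite (_ : nrm _ = 0); first exact: cvg_cst.
  rewrite /nrm /ip (_ : (fun x => _) = (fun=> 0)) ?rint0 ?sqrtr0//.
  by apply/funext => x; rewrite /cdot/=; ring.
rewrite /rder; apply: cvg_trans (cvgD c1 c2); apply: near_eq_cvg.
apply: filterS (near_ge0 t0) => s s0.
have hA := pA s s0; have hB := pB s s0; have hAt := pA t t0; have hBt := pB t t0.
rewrite [LHS](_ : _ = ip (DA s) (B s) + ip (A t) (DB s))// /DA /DB.
rewrite ipZl//; [|exact: CL2B]; rewrite ipZr//; [|exact: CL2B].
by rewrite ipBl// ipBr//; ring.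
Qed.

End Paths.

(** * Solution paths and their mass *)

Section Pointwise.
Context {R : realType}.
Local Notation Re := complex.Re.
Local Notation Im := complex.Im.
Implicit Types (a b d : R[i]) (M : R).

Lemma normc_ge0 a : 0 <= normc a.
Proof. by case: a => a1 a2; exact: sqrtr_ge0. Qed.

Lemma normc_real (k : R) : normc k%:C = `|k|.
Proof. by rewrite /= expr0n addr0 sqrtr_sqr. Qed.

Lemma normci : normc ('i : R[i]) = 1.
Proof. by rewrite /= expr0n expr1n add0r sqrtr1. Qed.

Lemma cdot_normc a b : `|cdot a b| <= normc a * normc b.
Proof.
rewrite -(ler_pXn2r (_ : 0 < 2)%N) ?nnegrE ?mulr_ge0 ?normc_ge0//.
rewrite real_normK ?num_real// exprMn !normc_sqr.
case: a b => [a1 a2] [b1 b2]; rewrite /cdot/=.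
have := sqr_ge0 (a1 * b2 - a2 * b1); lra.
Qed.

Lemma normc_dist a b : `|normc a - normc b| <= normc (a - b).
Proof.
have h1 := le_normcD (a - b) b; have h2 := le_normcD (b - a) a.
rewrite subrK in h1; rewrite subrK -opprB normcN in h2.
by rewrite ler_norml; apply/andP; split; lra.
Qed.

Definition cube a : R[i] := (normc a ^+ 2)%:C * a.

Lemma cube_diff a b : cube a - cube b =
  (normc a ^+ 2)%:C * (a - b) + (normc a ^+ 2 - normc b ^+ 2)%:C * b.
Proof. by rewrite /cube rmorphB/=; ring. Qed.

Lemma sqr_normc_diff a b M : normc a ^+ 2 <= M -> normc b ^+ 2 <= M ->
  `|normc a ^+ 2 - normc b ^+ 2| * normc b <= 2 * M * normc (a - b).
Proof.
move=> aM bM; have := normc_dist a b; have := normc_ge0 a; have := normc_ge0 b.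
have := normc_ge0 (a - b).
move: (normc a) (normc b) (normc (a - b)) aM bM => x y z xM yM z0 y0 x0 xyz.
have -> : x ^+ 2 - y ^+ 2 = (x - y) * (x + y) by ring.
rewrite normrM (ger0_norm (addr_ge0 x0 y0)) -[leLHS]mulrA.
have h : (x + y) * y <= 2 * M by have := sqr_ge0 (x - y); lra.
apply: le_trans (ler_wpM2r _ xyz) _; first by rewrite mulr_ge0// addr_ge0.
by rewrite [leRHS]mulrC; apply: ler_wpM2l.
Qed.

Lemma cube_lip a b M : normc a ^+ 2 <= M -> normc b ^+ 2 <= M ->
  normc (cube a - cube b) <= 3 * M * normc (a - b).
Proof.
move=> aM bM; rewrite cube_diff; apply: le_trans (le_normcD _ _) _.
rewrite !normcM !normc_real [`|normc a ^+ 2|]ger0_norm ?sqr_ge0//.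
have := sqr_normc_diff aM bM; have := ler_wpM2r (normc_ge0 (a - b)) aM; lra.
Qed.

(** In the splitting [cube_diff] the part [|a|^2 (a - b)], once multiplied by ['i], is orthogonal to
    [a - b]; what remains carries the factor [|a|^2 - |b|^2]. *)
Lemma cube_flux a b M : normc a ^+ 2 <= M -> normc b ^+ 2 <= M ->
  cdot (a - b) ('i * (cube a - cube b)) <= 2 * M * cdot (a - b) (a - b).
Proof.
move=> aM bM; rewrite cube_diff.
set k := normc a ^+ 2 - normc b ^+ 2.
have -> : cdot (a - b) ('i * ((normc a ^+ 2)%:C * (a - b) + k%:C * b)) =
    k * cdot (a - b) ('i * b).
  move: (k) (normc a ^+ 2) => k1 n1; clear.
  by case: a b => [? ?] [? ?]; rewrite /cdot/=; ring.
apply: le_trans (ler_norm _) _; rewrite normrM.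
have h := cdot_normc (a - b) ('i * b); rewrite normcM normci mul1r in h.
apply: le_trans (ler_wpM2l (normr_ge0 _) h) _.
rewrite mulrCA -normc_sqr expr2 [leRHS]mulrA [leRHS]mulrC.
apply: ler_wpM2l; first exact: normc_ge0.
exact: sqr_normc_diff.
Qed.

(** The cofactor of [a - b] in [quartic_diff] tends to [4 * cube b], the gradient of the fourth
    power of the modulus, at a linear rate. *)
Lemma quartic_lip a b M : normc a ^+ 2 <= M -> normc b ^+ 2 <= M ->
  normc ((normc a ^+ 2 + normc b ^+ 2)%:C * (a + b) - 4%:R%:C * cube b)
    <= 6 * M * normc (a - b).
Proof.
move=> aM bM.
have -> : (normc a ^+ 2 + normc b ^+ 2)%:C * (a + b) - 4%:R%:C * cube b =
    (cube a - cube b) + (normc a ^+ 2 - normc b ^+ 2)%:C * b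
      + (normc b ^+ 2)%:C * (a - b).
  by rewrite /cube; move: (normc a ^+ 2) (normc b ^+ 2) => x y;
    case: a b aM bM => [? ?] [? ?] _ _; apply/eqP; rewrite eq_complex /=;
    apply/andP; split; apply/eqP; ring.
apply: le_trans (le_normcD _ _) _.
apply: le_trans (lerD (le_normcD _ _) (lexx _)) _.
rewrite !normcM !normc_real [`|normc b ^+ 2|]ger0_norm ?sqr_ge0//.
have := cube_lip aM bM; have := sqr_normc_diff aM bM.
have := ler_wpM2r (normc_ge0 (a - b)) bM; lra.
Qed.

Lemma quartic_diff a b : normc a ^+ 2 * normc a ^+ 2 - normc b ^+ 2 * normc b ^+ 2 =
  cdot ((normc a ^+ 2 + normc b ^+ 2)%:C * (a + b)) (a - b).
Proof.
rewrite cdotZl !normc_sqr; case: a b => [? ?] [? ?]; rewrite /cdot/=; ring.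
Qed.

End Pointwise.

(** * Solution paths: the cubic term, the equation and the weighted mass balance *)

Section Schroedinger.
Context {R : realType}.
Local Notation mu := (@lebesgue_measure R).
Local Notation Re := complex.Re.
Local Notation Im := complex.Im.
Implicit Types (v w z : R -> R[i]) (x y s t c d k e C M h : R).
Implicit Types (A B : R -> R -> R[i]) (eta deta : R -> R).

Lemma nrm_le_normc v w k : 0 <= k -> CL2 v -> CL2 w ->
  (forall x, normc (v x) <= k * normc (w x)) -> nrm v <= k * nrm w.
Proof.
move=> k0 hv hw le; rewrite -(ger0_norm k0) -nrmZ//.
apply: nrm_le => //; first exact: CL2Z.
move=> x; rewrite -!normc_sqr normcM normc_real (ger0_norm k0).
by rewrite ler_pXn2r ?nnegrE ?mulr_ge0 ?normc_ge0.
Qed.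

(** The equation [eqU] acts as the definition of [G]: it holds at every time and every point, so no
    exceptional null set enters the estimates. *)
Record nls_path (gamma : R) (U Ux Uxx Ut G : R -> R -> R[i]) : Prop := NlsPath {
  pU : L2path U; pUx : L2path Ux; pUxx : L2path Uxx; pUt : L2path Ut;
  cU : L2cont U; cUx : L2cont Ux; cUxx : L2cont Uxx; cUt : L2cont Ut;
  dU : L2der U Ut;
  wU : forall s, 0 <= s -> weak_deriv (U s) (Ux s);
  wUx : forall s, 0 <= s -> weak_deriv (Ux s) (Uxx s);
  cReU : forall s, 0 <= s -> continuous (fun x => Re (U s x));
  cImU : forall s, 0 <= s -> continuous (fun x => Im (U s x));
  eqU : forall s x, G s x =
    'i * Ut s x + (2^-1)%:C * Uxx s x + cube (U s x) + 'i * (gamma%:C * U s x) }.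

Context (gamma : R) (U Ux Uxx Ut G : R -> R -> R[i]).
Context (H : nls_path gamma U Ux Uxx Ut G).

(** Upper bound for the squared sup norm of [U s] given by [csup_bound]; in contrast to the supremum
    itself it is continuous in time by construction. *)
Definition supU s : R := 2 * (nrm (U s) * nrm (Ux s)).
Definition V s x := cube (U s x).

Lemma supU_le s x : 0 <= s -> normc (U s x) ^+ 2 <= supU s.
Proof.
move=> s0; rewrite normc_sqr; apply: csup_bound.
- exact: (cReU H).
- exact: (cImU H).
- exact: (pU H).
- exact: (pUx H).
- exact: (wU H).
Qed.

Lemma supU_ge0 s : 0 <= supU s.
Proof. by rewrite mulr_ge0// mulr_ge0 ?nrm_ge0. Qed.

Lemma cont0_supU : cont0 supU.
Proof.
apply: cont0Z; apply: cont0M; apply: cont0_nrm;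
  [exact: pU H|exact: cU H|exact: pUx H|exact: cUx H].
Qed.

Lemma measurable_normc_sqr v : CL2 v -> measurable_fun setT (fun x => normc (v x) ^+ 2).
Proof.
move=> [[m1 _] [m2 _]]; under eq_fun do rewrite normc_sqr.
by apply: measurable_funD; exact: measurable_funM.
Qed.

Lemma pV : L2path V.
Proof.
move=> s s0; apply: (@CL2M _ _ _ (supU s)); last exact: (pU H).
- exact: measurable_normc_sqr (pU H s0).
- by move=> x; rewrite ger0_norm ?sqr_ge0//; exact: supU_le.
Qed.

Lemma cV : L2cont V.
Proof.
move=> t t0.
apply: (@cvg0_le _ _ _ _ (fun s => 3 * (supU s + supU t) * nrm (fun x => U s x - U t x))).
  apply: filterS (near_within_ge0 t) => s s0; rewrite ger0_norm ?nrm_ge0//.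
  apply: nrm_le_normc.
  - by rewrite mulr_ge0// addr_ge0 ?supU_ge0.
  - by apply: CL2B; exact: pV.
  - by apply: CL2B; apply: (pU H).
  - move=> x; apply: cube_lip; first by rewrite ler_wpDr ?supU_ge0// supU_le.
    by rewrite ler_wpDl ?supU_ge0// supU_le.
rewrite -[X in _ --> X](mulr0 (3 * (supU t + supU t))).
apply: cvgM; last exact: (cU H).
apply: cvgM; first exact: cvg_cst.
by apply: cvgD; [exact: cont0_supU|exact: cvg_cst].
Qed.

Lemma pG : L2path G.
Proof.
move=> s s0; have := eqU H s => /funext ->.
apply: CL2D; [apply: CL2D; [apply: CL2D|]|].
- by apply: CL2i; exact: (pUt H).
- by apply: CL2Z; exact: (pUxx H).
- exact: pV.
- by apply: CL2i; apply: CL2Z; exact: (pU H).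
Qed.

Lemma L2contZ k A : L2path A -> L2cont A -> L2cont (fun s x => k%:C * A s x).
Proof. by apply: (@L2contM _ _ (fun=> k) `|k|) => //; exact: measurable_cst. Qed.

Lemma cG : L2cont G.
Proof.
have E : G = (fun s x => 'i * Ut s x + (2^-1)%:C * Uxx s x + V s x + 'i * (gamma%:C * U s x)).
  by apply/funext => s; apply/funext => x; exact: (eqU H).
rewrite E.
have p1 : L2path (fun s x => 'i * Ut s x) by move=> s s0; apply: CL2i; exact: (pUt H).
have p2 : L2path (fun s x => (2^-1)%:C * Uxx s x) by move=> s s0; apply: CL2Z; exact: (pUxx H).
have p3 : L2path (fun s x => gamma%:C * U s x) by move=> s s0; apply: CL2Z; exact: (pU H).
apply: L2contD.
- by move=> s s0; apply: CL2D; [apply: CL2D; [exact: p1|exact: p2]|exact: pV].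
- by move=> s s0; apply: CL2i; exact: p3.
- apply: L2contD; [|exact: pV| |exact: cV].
    by move=> s s0; apply: CL2D; [exact: p1|exact: p2].
  apply: L2contD => //; first by apply: L2conti; exact: cUt H.
  by apply: L2contZ; [exact: pUxx H|exact: cUxx H].
- by apply: L2conti; apply: L2contZ; [exact: pU H|exact: cU H].
Qed.

Lemma eqUt s x : Ut s x = - ('i * G s x) - gamma%:C * U s x
  + (2^-1)%:C * ('i * Uxx s x) + 'i * V s x.
Proof.
rewrite (eqU H) /V; move: (2^-1 : R) => k.
case: (Ut s x) (Uxx s x) (cube (U s x)) (U s x) => [? ?] [? ?] [? ?] [? ?].
by apply/eqP; rewrite eq_complex /=; apply/andP; split; apply/eqP; ring.
Qed.

Lemma L2path_C1b eta deta A : C1b eta deta -> L2path A ->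
  L2path (fun s x => (eta x)%:C * A s x) /\ L2path (fun s x => (deta x)%:C * A s x).
Proof.
by move=> he pA; split=> s s0; have [] := CL2_C1b he (pA s s0).
Qed.

Lemma C1b_meas eta deta : C1b eta deta -> exists C,
  [/\ measurable_fun setT eta, measurable_fun setT deta,
      forall x, `|eta x| <= C & forall x, `|deta x| <= C].
Proof.
move=> he; have [_ cm' [C bC]] := he; exists C; split.
- by apply: continuous_measurableT; exact: C1b_cont he.
- exact: continuous_measurableT.
- by move=> x; have [] := bC x.
- by move=> x; have [] := bC x.
Qed.

Lemma L2cont_C1b eta deta A : C1b eta deta -> L2path A -> L2cont A ->
  L2cont (fun s x => (eta x)%:C * A s x).
Proof.
move=> he pA cA; have [C [m1 _ b1 _]] := C1b_meas he.
exact: L2contM m1 b1 pA cA.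
Qed.

Lemma ipM (m : R -> R) v w :
  ip (fun x => (m x)%:C * v x) w = ip v (fun x => (m x)%:C * w x).
Proof.
congr rint; apply/funext => x.
by case: (v x) (w x) => [? ?] [? ?]; rewrite /cdot/=; ring.
Qed.

Lemma ipMM (m n : R -> R) v w :
  ip (fun x => (m x)%:C * v x) (fun x => (n x)%:C * w x) =
  ip (fun x => (n x)%:C * v x) (fun x => (m x)%:C * w x).
Proof.
congr rint; apply/funext => x.
by case: (v x) (w x) => [? ?] [? ?]; rewrite /cdot/=; ring.
Qed.

Lemma ipNr v w : CL2 v -> CL2 w -> ip v (fun x => - w x) = - ip v w.
Proof.
move=> hv hw; rewrite /ip -rintN; last exact: itg_cdot.
congr rint; apply/funext => x.
by case: (v x) (w x) => [? ?] [? ?]; rewrite /cdot/=; ring.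
Qed.

Lemma mulM_i (m : R -> R) v :
  (fun x => (m x)%:C * ('i * v x)) = (fun x => 'i * ((m x)%:C * v x)).
Proof. by apply/funext => x; exact: mulrCA. Qed.

Lemma ip_i0 v : ip v (fun x => 'i * v x) = 0.
Proof.
rewrite -rint0; congr rint; apply/funext => x.
by case: (v x) => [? ?]; rewrite /cdot/=; ring.
Qed.

(** The commutator comes from [(eta^2)' = 2 * eta * deta], with one factor left on each side of the
    pairing. *)
Lemma ibp_weight eta deta v v' w w' : C1b eta deta ->
  CL2 v -> CL2 v' -> CL2 w -> CL2 w' -> weak_deriv v v' -> weak_deriv w w' ->
  ip (fun x => (eta x)%:C * v' x) (fun x => (eta x)%:C * w x) =
  - 2 * ip (fun x => (deta x)%:C * v x) (fun x => (eta x)%:C * w x)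
  - ip (fun x => (eta x)%:C * v x) (fun x => (eta x)%:C * w' x).
Proof.
move=> he hv hv' hw hw' dv dw.
have he2 := C1bM he he.
have [l1 l2] := CL2_C1b he hw; have [l3 l4] := CL2_C1b he hv.
have [l5 _] := CL2_C1b he hw'; have [k1 k2] := CL2_C1b he2 hw.
have [k3 _] := CL2_C1b he2 hw'.
have h := cibp hv hv' k1 (CL2D k2 k3) dv (weak_derivM he2 hw hw' dw).
have E1 : ip v' (fun x => (eta x * eta x)%:C * w x) =
   ip (fun x => (eta x)%:C * v' x) (fun x => (eta x)%:C * w x).
  rewrite ipM; congr ip; apply/funext => x.
  by case: (w x) => [? ?]; apply/eqP; rewrite eq_complex/=; apply/andP; split; apply/eqP; ring.
have E2 : ip v (fun x => (eta x * eta x)%:C * w' x) =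
   ip (fun x => (eta x)%:C * v x) (fun x => (eta x)%:C * w' x).
  rewrite ipM; congr ip; apply/funext => x.
  by case: (w' x) => [? ?]; apply/eqP; rewrite eq_complex/=; apply/andP; split; apply/eqP; ring.
have E3 : ip v (fun x => (deta x * eta x + eta x * deta x)%:C * w x) =
   2 * ip (fun x => (deta x)%:C * v x) (fun x => (eta x)%:C * w x).
  rewrite ipM -ipZr//; last by have [] := CL2_C1b he l1.
  congr ip; apply/funext => x.
  by case: (w x) => [? ?]; apply/eqP; rewrite eq_complex/=; apply/andP; split; apply/eqP; ring.
rewrite -E1 h ipDr// E3 E2; ring.
Qed.

(** The equation is paired with [eta^2 U]. The cubic term drops out, being ['i] times a real
    multiple of [U]; integrating [U_xx] by parts leaves only the commutator with [deta], because
    [<U_x, 'i U_x> = 0]. *)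
Lemma mass_rder eta deta t : C1b eta deta -> 0 <= t ->
  let N s := ip (fun x => (eta x)%:C * U s x) (fun x => (eta x)%:C * U s x) in
  rder N t (- 2 * gamma * N t
    - 2 * ip (fun x => (eta x)%:C * U t x) (fun x => 'i * ((eta x)%:C * G t x))
    - 2 * ip (fun x => (eta x)%:C * U t x) (fun x => 'i * ((deta x)%:C * Ux t x))).
Proof.
move=> he t0 N.
have [C [m1 _ b1 _]] := C1b_meas he.
have [p1 _] := L2path_C1b he (pU H); have [p2 _] := L2path_C1b he (pUt H).
have [p3 p3'] := L2path_C1b he (pUx H); have [p4 _] := L2path_C1b he (pUxx H).
have [p5 _] := L2path_C1b he pG; have [p6 _] := L2path_C1b he pV.
have c1 := L2cont_C1b he (pU H) (cU H).
have d1 := L2derM m1 b1 (pU H) (pUt H) (dU H).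
have := rder_ip t0 p1 p2 p1 p2 c1 d1 d1; congr rder.
rewrite [X in X + _]ipC.
pose u x := (eta x)%:C * U t x.
have hu : CL2 u := p1 t t0.
have E : (fun x => (eta x)%:C * Ut t x) = (fun x =>
   - ('i * ((eta x)%:C * G t x)) - gamma%:C * u x
   + (2^-1)%:C * ('i * ((eta x)%:C * Uxx t x)) + 'i * ((eta x)%:C * V t x)).
  by apply/funext => x; rewrite eqUt /u; ring.
rewrite -/u E.
have q1 := CL2i (p5 t t0); have q2 := CL2i (p4 t t0); have q3 := CL2i (p6 t t0).
have n1 := CL2N q1; have n2 := CL2Z gamma hu; have n3 := CL2Z (2^-1) q2.
rewrite ipDr//; last by apply: CL2D => //; exact: CL2B.
rewrite ipDr//; last exact: CL2B.
rewrite ipBr// ipZr// ipZr//.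
have -> : ip u (fun x => - ('i * ((eta x)%:C * G t x))) =
    - ip u (fun x => 'i * ((eta x)%:C * G t x)).
  by rewrite ipNr.
have -> : ip u (fun x => 'i * ((eta x)%:C * V t x)) = 0.
  rewrite -rint0; congr rint; apply/funext => x; rewrite /u /V /cube.
  by case: (U t x) => [? ?]; rewrite /cdot/=; ring.
have -> : ip u (fun x => 'i * ((eta x)%:C * Uxx t x)) =
    - 2 * ip u (fun x => 'i * ((deta x)%:C * Ux t x)).
  have h := ibp_weight he (CL2i (pUx H t0)) (CL2i (pUxx H t0)) (pU H t0) (pUx H t0)
     (weak_deriv_i (pUx H t0) (pUxx H t0) (wUx H t0)) (wU H t0).
  have Z : ip (fun x => (eta x)%:C * ('i * Ux t x)) (fun x => (eta x)%:C * Ux t x) = 0.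
    rewrite -rint0; congr rint; apply/funext => x.
    by case: (Ux t x) => [? ?]; rewrite /cdot/=; ring.
  rewrite Z subr0 in h.
  rewrite !mulM_i in h.
  by rewrite ipC [ip u _ in RHS]ipC h /u.
by rewrite /N -/u; lra.
Qed.

Lemma sqr_sqrt_le (a b : R) : 0 <= b -> a <= b ^+ 2 -> Num.sqrt a <= b.
Proof. by move=> b0 ab; rewrite -(ger0_norm b0) -sqrtr_sqr ler_wsqrtr. Qed.

(** For [n = |eta U|] the balance gives [(n^2)' <= - 2 n (gamma n - M - c)], so [(M + c) / gamma] is
    a barrier for [n]. *)
Lemma mass_bound eta deta M c : 0 < gamma -> C1b eta deta ->
  (forall t, 0 <= t -> nrm (fun x => (eta x)%:C * G t x) <= M) ->
  (forall t, 0 <= t -> nrm (fun x => (deta x)%:C * Ux t x) <= c) ->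
  forall t, 0 <= t -> nrm (fun x => (eta x)%:C * U t x) <=
    Num.max (nrm (fun x => (eta x)%:C * U 0 x)) ((M + c) / gamma).
Proof.
move=> g0 he bG bUx t t0.
pose u s x := (eta x)%:C * U s x.
have [p1 _] := L2path_C1b he (pU H); have [_ p3'] := L2path_C1b he (pUx H).
have [p5 _] := L2path_C1b he pG.
have c1 := L2cont_C1b he (pU H) (cU H).
have M0 : 0 <= M by apply: le_trans (bG 0 (lexx _)); exact: nrm_ge0.
have c0 : 0 <= c by apply: le_trans (bUx 0 (lexx _)); exact: nrm_ge0.
have k0 : 0 <= (M + c) / gamma by rewrite divr_ge0 ?addr_ge0// ltW.
have := @dini_barrier _ (fun s => ip (u s) (u s)) 0 (((M + c) / gamma) ^+ 2)
  (lexx _) (cont0_ip p1 p1 c1 c1) _ t t0.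
have hC : forall s, 0 <= s -> ((M + c) / gamma) ^+ 2 <= ip (u s) (u s) ->
   udini (fun s => ip (u s) (u s)) s 0.
  move=> s s0 hs.
  apply: udini_le (rder_udini (mass_rder he s0)).
  have := ip_CS (p1 s s0) (CL2i (p5 s s0)).
  have := ip_CS (p1 s s0) (CL2i (p3' s s0)).
  rewrite !nrmi !ler_norml -/(u s) => /andP[h1 _] /andP[h2 _].
  have n0 := nrm_ge0 (u s).
  have b1 := ler_wpM2l n0 (bG s s0); have b2 := ler_wpM2l n0 (bUx s s0).
  have kn : (M + c) / gamma <= nrm (u s) by rewrite -(ler_pXn2r (_ : 0 < 2)%N) ?nnegrE// nrm_sqr.
  rewrite ler_pdivrMr// in kn.
  have b3 := ler_wpM2l n0 kn.
  have E : nrm (u s) * (nrm (u s) * gamma) = gamma * ip (u s) (u s).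
    by rewrite -nrm_sqr; ring.
  rewrite E in b3; lra.
move=> /(_ hC) hN.
set m := Num.max _ _.
have m1 : nrm (u 0) <= m by rewrite le_max lexx.
have m2 : (M + c) / gamma <= m by rewrite le_max lexx orbT.
have m0 : 0 <= m by exact: le_trans m2.
apply: sqr_sqrt_le => //; apply: le_trans hN _; rewrite ge_max; apply/andP; split.
  by rewrite -nrm_sqr ler_pXn2r ?nnegrE ?nrm_ge0.
by rewrite ler_pXn2r ?nnegrE.
Qed.

End Schroedinger.

(** * The energy *)

Section Energy.
Context {R : realType}.
Implicit Types (v w z : R -> R[i]) (x y s t c d k e C M L h : R).
Implicit Types (A B : R -> R -> R[i]) (eta deta : R -> R).

(** [A], [Q] and [F] stand for the squared gradient norm, the quartic term and the pairing with the
    forcing. As [Q] grows at most like [sqrt A], the damping [- 2 * gamma * A] wins for large [A].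
    [K] is chosen before the functions: the uniformity in the cut-off originates here. *)
Lemma energy_barrier (gamma f0 q1 q0 c0 c1 a0 : R) : 0 < gamma ->
  0 <= f0 -> 0 <= q1 -> 0 <= q0 -> 0 <= c0 -> 0 <= c1 ->
  exists K, forall A Q F : R -> R,
    cont0 A -> cont0 Q -> cont0 F ->
    (forall t, 0 <= t -> [/\ 0 <= A t, 0 <= Q t, `|F t| <= f0 &
       Q t <= q1 * Num.sqrt (A t) + q0]) ->
    (forall t, 0 <= t -> udini (fun s => A s + (- Q s + 4 * F s)) t
       (- 2 * gamma * A t + 4 * gamma * Q t + c0 + c1 * Num.sqrt (A t))) ->
    A 0 <= a0 -> forall t, 0 <= t -> A t <= K.
Proof.
move=> g0 f0p q1p q0p c0p c1p.
(* Half of the damping absorbs the terms linear in [r = sqrt A] through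
   [b r <= gamma r^2 + b^2 / (4 gamma)], and [D] collects what is left. An energy above [C0] forces
   [D <= gamma * A]; [C1] also bounds the initial energy. *)
pose b := 4 * gamma * q1 + c1.
pose D := b ^+ 2 / (4 * gamma) + (4 * gamma * q0 + c0).
pose C0 := D / gamma + 4 * f0.
pose C1 := Num.max (a0 + 4 * f0) C0.
exists (2 * (C1 + q1 ^+ 2 / 2 + q0 + 4 * f0)) => A Q F cA cQ cF bnd dE A0 t t0.
pose E s := A s + (- Q s + 4 * F s).
have cE : cont0 E by apply: cont0D => //; apply: cont0D; [exact: cont0N|exact: cont0Z].
have Fb s : 0 <= s -> - f0 <= F s <= f0.
  by move=> s0; have [_ _ + _] := bnd s s0; rewrite ler_norml.
have EC : E t <= Num.max (E 0) C0.
  apply: (@dini_barrier _ E 0) => // s s0 CE; apply: udini_le (dE s s0).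
  have [As Qs _ Qb] := bnd s s0; have /andP[F1 F2] := Fb s s0.
  have AD : D / gamma <= A s by rewrite /E /C0 in CE; lra.
  rewrite ler_pdivrMr// in AD.
  set r := Num.sqrt (A s) in Qb *.
  have r2 : r ^+ 2 = A s by rewrite sqr_sqrtr.
  have h1 : 4 * gamma * Q s <= 4 * gamma * (q1 * r + q0).
    by rewrite ler_pM2l// mulr_gt0.
  have h2 : b * r <= gamma * A s + b ^+ 2 / (4 * gamma).
    rewrite -r2 -subr_ge0.
    rewrite (_ : _ - _ = gamma * (r - b / (2 * gamma)) ^+ 2); last by field; rewrite gt_eqF.
    by rewrite mulr_ge0 ?sqr_ge0// ltW.
  rewrite /D in AD; rewrite /b in h2 AD; lra.
have EC1 : E t <= C1.
  apply: le_trans EC _; rewrite ge_max /C1 !le_max lexx orbT andbT.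
  have [_ Q0 _ _] := bnd 0 (lexx _); have /andP[F1 F2] := Fb 0 (lexx _).
  by apply/orP; left; rewrite /E; lra.
have [At Qt _ Qb] := bnd t t0; have /andP[F1 F2] := Fb t t0.
set r := Num.sqrt (A t) in Qb.
have r2 : r ^+ 2 = A t by rewrite sqr_sqrtr.
have h : q1 * r <= A t / 2 + q1 ^+ 2 / 2 by rewrite -r2; have := sqr_ge0 (r - q1); lra.
rewrite /E in EC1; lra.
Qed.

Context (gamma : R) (U Ux Uxx Ut G : R -> R -> R[i]).
Context (H : nls_path gamma U Ux Uxx Ut G).
Notation mul m v := (fun x => (m x)%:C * v x).

Lemma quot_cvg eta deta t : C1b eta deta -> 0 <= t ->
  nrm (fun x => ((s - t)^-1)%:C * ((eta x)%:C * U s x - (eta x)%:C * U t x)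
      - (eta x)%:C * Ut t x) @[s --> t^'+] --> 0.
Proof.
move=> he t0; have [C [m1 _ b1 _]] := C1b_meas he.
exact: (L2derM m1 b1 (pU H) (pUt H) (dU H) t0).
Qed.

Lemma quot_CL2 eta deta t : C1b eta deta -> 0 <= t ->
  \forall s \near t^'+,
  CL2 (fun x => ((s - t)^-1)%:C * ((eta x)%:C * U s x - (eta x)%:C * U t x)).
Proof.
move=> he t0; have [p1 _] := L2path_C1b he (pU H).
apply: filterS (near_ge0 t0) => s s0; apply: CL2Z; apply: CL2B; exact: p1.
Qed.

Lemma add_cvg (m : R -> R) C A t : measurable_fun setT m -> (forall x, `|m x| <= C) ->
  L2path A -> L2cont A -> 0 <= t ->
  nrm (fun x => (m x)%:C * (A s x + A t x) - 2%:C * ((m x)%:C * A t x)) @[s --> t^'+] --> 0.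
Proof.
move=> mm bm pA cA t0.
have := L2cont_right t0 (L2contM mm bm pA cA); apply: cvg_trans.
apply: near_eq_cvg; apply: nearW => s /=; congr nrm; apply/funext => x.
case: (A s x) (A t x) => [? ?] [? ?]; apply/eqP; rewrite eq_complex/=; apply/andP; split; apply/eqP; ring.
Qed.

Lemma grad_rder eta deta t : C1b eta deta -> 0 <= t ->
  rder (fun s => ip (mul eta (Ux s)) (mul eta (Ux s))) t
   (- 2 * ip (mul eta (Ut t)) (mul eta (Uxx t))
    - 4 * ip (mul eta (Ut t)) (mul deta (Ux t))).
Proof.
move=> he t0; have [C [m1 m2 b1 b2]] := C1b_meas he.
pose X s x := ((s - t)^-1)%:C * ((eta x)%:C * U s x - (eta x)%:C * U t x).
have cX := quot_cvg he t0; have hX := quot_CL2 he t0.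
have [q1 q1'] := L2path_C1b he (pUx H); have [q2 _] := L2path_C1b he (pUxx H).
have [q3 _] := L2path_C1b he (pUt H); have [q0 q0'] := L2path_C1b he (pU H).
have k1 := q1' t t0; have k2 := q2 t t0; have k3 := q3 t t0.
have c1 : ip (X s) (fun x => (deta x)%:C * (Ux s x + Ux t x)) @[s --> t^'+] -->
    ip (mul eta (Ut t)) (fun x => 2%:C * ((deta x)%:C * Ux t x)).
  apply: ip_cvg => //.
  - apply: filterS (near_ge0 t0) => s s0.
    by apply: (CL2M m2 b2); apply: CL2D; apply: (pUx H).
  - exact: CL2Z.
  - exact: (add_cvg m2 b2 (pUx H) (cUx H) t0).
have c2 : ip (X s) (fun x => (eta x)%:C * (Uxx s x + Uxx t x)) @[s --> t^'+] -->
    ip (mul eta (Ut t)) (fun x => 2%:C * ((eta x)%:C * Uxx t x)).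
  apply: ip_cvg => //.
  - apply: filterS (near_ge0 t0) => s s0.
    by apply: (CL2M m1 b1); apply: CL2D; apply: (pUxx H).
  - exact: CL2Z.
  - exact: (add_cvg m1 b1 (pUxx H) (cUxx H) t0).
rewrite ipZr// in c1; rewrite ipZr// in c2.
have c3 : - 2 * ip (X s) (fun x => (deta x)%:C * (Ux s x + Ux t x))
   - ip (X s) (fun x => (eta x)%:C * (Uxx s x + Uxx t x)) @[s --> t^'+] -->
   - 2 * (2 * ip (mul eta (Ut t)) (mul deta (Ux t)))
   - 2 * ip (mul eta (Ut t)) (mul eta (Uxx t)).
  by apply: cvgB => //; apply: cvgM => //; exact: cvg_cst.
rewrite /rder (_ : _ - _ = - 2 * (2 * ip (mul eta (Ut t)) (mul deta (Ux t)))
   - 2 * ip (mul eta (Ut t)) (mul eta (Uxx t))); last by ring.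
apply: cvg_trans c3; apply: near_eq_cvg.
apply: filterS (near_ge0 t0) => s s0.
have u1 := pU H s0; have u2 := pU H t0; have x1 := pUx H s0; have x2 := pUx H t0.
have y1 := pUxx H s0; have y2 := pUxx H t0.
have wd1 := weak_derivD u1 x1 (CL2N u2) (CL2N x2) (wU H s0)
   (weak_derivN u2 x2 (wU H t0)).
have wd2 := weak_derivD x1 y1 x2 y2 (wUx H s0) (wUx H t0).
have I := ibp_weight he (CL2B u1 u2) (CL2B x1 x2) (CL2D x1 x2) (CL2D y1 y2) wd1 wd2.
have e1 := q0 s s0; have e2 := q0 t t0; have e3 := q1 s s0; have e4 := q1 t t0.
have w1 : CL2 (fun x => (deta x)%:C * (Ux s x + Ux t x)).
  by apply: (CL2M m2 b2); exact: CL2D.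
have w2 : CL2 (fun x => (eta x)%:C * (Uxx s x + Uxx t x)).
  by apply: (CL2M m1 b1); exact: CL2D.
have Eu : (fun x => (eta x)%:C * U s x - (eta x)%:C * U t x) =
   (fun x => (eta x)%:C * (U s x - U t x)).
  by apply/funext => x; rewrite mulrBr.
rewrite /X !ipZl//; [|exact: CL2B|exact: CL2B].
rewrite Eu.
have -> : ip (mul eta (Ux s)) (mul eta (Ux s)) - ip (mul eta (Ux t)) (mul eta (Ux t)) =
   ip (fun x => (eta x)%:C * (Ux s x - Ux t x)) (fun x => (eta x)%:C * (Ux s x + Ux t x)).
  have -> : (fun x => (eta x)%:C * (Ux s x - Ux t x)) =
     (fun x => (eta x)%:C * Ux s x - (eta x)%:C * Ux t x).
    by apply/funext => x; rewrite mulrBr.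
  have -> : (fun x => (eta x)%:C * (Ux s x + Ux t x)) =
     (fun x => (eta x)%:C * Ux s x + (eta x)%:C * Ux t x).
    by apply/funext => x; rewrite mulrDr.
  rewrite ipBl//; last exact: CL2D.
  rewrite !ipDr// [ip (mul eta (Ux t)) (mul eta (Ux s))]ipC; ring.
rewrite I ipMM; ring.
Qed.

(** By [quartic_diff] the increment pairs [U(s) - U(t)] with [W s], which tends in L^2 to four times
    the cubic term. *)
Lemma quartic_rder eta deta t : C1b eta deta -> 0 <= t ->
  rder (fun s => ip (mul eta (V U s)) (mul eta (U s))) t
   (4 * ip (mul eta (V U t)) (mul eta (Ut t))).
Proof.
move=> he t0; have [C [m1 m2 b1 b2]] := C1b_meas he.
have C0 : 0 <= C by exact: le_trans (b1 0).
pose X s x := ((s - t)^-1)%:C * ((eta x)%:C * U s x - (eta x)%:C * U t x).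
have cX := quot_cvg he t0; have hX := quot_CL2 he t0.
pose W s x : R[i] := (normc (U s x) ^+ 2 + normc (U t x) ^+ 2)%:C * (U s x + U t x).
have hW s : 0 <= s -> CL2 (W s).
  move=> s0; apply: (@CL2M _ _ _ (supU U Ux s + supU U Ux t)).
  - by apply: measurable_funD; apply: measurable_normc_sqr; exact: (pU H).
  - move=> x; rewrite ger0_norm ?addr_ge0 ?sqr_ge0//.
    by apply: lerD; exact: (supU_le H).
  - by apply: CL2D; exact: (pU H).
have [q0 _] := L2path_C1b he (pU H); have [q1 _] := L2path_C1b he (pV H).
have [q3 _] := L2path_C1b he (pUt H).
have k1 := q1 t t0; have k3 := q3 t t0.
have c1 : ip (X s) (mul eta (W s)) @[s --> t^'+] -->
   ip (mul eta (Ut t)) (fun x => 4%:C * ((eta x)%:C * V U t x)).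
  apply: ip_cvg => //.
  - by apply: filterS (near_ge0 t0) => s s0; apply: (CL2M m1 b1); exact: hW.
  - exact: CL2Z.
  - apply: (@cvg0_le _ _ _ _ (fun s => C * (6 * (supU U Ux s + supU U Ux t)) *
        nrm (fun x => U s x - U t x))).
      apply: filterS (near_ge0 t0) => s s0; rewrite ger0_norm ?nrm_ge0//.
      have M0 : 0 <= 6 * (supU U Ux s + supU U Ux t).
        by rewrite mulr_ge0// addr_ge0// supU_ge0.
      apply: nrm_le_normc.
      + exact: mulr_ge0.
      + by apply: CL2B; [apply: (CL2M m1 b1); exact: hW|exact: CL2Z].
      + by apply: CL2B; exact: (pU H).
      + move=> x.
        have -> : (eta x)%:C * W s x - 4%:C * ((eta x)%:C * V U t x) =
           (eta x)%:C * (W s x - 4%:C * V U t x) by ring.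
        rewrite normcM normc_real -mulrA; apply: ler_pM => //; first exact: normc_ge0.
        apply: quartic_lip.
          by rewrite ler_wpDr ?supU_ge0// (supU_le H).
        by rewrite ler_wpDl ?supU_ge0// (supU_le H).
    rewrite -[X in _ --> X](mulr0 (C * (6 * (supU U Ux t + supU U Ux t)))).
    apply: cvgM; last exact: L2cont_right t0 (cU H).
    apply: cvgM; first exact: cvg_cst.
    apply: cvgM; first exact: cvg_cst.
    apply: cvgD; last exact: cvg_cst.
    by move=> P /(cont0_supU H t0); exact: right_within.
rewrite ipZr// ipC in c1.
rewrite /rder; apply: cvg_trans c1; apply: near_eq_cvg.
apply: filterS (near_ge0 t0) => s s0.
have e1 := q0 s s0; have e2 := q0 t t0; have e3 := q1 s s0; have e4 := q1 t t0.
have hWs : CL2 (mul eta (W s)) by apply: (CL2M m1 b1); exact: hW.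
rewrite /X ipZl//; last exact: CL2B.
rewrite mulrC; congr (_ / _).
rewrite /ip -rintB; [|exact: itg_cdot|exact: itg_cdot].
congr rint; apply/funext => x.
have := quartic_diff (U s x) (U t x); rewrite /W /V /cube !normc_sqr.
move: (U s x) (U t x) => [a1 a2] [d1 d2]; rewrite /cdot/= => h.
have := congr1 (fun r => eta x ^+ 2 * r) h => /= h'.
by lra.
Qed.

End Energy.

(** * The energy balance with Lipschitz forcing *)

Section EnergyBound.
Context {R : realType}.
Implicit Types (v w z : R -> R[i]) (x y s t c d k e C M L h : R).
Implicit Types (A B : R -> R -> R[i]) (eta deta : R -> R).
Context (gamma : R) (U Ux Uxx Ut G : R -> R -> R[i]).
Context (H : nls_path gamma U Ux Uxx Ut G).
Notation mul m v := (fun x => (m x)%:C * v x).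

(** The increment of [G] costs at most [L * |eta U|] per unit of time; this bound stands in for the
    pairing of [U] with the time derivative of [G]. *)
Lemma force_udini eta deta L t : C1b eta deta -> 0 <= t ->
  (forall s t, 0 <= s -> 0 <= t ->
    nrm (fun x => (eta x)%:C * (G s x - G t x)) <= L * `|s - t|) ->
  udini (fun s => ip (mul eta (G s)) (mul eta (U s))) t
   (L * nrm (mul eta (U t)) + ip (mul eta (G t)) (mul eta (Ut t))).
Proof.
move=> he t0 lip; have [C [m1 m2 b1 b2]] := C1b_meas he.
have L0 : 0 <= L.
  have := le_trans (nrm_ge0 _) (lip 1 0 ler01 (lexx _)).
  by rewrite subr0 normr1 mulr1.
have cX := quot_cvg H he t0; have hX := quot_CL2 H he t0.
pose X s x := ((s - t)^-1)%:C * ((eta x)%:C * U s x - (eta x)%:C * U t x).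
have [q0 _] := L2path_C1b he (pU H); have [q1 _] := L2path_C1b he (pG H).
have [q3 _] := L2path_C1b he (pUt H).
have cq0 := L2cont_C1b he (pU H) (cU H).
have k1 := q1 t t0; have k2 := q0 t t0; have k3 := q3 t t0.
have c1 : ip (mul eta (G t)) (X s) @[s --> t^'+] --> ip (mul eta (G t)) (mul eta (Ut t)).
  apply: (@ip_cvg _ _ _ (fun=> mul eta (G t))) => //; first exact: nearW.
  rewrite (_ : (fun _ => _) = cst 0); first exact: cvg_cst.
  apply/funext => s; rewrite /nrm /ip (_ : (fun x => _) = (fun=> 0)) ?rint0 ?sqrtr0//.
  by apply/funext => x; rewrite subrr /cdot/= mulr0 addr0.
have c2 : L * nrm (mul eta (U s)) @[s --> t^'+] --> L * nrm (mul eta (U t)).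
  apply: cvgM; first exact: cvg_cst.
  apply: nrmB_cvg => //; last exact: L2cont_right t0 cq0.
  exact: L2path_right t0 q0.
have c3 : L * nrm (mul eta (U s)) + ip (mul eta (G t)) (X s) @[s --> t^'+] -->
    L * nrm (mul eta (U t)) + ip (mul eta (G t)) (mul eta (Ut t)) by exact: cvgD.
move/cvgrPdist_lt : c3 => h e e0.
near=> s.
have s0 : 0 <= s by near: s; exact: near_ge0.
have ts : 0 < s - t by rewrite subr_gt0; near: s; exact: near_right_gt.
have hs : `|L * nrm (mul eta (U t)) + ip (mul eta (G t)) (mul eta (Ut t)) -
   (L * nrm (mul eta (U s)) + ip (mul eta (G t)) (X s))| < e by near: s; exact: h.
have e1 := q0 s s0; have e3 := q1 s s0.
have E1 : ip (mul eta (G t)) (X s) * (s - t) =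
    ip (mul eta (G t)) (mul eta (U s)) - ip (mul eta (G t)) (mul eta (U t)).
  rewrite /X ipZr//; last exact: CL2B.
  by rewrite ipBr// mulrC mulrA divff ?mul1r// gt_eqF.
have E2 : ip (mul eta (G s)) (mul eta (U s)) - ip (mul eta (G t)) (mul eta (U s)) <=
    L * (s - t) * nrm (mul eta (U s)).
  rewrite -ipBl//; apply: le_trans (ler_norm _) _; apply: le_trans (ip_CS _ _) _ => //.
    exact: CL2B.
  apply: ler_wpM2r; first exact: nrm_ge0.
  have := lip s t s0 t0; rewrite (gtr0_norm ts).
  by under eq_fun do rewrite mulrBr.
have hs' : L * nrm (mul eta (U s)) + ip (mul eta (G t)) (X s) <=
  L * nrm (mul eta (U t)) + ip (mul eta (G t)) (mul eta (Ut t)) + e.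
  by move: hs; rewrite ltr_norml => /andP[]; lra.
have := ler_wpM2r (ltW ts) hs'; lra.
Unshelve. all: by end_near. Qed.

(** By the equation, [Y = U_xx / 2 + |U|^2 U - G] equals [- 'i] times [Z = U_t + gamma U], both
    weighted by [eta], so [<Y, Z> = 0]. This trades each pairing with [U_t] for [- gamma] times the
    pairing with [U]. *)
Lemma energy_identity eta deta t : C1b eta deta -> 0 <= t ->
  - 2 * ip (mul eta (Ut t)) (mul eta (Uxx t)) - 4 * ip (mul eta (V U t)) (mul eta (Ut t))
  + 4 * ip (mul eta (G t)) (mul eta (Ut t)) =
  - 2 * gamma * ip (mul eta (Ux t)) (mul eta (Ux t))
  - 4 * gamma * ip (mul deta (U t)) (mul eta (Ux t))
  + 4 * gamma * ip (mul eta (V U t)) (mul eta (U t))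
  - 4 * gamma * ip (mul eta (G t)) (mul eta (U t)).
Proof.
move=> he t0.
have [q0 q0'] := L2path_C1b he (pU H); have [q1 _] := L2path_C1b he (pG H).
have [q2 _] := L2path_C1b he (pUx H); have [q3 _] := L2path_C1b he (pUt H).
have [q4 _] := L2path_C1b he (pUxx H); have [q5 _] := L2path_C1b he (pV H).
have k0 := q0 t t0; have k1 := q1 t t0; have k2 := q2 t t0; have k3 := q3 t t0.
have k4 := q4 t t0; have k5 := q5 t t0; have k0' := q0' t t0.
have I := ibp_weight he (pUx H t0) (pUxx H t0) (pU H t0) (pUx H t0) (wUx H t0) (wU H t0).
rewrite ipMM [ip (mul eta (Ux t)) (mul deta _)]ipC in I.
pose Z x := (eta x)%:C * Ut t x + gamma%:C * ((eta x)%:C * U t x).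
pose Y x := (2^-1)%:C * ((eta x)%:C * Uxx t x) + (eta x)%:C * V U t x - (eta x)%:C * G t x.
have hY : CL2 (fun x => (2^-1)%:C * ((eta x)%:C * Uxx t x) + (eta x)%:C * V U t x).
  by apply: CL2D => //; exact: CL2Z.
have hZ : CL2 Z by apply: CL2D => //; exact: CL2Z.
have YZ : ip Y Z = 0.
  rewrite -rint0; congr rint; apply/funext => x; rewrite /Y /Z (eqU H) -/(V U t x).
  have -> : (2^-1)%:C * ((eta x)%:C * Uxx t x) + (eta x)%:C * V U t x -
    (eta x)%:C * ('i * Ut t x + (2^-1)%:C * Uxx t x + cube (U t x) +
      'i * (gamma%:C * U t x)) =
    - ('i * ((eta x)%:C * Ut t x + gamma%:C * ((eta x)%:C * U t x))).
    by rewrite /V; ring.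
  move: ((eta x)%:C * Ut t x + _) => [? ?]; rewrite /cdot/=; ring.
have kg := CL2Z gamma k0; have k4' := CL2Z (2^-1) k4.
have /esym := YZ; rewrite /Y /Z ipBl// ipDl// ipZl// !ipDr// !ipZr//.
rewrite [ip (mul eta (Ut t)) _]ipC.
move=> YZ'; have I' := congr1 (fun r => gamma * r) I; rewrite /= in I'; lra.
Qed.

(** The coefficients 1, -1 and 4 make the terms in [U_t] add up to [- 4 <Y, U_t>] with the [Y] of
    [energy_identity]; besides these there are the Lipschitz cost of the forcing and one commutator
    in [deta * U_t]. *)
Lemma energy_udini eta deta L t : C1b eta deta -> 0 <= t ->
  (forall s t, 0 <= s -> 0 <= t ->
    nrm (fun x => (eta x)%:C * (G s x - G t x)) <= L * `|s - t|) ->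
  let A s := ip (mul eta (Ux s)) (mul eta (Ux s)) in
  let Q s := ip (mul eta (V U s)) (mul eta (U s)) in
  let F s := ip (mul eta (G s)) (mul eta (U s)) in
  udini (fun s => A s + (- Q s + 4 * F s)) t
    (- 2 * gamma * A t + 4 * gamma * Q t - 4 * gamma * F t
     + 4 * L * nrm (mul eta (U t))
     - 4 * gamma * ip (mul deta (U t)) (mul eta (Ux t))
     - 4 * ip (mul deta (Ut t)) (mul eta (Ux t))).
Proof.
move=> he t0 lip A Q F.
have dA := rder_udini (grad_rder H he t0).
have dQ := rder_udini (rderZ (k := -1) (quartic_rder H he t0)).
have dF := force_udini he t0 lip.
have dF4 : udini (fun s => 4 * F s) t (4 * (L * nrm (mul eta (U t)) +
    ip (mul eta (G t)) (mul eta (Ut t)))).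
  move=> e e0; have e4 : 0 < e / 4 by lra.
  apply: filterS (dF _ e4) => s; rewrite -/(F s) -/(F t); lra.
have dQ' : udini (fun s => - Q s) t (- 1 * (4 * ip (mul eta (V U t)) (mul eta (Ut t)))).
  by under eq_fun do rewrite -mulN1r.
apply: udini_le (udiniD dA (udiniD dQ' dF4)).
have := energy_identity he t0.
rewrite [ip (mul deta (Ut t)) _]ipMM -/(A t) -/(Q t) -/(F t); lra.
Qed.

End EnergyBound.

(** * A gradient bound uniform in the cut-off *)

Section EnergyBoundUniform.
Context {R : realType}.
Notation mul m v := (fun x => (m x)%:C * v x).

(** Serves twice. With [eta = 1] the quartic term is interpolated through [q1], and [c = 0]; with
    the bumps [q1 = 0], and [c] carries the commutators. *)
Lemma energy_bound (gamma L M n q1 q0 c a0 : R) : 0 < gamma ->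
  0 <= L -> 0 <= M -> 0 <= n -> 0 <= q1 -> 0 <= q0 -> 0 <= c ->
  exists K : R, forall (U Ux Uxx Ut G : R -> R -> R[i]) (eta deta : R -> R),
    nls_path gamma U Ux Uxx Ut G -> C1b eta deta ->
    (forall s t : R, 0 <= s -> 0 <= t ->
       nrm (fun x => (eta x)%:C * (G s x - G t x)) <= L * `|s - t|) ->
    (forall t : R, 0 <= t -> nrm (mul eta (G t)) <= M) ->
    (forall t : R, 0 <= t -> nrm (mul eta (U t)) <= n) ->
    (forall t : R, 0 <= t -> ip (mul eta (V U t)) (mul eta (U t)) <=
        q1 * nrm (mul eta (Ux t)) + q0) ->
    (forall t : R, 0 <= t -> gamma * nrm (mul deta (U t)) + nrm (mul deta (Ut t)) <= c) ->
    nrm (mul eta (Ux 0)) ^+ 2 <= a0 ->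
    forall t : R, 0 <= t -> nrm (mul eta (Ux t)) ^+ 2 <= K.
Proof.
move=> g0 L0 M0 n0 q10 q00 c0.
have Mn0 : 0 <= M * n by exact: mulr_ge0.
have Ln0 : 0 <= L * n by exact: mulr_ge0.
have gMn0 : 0 <= gamma * (M * n) by rewrite mulr_ge0// ltW.
have cn0 : 0 <= 4 * gamma * (M * n) + 4 * (L * n) by lra.
have c40 : 0 <= 4 * c by lra.
have [K HK] := @energy_barrier R gamma _ _ _ _ _ a0 g0 Mn0 q10 q00 cn0 c40.
exists K => U Ux Uxx Ut G eta deta H he lip bG bU bQ bd A0 t t0.
have [q_0 q_0'] := L2path_C1b he (pU H); have [q_1 _] := L2path_C1b he (pG H).
have [q_2 _] := L2path_C1b he (pUx H); have [_ q_3] := L2path_C1b he (pUt H).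
have [q_5 _] := L2path_C1b he (pV H).
have c_0 := L2cont_C1b he (pU H) (cU H); have c_1 := L2cont_C1b he (pG H) (cG H).
have c_2 := L2cont_C1b he (pUx H) (cUx H); have c_5 := L2cont_C1b he (pV H) (cV H).
rewrite nrm_sqr; apply: (HK (fun s => ip (mul eta (Ux s)) (mul eta (Ux s)))
  (fun s => ip (mul eta (V U s)) (mul eta (U s)))
  (fun s => ip (mul eta (G s)) (mul eta (U s)))) => //.
- exact: cont0_ip.
- exact: cont0_ip.
- exact: cont0_ip.
- move=> s s0; split.
  + exact: ip_ge0.
  + apply: rint_ge0 => x; rewrite /V /cube.
    have -> : cdot ((eta x)%:C * ((normc (U s x) ^+ 2)%:C * U s x)) ((eta x)%:C * U s x)
      = eta x ^+ 2 * normc (U s x) ^+ 2 * cdot (U s x) (U s x).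
      move: (normc (U s x) ^+ 2) => r.
      by case: (U s x) => [? ?]; rewrite /cdot/=; ring.
    by apply: mulr_ge0; [apply: mulr_ge0; exact: sqr_ge0|exact: cdot_ge0].
  + apply: le_trans (ip_CS (q_1 s s0) (q_0 s s0)) _.
    by apply: ler_pM; rewrite ?nrm_ge0//; [exact: bG|exact: bU].
  + exact: bQ.
- move=> s s0; apply: udini_le (energy_udini H he s0 lip).
  have := ip_CS (q_0' s s0) (q_2 s s0); rewrite ler_norml => /andP[h2' _].
  have := ip_CS (q_3 s s0) (q_2 s s0); rewrite ler_norml => /andP[h1' _].
  have h2 : - ip (mul deta (U s)) (mul eta (Ux s)) <=
     nrm (mul deta (U s)) * nrm (mul eta (Ux s)) by lra.
  have h1 : - ip (mul deta (Ut s)) (mul eta (Ux s)) <=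
     nrm (mul deta (Ut s)) * nrm (mul eta (Ux s)) by lra.
  set r := Num.sqrt _.
  have r0 : 0 <= r by exact: sqrtr_ge0.
  have hr : r = nrm (mul eta (Ux s)) by [].
  have h3 := ler_wpM2r r0 (bd s s0).
  have h4 := ler_wpM2l (ltW g0) h2.
  have h5 := ler_wpM2l L0 (bU s s0).
  have h6 : `|ip (mul eta (G s)) (mul eta (U s))| <= M * n.
    apply: le_trans (ip_CS (q_1 s s0) (q_0 s s0)) _.
    by apply: ler_pM; rewrite ?nrm_ge0//; [exact: bG|exact: bU].
  have h7 : - ip (mul eta (G s)) (mul eta (U s)) <= M * n.
    by move: h6; rewrite ler_norml => /andP[]; lra.
  have h8 := ler_wpM2l (ltW g0) h7.
  rewrite -hr in h1 h2 h4; lra.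
- by rewrite -nrm_sqr.
Qed.

End EnergyBoundUniform.

(** * Time difference quotients *)

Section TimeTools.
Context {R : realType}.
Local Notation mu := (@lebesgue_measure R).
Implicit Types (f k : R -> R) (x y s t c d e C M L h : R).
Implicit Types (A B : R -> R -> R[i]).

Lemma L2contP A : L2cont A -> forall t, 0 <= t -> forall e, 0 < e ->
  exists2 d : R, 0 < d & forall s, 0 <= s -> `|s - t| < d ->
    nrm (fun x => A s x - A t x) < e.
Proof.
move=> cA t t0 e e0; move/cvgrPdist_lt : (cA t t0) => /(_ e e0).
rewrite near_withinE => -[d /= d0 dH]; exists d => // s s0 sd.
have := dH s; rewrite /ball_/= distrC in_itv/= andbT => /(_ sd s0).
by rewrite sub0r normrN ger0_norm ?nrm_ge0.
Qed.

Lemma L2cont_shift A h : 0 <= h -> L2cont A -> L2cont (fun s => A (s + h)).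
Proof.
move=> h0 cA t t0; apply/cvgrPdist_lt => e e0.
have [d d0 dH] := L2contP cA (addr_ge0 t0 h0) e0.
rewrite near_withinE; exists d => //= s sd; rewrite /= in_itv/= andbT => s0.
rewrite sub0r normrN ger0_norm ?nrm_ge0//; apply: dH; first exact: addr_ge0.
by rewrite opprD addrACA subrr addr0 distrC.
Qed.

Lemma L2der_shift A B h : 0 <= h -> L2der A B ->
  L2der (fun s => A (s + h)) (fun s => B (s + h)).
Proof.
move=> h0 dA t t0; apply/cvgrPdist_lt => e e0.
move/cvgrPdist_lt : (dA _ (addr_ge0 t0 h0)) => /(_ e e0).
rewrite /at_right !near_withinE => -[d /= d0 dH]; exists d => //= s sd ts.
have := dH (s + h); rewrite /ball_/= opprD addrACA subrr addr0 => /(_ sd).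
rewrite ltrD2r => /(_ ts).
have -> // : s + h - (t + h) = s - t by rewrite opprD addrACA subrr addr0.
Qed.

Lemma L2pathB A B : L2path A -> L2path B -> L2path (fun s x => A s x - B s x).
Proof. by move=> pA pB s s0; apply: CL2B; [exact: pA|exact: pB]. Qed.

Lemma L2contB A B : L2path A -> L2path B -> L2cont A -> L2cont B ->
  L2cont (fun s x => A s x - B s x).
Proof.
move=> pA pB cA cB; apply: L2contD => //; last exact: L2contN.
by move=> s s0; apply: CL2N; exact: pB.
Qed.

Lemma L2derB A A' B B' : L2path A -> L2path B -> L2path A' -> L2path B' ->
  L2der A A' -> L2der B B' ->
  L2der (fun s x => A s x - B s x) (fun s x => A' s x - B' s x).
Proof.
move=> pA pB pA' pB' dA dB t t0.
apply: (@cvg0_le _ _ _ _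
  (fun s => nrm (fun x => ((s - t)^-1)%:C * (A s x - A t x) - A' t x) +
            nrm (fun x => ((s - t)^-1)%:C * (B s x - B t x) - B' t x))).
  apply: filterS (near_ge0 t0) => s s0; rewrite ger0_norm ?nrm_ge0//.
  rewrite -[nrm (fun x => ((s - t)^-1)%:C * (B s x - B t x) - B' t x)]nrmN.
  have -> : (fun x => ((s - t)^-1)%:C * (A s x - B s x - (A t x - B t x)) - (A' t x - B' t x))
    = (fun x => ((s - t)^-1)%:C * (A s x - A t x) - A' t x +
        - (((s - t)^-1)%:C * (B s x - B t x) - B' t x)) by apply/funext => x; ring.
  apply: nrmD.
    by apply: CL2B; [apply: CL2Z; apply: CL2B; exact: pA|exact: pA'].
  by apply: CL2N; apply: CL2B; [apply: CL2Z; apply: CL2B; exact: pB|exact: pB'].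
by rewrite -[X in _ --> X](addr0 0); apply: cvgD; [exact: dA|exact: dB].
Qed.

Lemma cont0_bounded f (T : R) : cont0 f -> 0 <= T ->
  exists2 C : R, 0 <= C & forall t, 0 <= t <= T -> f t <= C.
Proof.
move=> cf T0.
have cf' : {within `[0, T], continuous f}.
  have cI : {within `[0, +oo[, continuous f}.
    by apply/subspace_continuousP => x; rewrite /= in_itv/= andbT => x0; exact: cf.
  apply: continuous_subspaceW cI.
  by move=> x; rewrite /= !in_itv/= andbT => /andP[].
have [c _ Hc] := EVT_max T0 cf'.
exists `|f c| => // t tT; apply: le_trans (ler_norm _); apply: Hc.
by rewrite in_itv.
Qed.

(** Even extension turns continuity on [[0, +oo[] into continuity on the line. *)
Lemma cont0_abs f : cont0 f -> continuous (fun s => f `|s|).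
Proof.
move=> cf x; apply/cvgrPdist_lt => e e0.
have [d d0 dH] := cont0P cf (normr_ge0 x) e0.
exists d => //= y xy; rewrite distrC; apply: dH => //.
by apply: le_lt_trans (ler_dist_dist _ _) _; rewrite distrC.
Qed.

Lemma cont0_measurable f : cont0 f -> measurable_fun (`]0%R, +oo[ : set R) f.
Proof.
move=> cf; have mg : measurable_fun (`]0%R, +oo[ : set R) (fun s => f `|s|).
  by apply: measurable_funS (continuous_measurableT (cont0_abs cf)).
apply: eq_measurable_fun mg => s; rewrite inE/= in_itv/= andbT => s0.
by rewrite gtr0_norm.
Qed.

(* Extending [k] evenly makes the fundamental theorem of calculus available at 0. *)
Lemma primitive k : cont0 k -> (forall t, 0 <= t -> 0 <= k t) ->
  (\int[mu]_(t in `]0%R, +oo[) (k t)%:E < +oo)%E ->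
  exists P : R -> R, [/\ cont0 P, forall t, 0 <= t -> rder P t (k t) &
    exists J, forall t, 0 <= t -> 0 <= P t <= J].
Proof.
move=> ck k0 kfin.
pose g s := k `|s|.
have cg : continuous g by exact: cont0_abs.
have g0 s : 0 <= g s by apply: k0.
(* The lower limit -1 makes every [t >= 0] an interior point. *)
pose P t := \int[mu]_(s in `[-1, t]) g s.
have ig (u : R) : mu.-integrable `[-1, u] (EFin \o g).
  apply: continuous_compact_integrable; first exact: segment_compact.
  exact: continuous_subspaceT.
have dP t : 0 <= t -> is_derive t 1 P (g t).
  move=> t0; have t1 : t < t + 1 by rewrite ltrDl.
  have m1 : -1 < t by apply: lt_le_trans t0.
  have [h1 h2] := continuous_FTC1_closed t1 (ig _) m1 (cg t).
  by apply: DeriveDef; [exact: h1|rewrite -derive1E; exact: h2].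
exists P; split.
- move=> t t0; apply: cvg_within_filter; apply: differentiable_continuous.
  by apply/derivable1_diffP; have [] := dP t t0.
- move=> t t0; have -> : k t = g t by rewrite /g ger0_norm.
  have [d1 d2] := dP t t0.
  have c : (fun h => h^-1 *: ((P \o shift t) (h *: (1 : R)) - P t)) @ 0^' --> g t.
    by rewrite -d2; exact: d1.
  apply/cvgrPdist_lt => e e0; move/cvgrPdist_lt : c => /(_ e e0).
  rewrite /dnbhs near_withinE => -[d /= dd dH].
  rewrite /at_right near_withinE; exists d => //= s sd ts.
  have sd' : `|0 - (s - t)| < d by rewrite sub0r normrN distrC.
  have := dH (s - t) sd'; rewrite subr_eq0 gt_eqF// => /(_ isT).
  by rewrite /GRing.scale/= mulr1 subrK mulrC.
- exists (P 0 + fine (\int[mu]_(t in `]0%R, +oo[) (k t)%:E)) => t t0.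
  have Pge0 (u : R) : 0 <= P u by apply: Rintegral_ge0.
  rewrite Pge0/=.
  have kf : (\int[mu]_(t in `]0%R, +oo[) (k t)%:E)%E \is a fin_num.
    rewrite ge0_fin_numE//; apply: integral_ge0 => s; rewrite /= in_itv/= andbT => s0.
    by rewrite lee_fin k0// ltW.
  have eP : P t = P 0 + \int[mu]_(s in `]0, t]) g s.
    have h := @Rintegral_itvB R g (BLeft (-1)) (BRight t) 0 (ig t).
    rewrite -h; first by rewrite /P addrC subrK.
      by rewrite bnd_simp; lra.
    by rewrite bnd_simp.
  rewrite eP lerD2l -lee_fin (fineK kf).
  have iS : mu.-integrable `]0, t] (EFin \o g).
    apply: integrableS (ig t) => //.
    move=> s; rewrite /= !in_itv/= => /andP[s0 ->]; rewrite andbT ltW//.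
    by apply: lt_trans s0; rewrite ltrN10.
  rewrite /Rintegral fineK; last exact: integrable_fin_num iS.
  apply: (@le_trans _ _ (\int[mu]_(s in `]0%R, t]) (k s)%:E)%E).
    rewrite le_eqVlt; apply/orP; left; apply/eqP; apply: eq_integral => s.
    by rewrite inE/= in_itv/= /g => /andP[s0 _]; rewrite gtr0_norm.
  apply: ge0_subset_integral => //.
  + apply/measurable_EFinP.
    exact: cont0_measurable.
  + by move=> s; rewrite /= in_itv/= andbT => s0; rewrite lee_fin k0// ltW.
  + by move=> s; rewrite /= !in_itv/= => /andP[-> _].
Qed.

End TimeTools.

(** * Bounding the time derivative by comparing time translates *)

Section TimeDerivativeBound.
Context {R : realType}.
Implicit Types (x y s t c d e C M L h : R).
Context (gamma : R) (U Ux Uxx Ut G : R -> R -> R[i]).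
Context (H : nls_path gamma U Ux Uxx Ut G).

Definition incr h s : R -> R[i] := fun x => U (s + h) x - U s x.

Lemma diff_rder h t : 0 <= h -> 0 <= t ->
  rder (fun s => ip (incr h s) (incr h s)) t
    (2 * ip (incr h t) (fun x => Ut (t + h) x - Ut t x)).
Proof.
move=> h0 t0; pose d s := incr h s.
have sh (A : R -> R -> R[i]) : L2path A -> L2path (fun s => A (s + h)).
  by move=> pA s s0; apply: pA; exact: addr_ge0.
have pd : L2path d by apply: L2pathB; [apply: sh|]; exact: (pU H).
have pdt : L2path (fun s x => Ut (s + h) x - Ut s x).
  by apply: L2pathB; [apply: (sh Ut)|]; exact: (pUt H).
have cd : L2cont d.
  apply: L2contB; [apply: sh; exact: (pU H)|exact: (pU H)| |exact: (cU H)].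
  by apply: L2cont_shift => //; exact: (cU H).
have dd : L2der d (fun s x => Ut (s + h) x - Ut s x).
  apply: L2derB; [apply: sh; exact: (pU H)|exact: (pU H)
    |apply: (sh Ut); exact: (pUt H)|exact: (pUt H)| |exact: (dU H)].
  by apply: L2der_shift => //; exact: (dU H).
have := rder_ip t0 pd pdt pd pdt cd dd dd; congr rder.
by rewrite ipC; ring.
Qed.

(** The equations at [t + h] and [t] are subtracted and paired with the increment: the term in
    [U_xx] drops out, the forcing costs [L * h], and [cube_flux] controls the cubic difference. *)
Lemma diff_flux h t L m : 0 <= h -> 0 <= t ->
  (forall s t : R, 0 <= s -> 0 <= t -> nrm (fun x => G s x - G t x) <= L * `|s - t|) ->
  supU U Ux t <= m -> supU U Ux (t + h) <= m ->
  2 * ip (incr h t) (fun x => Ut (t + h) x - Ut t x) <=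
  - 2 * gamma * ip (incr h t) (incr h t) + 2 * (L * h) * nrm (incr h t)
  + 4 * m * ip (incr h t) (incr h t).
Proof.
move=> h0 t0 lip m1 m2; pose d := incr h t; rewrite -/d; have th0 := addr_ge0 t0 h0.
have hd : CL2 d by apply: CL2B; exact: (pU H).
have hg : CL2 (fun x => G (t + h) x - G t x) by apply: CL2B; exact: (pG H).
have hx : CL2 (fun x => Ux (t + h) x - Ux t x) by apply: CL2B; exact: (pUx H).
have hxx : CL2 (fun x => Uxx (t + h) x - Uxx t x) by apply: CL2B; exact: (pUxx H).
have hv : CL2 (fun x => V U (t + h) x - V U t x) by apply: CL2B; exact: (pV H).
have E : (fun x => Ut (t + h) x - Ut t x) = (fun x =>
  - ('i * (G (t + h) x - G t x)) - gamma%:C * d x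
  + (2^-1)%:C * ('i * (Uxx (t + h) x - Uxx t x)) + 'i * (V U (t + h) x - V U t x)).
  by apply/funext => x; rewrite !(eqUt H) /d /incr; ring.
have igd := CL2i hg; have ixx := CL2i hxx; have iv := CL2i hv.
rewrite E ipDr//; last by do 2?[apply: CL2D || apply: CL2B]; [exact: CL2N|exact: CL2N (CL2Z _ hd)|exact: CL2Z].
rewrite ipDr//; last first.
- exact: CL2Z.
- by apply: CL2B; [exact: CL2N|exact: CL2Z].
rewrite ipBr//; [|exact: CL2N|exact: CL2Z].
rewrite !ipZr// ipNr//.
have -> : ip d (fun x => 'i * (Uxx (t + h) x - Uxx t x)) = 0.
  have w1 := weak_derivD (pU H th0) (pUx H th0) (CL2N (pU H t0)) (CL2N (pUx H t0))
    (wU H th0) (weak_derivN (pU H t0) (pUx H t0) (wU H t0)).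
  have w2 := weak_derivD (pUx H th0) (pUxx H th0) (CL2N (pUx H t0)) (CL2N (pUxx H t0))
    (wUx H th0) (weak_derivN (pUx H t0) (pUxx H t0) (wUx H t0)).
  rewrite ipC (cibp (CL2i hx) ixx hd hx (weak_deriv_i hx hxx w2) w1).
  by rewrite ipC ip_i0 oppr0.
have b1 : - ip d (fun x => 'i * (G (t + h) x - G t x)) <= nrm d * (L * h).
  have := ip_CS hd igd; rewrite ler_norml nrmi => /andP[b _].
  have := ler_wpM2l (nrm_ge0 d) (lip (t + h) t th0 t0).
  rewrite (addrC t) addrK (ger0_norm h0) addrC in b *; lra.
have b2 : ip d (fun x => 'i * (V U (t + h) x - V U t x)) <= 2 * m * ip d d.
  rewrite -rintZ; last exact: itg_cdot.
  apply: rint_le; [exact: itg_cdot|by apply: itgZ; exact: itg_cdot|].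
  move=> x; apply: cube_flux.
    by apply: le_trans m2; exact: (supU_le H).
  by apply: le_trans m1; exact: (supU_le H).
lra.
Qed.

(** With [supU <= gamma / 4] the cubic contribution is at most half of the damping, so
    [2 * L * h / gamma] is a barrier for the norm of the increment over [h]. This bound is
    proportional to [h]; dividing by [h] and letting it tend to 0 bounds [U_t] without
    differentiating the equation in time. *)
Lemma Ut_bound (L T : R) : 0 < gamma -> 0 <= T ->
  (forall s t : R, 0 <= s -> 0 <= t -> nrm (fun x => G s x - G t x) <= L * `|s - t|) ->
  (forall t : R, T <= t -> supU U Ux t <= gamma / 4) ->
  forall t : R, T <= t -> nrm (Ut t) <= Num.max (nrm (Ut T)) (2 * L / gamma).
Proof.
move=> g0 T0 lip small t Tt; have t0 := le_trans T0 Tt.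
have L0 : 0 <= L.
  have := le_trans (nrm_ge0 _) (lip 1 0 ler01 (lexx _)).
  by rewrite subr0 normr1 mulr1.
pose d h s := incr h s.
have Lg0 : 0 <= 2 * L / gamma by rewrite divr_ge0 ?mulr_ge0// ltW.
have key h : 0 < h -> nrm (d h t) <= Num.max (nrm (d h T)) (2 * L / gamma * h).
  move=> h0; set K := 2 * L / gamma * h.
  have K0 : 0 <= K by rewrite mulr_ge0// ltW.
  have pd : L2path (d h).
    apply: L2pathB; last exact: (pU H).
    by move=> s s0; apply: (pU H); rewrite addr_ge0// ltW.
  have cd : L2cont (d h).
    apply: L2contB; [|exact: (pU H)| |exact: (cU H)].
      by move=> s s0; apply: (pU H); rewrite addr_ge0// ltW.
    by apply: L2cont_shift; [exact: ltW|exact: (cU H)].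
  have hb : ip (d h t) (d h t) <= Num.max (ip (d h T) (d h T)) (K ^+ 2).
    apply: (@dini_barrier _ (fun s => ip (d h s) (d h s)) T) => //; first exact: cont0_ip.
    move=> s Ts hs; have s0 := le_trans T0 Ts.
    apply: udini_le (rder_udini (diff_rder (ltW h0) s0)).
    have Tsh : T <= s + h by rewrite ler_wpDr// ltW.
    apply: le_trans (diff_flux (ltW h0) s0 lip (small _ Ts) (small _ Tsh)) _.
    rewrite -/(d h s); have n0 := nrm_ge0 (d h s).
    have Kn : K <= nrm (d h s) by rewrite -(ler_pXn2r (_ : 0 < 2)%N) ?nnegrE// nrm_sqr.
    have Kn' : 2 * L * h <= gamma * nrm (d h s).
      by move: Kn; rewrite /K mulrAC ler_pdivrMr// [gamma * _]mulrC.
    have := ler_wpM2r n0 Kn'; rewrite -(nrm_sqr (d h s)) expr2; lra.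
  set m := Num.max _ _.
  have e1 : nrm (d h T) <= m by rewrite le_max lexx.
  have e2 : K <= m by rewrite le_max lexx orbT.
  have m0 : 0 <= m by exact: le_trans e2.
  apply: sqr_sqrt_le => //; apply: le_trans hb _; rewrite ge_max; apply/andP; split.
    by rewrite -nrm_sqr ler_pXn2r ?nnegrE ?nrm_ge0.
  by rewrite ler_pXn2r ?nnegrE.
have lim s : 0 <= s -> nrm (fun x => ((u - s)^-1)%:C * (U u x - U s x)) @[u --> s^'+] --> nrm (Ut s).
  move=> s0; apply: nrmB_cvg; [|exact: (pUt H)|exact: (dU H)].
  by apply: filterS (near_ge0 s0) => u u0; apply: CL2Z; apply: CL2B; exact: (pU H).
apply/ler_addgt0Pr => /= e e0; have e2 : 0 < e / 2 by lra.
move/cvgrPdist_lt : (lim t t0) => /(_ _ e2).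
rewrite /at_right near_withinE => -[d1 /= d10 dH1].
move/cvgrPdist_lt : (lim T T0) => /(_ _ e2).
rewrite /at_right near_withinE => -[d2 /= d20 dH2].
(* A single [h] must serve both quotients, the one at [t] and the one at the starting time [T]. *)
have [h [h0 hd1 hd2]] : exists h : R, [/\ 0 < h, h < d1 & h < d2].
  have m1 : Num.min d1 d2 <= d1 by rewrite ge_min lexx.
  have m2 : Num.min d1 d2 <= d2 by rewrite ge_min lexx orbT.
  have m0 : 0 < Num.min d1 d2 by rewrite lt_min d10.
  by exists (Num.min d1 d2 / 2); split; lra.
have q s : 0 <= s -> nrm (fun x => ((s + h - s)^-1)%:C * (U (s + h) x - U s x)) = h^-1 * nrm (d h s).
  move=> s0; rewrite nrmZ; last by apply: CL2B; apply: (pU H) => //; rewrite addr_ge0// ltW.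
  by rewrite addrAC subrr add0r ger0_norm// invr_ge0 ltW.
have bb (s dd : R) : h < dd -> `|s - (s + h)| < dd.
  by rewrite opprD addrA subrr add0r normrN gtr0_norm.
have tl (s : R) : s < s + h by rewrite ltrDl.
have := dH1 (t + h) (bb _ _ hd1) (tl t); rewrite q// ltr_norml => /andP[_ a1].
have := dH2 (T + h) (bb _ _ hd2) (tl T); rewrite q// ltr_norml => /andP[a2 _].
set m := Num.max _ _.
have hm : h^-1 * nrm (d h t) <= m + e / 2.
  rewrite mulrC ler_pdivrMr//; apply: le_trans (key h h0) _; rewrite ge_max; apply/andP; split.
    rewrite -ler_pdivrMr// mulrC.
    have : nrm (Ut T) <= m by rewrite le_max lexx.
    lra.
  rewrite ler_pM2r//; have : 2 * L / gamma <= m by rewrite le_max lexx orbT.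
  lra.
lra.
Qed.

End TimeDerivativeBound.

(** * Bounds uniform in time *)

Section UniformBounds.
Context {R : realType}.
Local Notation mu := (@lebesgue_measure R).
Local Notation Re := complex.Re.
Local Notation Im := complex.Im.
Implicit Types (x y s t d e C T h : R) (v : R -> R[i]).
Notation mul m v := (fun x => (m x)%:C * v x).

Lemma mul1C v : mul (fun=> 1) v = v.
Proof. by apply/funext => x; rewrite rmorph1 mul1r. Qed.

Lemma nrm_mul0 v : nrm (mul (fun=> 0) v) = 0.
Proof.
rewrite /nrm (_ : ip _ _ = 0) ?sqrtr0//.
by rewrite -[RHS]rint0; congr rint; apply/funext => x; case: (v x) => [? ?]; rewrite /cdot/=; ring.
Qed.

Context (gamma : R) (U Ux Uxx Ut G : R -> R -> R[i]).
Context (H : nls_path gamma U Ux Uxx Ut G) (L M : R).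
Context (g0 : 0 < gamma).
Context (lip : forall s t, 0 <= s -> 0 <= t -> nrm (fun x => G s x - G t x) <= L * `|s - t|).
Context (bG : forall t, 0 <= t -> nrm (G t) <= M).
Context (intG : (\int[mu]_(t in `]0%R, +oo[) (ip (G t) (G t))%:E < +oo)%E).

Lemma mass_rder1 t : 0 <= t -> rder (fun s => ip (U s) (U s)) t
  (- 2 * gamma * ip (U t) (U t) - 2 * ip (U t) (fun x => 'i * G t x)).
Proof.
move=> t0; have := mass_rder H (C1b_cst 1) t0.
under eq_fun do rewrite mul1C.
rewrite !mul1C; congr rder.
rewrite (_ : (fun x => 'i * (1%:C * G t x)) = (fun x => 'i * G t x)); last first.
  by apply/funext => x; rewrite rmorph1 mul1r.
rewrite (_ : ip (U t) (fun x => 'i * (0%:C * Ux t x)) = 0) ?mulr0 ?subr0//.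
rewrite -[RHS]rint0; congr rint; apply/funext => x.
by case: (U t x) (Ux t x) => [? ?] [? ?]; rewrite /cdot/=; ring.
Qed.

(** Young's inequality spends half of the damping on the forcing. *)
Lemma mass_dini t : 0 <= t -> udini (fun s => ip (U s) (U s)) t
  (- gamma * ip (U t) (U t) + gamma^-1 * ip (G t) (G t)).
Proof.
move=> t0; apply: udini_le (rder_udini (mass_rder1 t0)).
have := ip_CS (pU H t0) (CL2i (pG H t0)); rewrite nrmi ler_norml => /andP[h _].
have g1 : gamma^-1 * gamma = 1 by rewrite mulVf// gt_eqF.
have := sqr_ge0 (gamma * nrm (U t) - nrm (G t)).
move=> /(mulr_ge0 (_ : 0 <= gamma^-1)).
rewrite invr_ge0 ltW// => /(_ isT).
rewrite -!nrm_sqr in h *.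
rewrite (_ : gamma^-1 * (gamma * nrm (U t) - nrm (G t)) ^+ 2 = gamma * nrm (U t) ^+ 2 - 2 * (nrm (U t) * nrm (G t))
   + gamma^-1 * nrm (G t) ^+ 2); last by field; rewrite gt_eqF.
lra.
Qed.

Lemma cont0_mass : cont0 (fun s => ip (U s) (U s)).
Proof. by apply: cont0_ip; [exact: (pU H)|exact: (pU H)|exact: (cU H)|exact: (cU H)]. Qed.

(** Let [P] be a primitive of [|G|^2] and [t1] a time after which it grows by at most
    [gamma * e / 2]. Subtracting [(P - P t1) / gamma] from the mass cancels the forcing and leaves a
    function [W] with [W' <= - gamma * W]; the correction itself is at most [e / 2]. *)
Lemma mass_decay e : 0 < e -> exists2 T, 0 <= T & forall t, T <= t -> ip (U t) (U t) <= e.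
Proof.
move=> e0.
have ck : cont0 (fun t => ip (G t) (G t)).
  by apply: cont0_ip; [exact: (pG H)|exact: (pG H)|exact: (cG H)|exact: (cG H)].
have [P [cP dP [J bP]]] := primitive ck (fun t _ => ip_ge0 (G t)) intG.
have mP s t : 0 <= s -> s <= t -> P s <= P t.
  move=> s0 st; rewrite -lerN2.
  apply: (@dini_noninc _ (fun s => - P s) s) => //; first exact: cont0N.
  move=> r sr; have r0 := le_trans s0 sr.
  have := rder_udini (rderZ (k := -1) (dP r r0)).
  under eq_fun do rewrite mulN1r.
  by apply: udini_le; rewrite mulN1r oppr_le0 ip_ge0.
pose S := [set P t | t in [set t | 0 <= t]].
have hS : has_sup S.
  split; first by exists (P 0); exists 0 => //=.
  by exists J => _ [t t0 <-]; have /andP[] := bP t t0.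
have ge0 : 0 < gamma * (e / 2) by rewrite mulr_gt0// divr_gt0.
have [_ [t1 /= t10 <-] Pt1] := sup_adherent ge0 hS.
have tail t : t1 <= t -> P t - P t1 <= gamma * (e / 2).
  move=> tt; have : P t <= sup S.
    by apply: (sup_upper_bound hS); exists t => //=; exact: le_trans tt.
  lra.
pose W s := ip (U s) (U s) + gamma^-1 * (- P s + P t1).
have cW : cont0 W.
  apply: cont0D; first exact: cont0_mass.
  by apply: cont0Z; apply: cont0D; [exact: cont0N|exact: cont0_cst].
have gi : 0 < gamma^-1 by rewrite invr_gt0.
have e2 : 0 < e / 2 by rewrite divr_gt0.
have [T t1T HT] : exists2 T, t1 <= T & forall t, T <= t -> W t <= e / 2.
  apply: (dini_decay (k := gamma)) => // t tt; have t0 := le_trans t10 tt.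
  have d1 : rder (fun s => gamma^-1 * (- P s + P t1)) t (gamma^-1 * (-1 * ip (G t) (G t) + 0)).
    apply: rderZ; apply: rderD; last exact: rder_cst.
    by have := rderZ (k := -1) (dP t t0); under eq_fun do rewrite mulN1r.
  apply: udini_le (udiniD (mass_dini t0) (rder_udini d1)).
  have : 0 <= P t - P t1 by rewrite subr_ge0 mP.
  have -> : - gamma * W t = - gamma * ip (U t) (U t) + (P t - P t1).
    by rewrite /W; field; rewrite gt_eqF.
  lra.
exists T; first exact: le_trans t1T.
move=> t Tt; have := HT t Tt; have := tail t (le_trans t1T Tt).
rewrite /W => h1 h2.
have h3 : gamma^-1 * (P t - P t1) <= e / 2.
  by rewrite mulrC ler_pdivrMr// mulrC.
lra.
Qed.

Lemma M_ge0 : 0 <= M.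
Proof. exact: le_trans (nrm_ge0 _) (bG (lexx 0)). Qed.

Lemma L_ge0 : 0 <= L.
Proof.
have := le_trans (nrm_ge0 _) (lip ler01 (lexx 0)).
by rewrite subr0 normr1 mulr1.
Qed.

Lemma mass_bounded : exists2 n, 0 <= n & forall t, 0 <= t -> nrm (U t) <= n.
Proof.
exists (Num.max (nrm (U 0)) ((M + 0) / gamma)); first by rewrite le_max nrm_ge0.
move=> t t0; have := @mass_bound _ gamma U Ux Uxx Ut G H _ _ M 0 g0 (C1b_cst 1) _ _ t t0.
rewrite !mul1C; apply.
- by move=> s s0; rewrite mul1C; exact: bG.
- by move=> s s0; rewrite nrm_mul0.
Qed.

Lemma quartic_le (eta : R -> R) t (m : R) : 0 <= t -> CL2 (mul eta (U t)) ->
  CL2 (mul eta (V U t)) -> supU U Ux t <= m ->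
  ip (mul eta (V U t)) (mul eta (U t)) <= m * nrm (mul eta (U t)) ^+ 2.
Proof.
move=> t0 h1 h2 hm; rewrite nrm_sqr -rintZ; last exact: itg_cdot.
apply: rint_le; [exact: itg_cdot|by apply: itgZ; exact: itg_cdot|].
move=> x; have h := le_trans (supU_le H x t0) hm.
rewrite /V /cube.
have -> : cdot ((eta x)%:C * ((normc (U t x) ^+ 2)%:C * U t x)) ((eta x)%:C * U t x) =
   normc (U t x) ^+ 2 * cdot ((eta x)%:C * U t x) ((eta x)%:C * U t x).
  rewrite -cdotZl; congr cdot; ring.
by apply: ler_wpM2r => //; exact: cdot_ge0.
Qed.

(** The quartic term is at most [supU * |U|^2 <= 2 n^3 |U_x|], hence linear in the gradient norm: in
    one dimension the cubic equation is subcritical. *)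
Lemma grad_bounded : exists2 X, 0 <= X & forall t, 0 <= t -> nrm (Ux t) <= X.
Proof.
have [n n0 bU] := mass_bounded.
have q10 : 0 <= 2 * n * n ^+ 2 by rewrite mulr_ge0 ?sqr_ge0// mulr_ge0.
have [K HK] := energy_bound (nrm (Ux 0) ^+ 2) g0 L_ge0 M_ge0 n0 q10 (lexx 0) (lexx 0).
have bb : forall t, 0 <= t -> nrm (Ux t) ^+ 2 <= K.
  move=> t t0; have := HK _ _ _ _ _ (fun=> 1) (fun=> 0) H (C1b_cst 1).
  rewrite !mul1C => /(_ _ _ _ _ _ (lexx _) t t0); rewrite mul1C; apply.
  - by move=> s u s0 u0; rewrite mul1C; exact: lip.
  - by move=> s s0; rewrite mul1C; exact: bG.
  - by move=> s s0; rewrite mul1C; exact: bU.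
  - move=> s s0; rewrite !mul1C addr0.
    have hU := pU H s0; have hV := pV H s0.
    rewrite -[U s]mul1C in hU; rewrite -[V U s]mul1C in hV.
    have := quartic_le s0 hU hV (lexx _); rewrite !mul1C => h.
    apply: le_trans h _; rewrite /supU.
    have b := bU s s0; have nU := nrm_ge0 (U s); have nX := nrm_ge0 (Ux s).
    rewrite (_ : 2 * n * n ^+ 2 * nrm (Ux s) = 2 * (n * nrm (Ux s)) * n ^+ 2); last by ring.
    apply: ler_pM.
    + by rewrite mulr_ge0// mulr_ge0.
    + exact: sqr_ge0.
    + by rewrite ler_pM2l//; apply: ler_wpM2r.
    + by rewrite ler_pXn2r ?nnegrE.
  - by move=> s s0; rewrite !nrm_mul0 mulr0 addr0.
have K0 : 0 <= K by apply: le_trans (bb 0 (lexx 0)); exact: sqr_ge0.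
exists (Num.sqrt K); first exact: sqrtr_ge0.
move=> t t0; rewrite -(ger0_norm (nrm_ge0 (Ux t))) -sqrtr_sqr ler_wsqrtr//.
exact: bb.
Qed.

(* Once the mass has decayed, the cubic term is small compared with the damping and the
   time difference quotients of [U] stay bounded. *)
Lemma Ut_bounded : exists2 Y, 0 <= Y & forall t, 0 <= t -> nrm (Ut t) <= Y.
Proof.
have [X X0 bX] := grad_bounded.
(* Solves [2 * (r * (X + 1)) = gamma / 4]; [X + 1] is positive even if [X = 0]. *)
pose r := gamma / 4 / (2 * (X + 1)).
have X1 : 0 < 2 * (X + 1) by rewrite mulr_gt0// ltr_wpDl.
have r0 : 0 < r by rewrite !divr_gt0.
have [T T0 HT] := mass_decay (exprn_gt0 2 r0).
have small t : T <= t -> supU U Ux t <= gamma / 4.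
  move=> Tt; have t0 := le_trans T0 Tt.
  have nr : nrm (U t) <= r by apply: sqr_sqrt_le (ltW r0) (HT t Tt).
  rewrite /supU; apply: (@le_trans _ _ (2 * (r * (X + 1)))).
    rewrite ler_pM2l//; apply: ler_pM; rewrite ?nrm_ge0//.
    by apply: le_trans (bX t t0) _; rewrite lerDl.
  rewrite /r; rewrite (_ : 2 * _ = gamma / 4)//; field.
  by rewrite gt_eqF// ltr_wpDl.
have [C C0 HC] := cont0_bounded (cont0_nrm (pUt H) (cUt H)) T0.
have ub := Ut_bound H g0 T0 lip small.
exists (C + Num.max (nrm (Ut T)) (2 * L / gamma)).
  by rewrite addr_ge0// le_max nrm_ge0.
move=> t t0; have [Tt|tT] := leP T t.
  by apply: le_trans (ub t Tt) _; rewrite lerDr.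
have hC : nrm (Ut t) <= C by apply: HC; rewrite t0 ltW.
by apply: le_trans hC _; rewrite lerDl le_max nrm_ge0.
Qed.

(** The equation is solved for [U_xx], all of whose other terms are already bounded. *)
Lemma Uxx_bounded : exists2 Z, 0 <= Z & forall t, 0 <= t -> nrm (Uxx t) <= Z.
Proof.
have [n n0 bU] := mass_bounded; have [X X0 bX] := grad_bounded.
have [Y Y0 bY] := Ut_bounded; have M0 := M_ge0.
have nX0 : 0 <= 2 * (n * X) by rewrite !mulr_ge0.
exists (2 * (M + Y + 2 * (n * X) * n + gamma * n)).
  by rewrite mulr_ge0// !addr_ge0// ?mulr_ge0// ltW.
move=> t t0.
have hU := pU H t0; have hG := pG H t0; have hT := pUt H t0; have hV := pV H t0.
have hX := pUxx H t0.
have E : Uxx t = (fun x => 2%:C * (G t x + (- ('i * Ut t x) + (- V U t x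
    + - (gamma%:C * ('i * U t x)))))).
  apply/funext => x; rewrite (eqU H) /V.
  have h2 : (2%:C * (2^-1)%:C : R[i]) = 1 by rewrite -rmorphM/= divff.
  have -> : 2%:C * ('i * Ut t x + (2^-1)%:C * Uxx t x + cube (U t x) + 'i * (gamma%:C * U t x) +
    (- ('i * Ut t x) + (- cube (U t x) + - (gamma%:C * ('i * U t x))))) =
    2%:C * (2^-1)%:C * Uxx t x by ring.
  by rewrite h2 mul1r.
have k1 := CL2N (CL2i hT); have k2 := CL2N hV; have k3 := CL2Z gamma (CL2i hU).
have bV : nrm (V U t) <= 2 * (n * X) * nrm (U t).
  apply: nrm_le_normc => // x.
  rewrite /V /cube normcM normc_real ger0_norm ?sqr_ge0//.
  apply: ler_wpM2r; first exact: normc_ge0.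
  apply: le_trans (supU_le H x t0) _; rewrite /supU ler_pM2l//.
  by apply: ler_pM; rewrite ?nrm_ge0//; [exact: bU|exact: bX].
rewrite E nrmZ; last by do 3?apply: CL2D => //; exact: CL2N.
rewrite ger0_norm// ler_pM2l//.
have s1 := nrmD hG (CL2D k1 (CL2D k2 (CL2N k3))).
have s2 := nrmD k1 (CL2D k2 (CL2N k3)).
have s3 := nrmD k2 (CL2N k3).
have e1 := nrmN (fun x => 'i * Ut t x); have e2 := nrmi (Ut t).
have e3 := nrmN (V U t).
have e4 := nrmN (fun x => gamma%:C * ('i * U t x)); have e5 := nrmZ gamma (CL2i hU).
have e6 := nrmi (U t); rewrite (gtr0_norm g0) in e5.
have b1 := bG t0; have b2 := bU t t0; have b3 := bY t t0.
have b4 := ler_wpM2l nX0 b2; have b5 := ler_wpM2l (ltW g0) b2.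
rewrite e6 in e5; lra.
Qed.

(* [|u_x|^2 <= |u| |u_xx|] turns the bound [supU] on [|u|_oo^2] into one on its square. *)
Lemma supU_sqr_le t : 0 <= t -> supU U Ux t ^+ 2 <= 4 * nrm (U t) ^+ 3 * nrm (Uxx t).
Proof.
move=> t0.
have h := cibp (pU H t0) (pUx H t0) (pUx H t0) (pUxx H t0) (wU H t0) (wUx H t0).
have := le_trans (ler_norm _) (ip_CS (CL2N (pU H t0)) (pUxx H t0)).
rewrite nrmN ipC ipNr; [|exact: (pUxx H)|exact: (pU H)].
rewrite ipC -h -nrm_sqr => hx.
have := ler_wpM2l (mulr_ge0 (ler0n R 4) (sqr_ge0 (nrm (U t)))) hx.
rewrite /supU; lra.
Qed.

(** The slope of [eta] enters through [B] alone, because [deta] always multiplies a function already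
    bounded in the unweighted norm. The pointwise estimate is [csup_bound] for [eta * U], whose
    derivative is [deta * U + eta * U_x]. *)
Lemma weighted_bound (B Mw Lw n0 a0 : R) : 0 <= B -> 0 <= Mw -> 0 <= Lw -> 0 <= n0 ->
  exists K : R, forall eta deta : R -> R, C1b eta deta ->
    (forall x, `|deta x| <= B) ->
    (forall s t, 0 <= s -> 0 <= t ->
       nrm (fun x => (eta x)%:C * (G s x - G t x)) <= Lw * `|s - t|) ->
    (forall t, 0 <= t -> nrm (mul eta (G t)) <= Mw) ->
    nrm (mul eta (U 0)) <= n0 -> nrm (mul eta (Ux 0)) ^+ 2 <= a0 ->
    forall x t, 0 <= t -> eta x ^+ 2 * normc (U t x) ^+ 2 <= K.
Proof.
move=> B0 Mw0 Lw0 n00.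
have [n nn bU] := mass_bounded; have [X X0 bX] := grad_bounded.
have [Y Y0 bY] := Ut_bounded.
have BX0 : 0 <= B * X by exact: mulr_ge0.
pose nw := Num.max n0 ((Mw + B * X) / gamma).
have nw0 : 0 <= nw by rewrite le_max n00.
have nX0 : 0 <= 2 * (n * X) by rewrite !mulr_ge0.
(* The sup norm is under control by now, so the weighted quartic term is at most [2 n X] times the
   weighted mass and the energy bound is applied with [q1 = 0]. *)
have q00 : 0 <= 2 * (n * X) * nw ^+ 2 by rewrite mulr_ge0// sqr_ge0.
have c0 : 0 <= gamma * (B * n) + B * Y.
  by rewrite addr_ge0// ?mulr_ge0// ltW.
have [K HK] := energy_bound a0 g0 Lw0 Mw0 nw0 (lexx 0) q00 c0.
exists (2 * (nw * (B * n + Num.sqrt K))) => eta deta he bd lw bw U0 Ux0 x t t0.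
have [C [m1 m2 b1 b2]] := C1b_meas he.
have bdU v : CL2 v -> nrm (mul deta v) <= B * nrm v by move=> hv; exact: nrmM.
have bUw s : 0 <= s -> nrm (mul eta (U s)) <= nw.
  move=> s0; apply: le_trans (mass_bound H g0 he bw (c := B * X) _ s0) _.
    move=> r r0; apply: le_trans (bdU _ (pUx H r0)) _.
    by apply: ler_wpM2l => //; exact: bX.
  rewrite ge_max; apply/andP; split; last by rewrite le_max lexx orbT.
  by apply: le_trans U0 _; rewrite le_max lexx.
have [p0 p0'] := L2path_C1b he (pU H); have [p1 _] := L2path_C1b he (pV H).
have [p2 _] := L2path_C1b he (pUx H).
have bK := HK _ _ _ _ _ eta deta H he lw bw bUw _ _ Ux0 t t0.
have {bK}bK : nrm (mul eta (Ux t)) ^+ 2 <= K.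
  apply: bK.
  - move=> s s0; rewrite mul0r add0r.
    have hs : supU U Ux s <= 2 * (n * X).
      by rewrite /supU ler_pM2l//; apply: ler_pM; rewrite ?nrm_ge0//; [exact: bU|exact: bX].
    apply: le_trans (quartic_le s0 (p0 s s0) (p1 s s0) hs) _.
    apply: ler_wpM2l => //; rewrite ler_pXn2r ?nnegrE ?nrm_ge0//; exact: bUw.
  - move=> s s0; apply: lerD.
      rewrite ler_pM2l//; apply: le_trans (bdU _ (pU H s0)) _.
      by apply: ler_wpM2l => //; exact: bU.
    apply: le_trans (bdU _ (pUt H s0)) _.
    by apply: ler_wpM2l => //; exact: bY.
have cRe w : mul eta (U t) = w -> continuous (fun x => Re (w x)).
  move=> <-; have -> : (fun x => Re ((eta x)%:C * U t x)) = (fun x => eta x * Re (U t x)).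
    by apply/funext => y; case: (U t y) => [? ?] /=; ring.
  by move=> y; apply: cvgM; [exact: (C1b_cont he)|exact: (cReU H t0)].
have cIm w : mul eta (U t) = w -> continuous (fun x => Im (w x)).
  move=> <-; have -> : (fun x => Im ((eta x)%:C * U t x)) = (fun x => eta x * Im (U t x)).
    by apply/funext => y; case: (U t y) => [? ?] /=; ring.
  by move=> y; apply: cvgM; [exact: (C1b_cont he)|exact: (cImU H t0)].
have hw := weak_derivM he (pU H t0) (pUx H t0) (wU H t0).
have hsum := CL2D (p0' t t0) (p2 t t0).
have := csup_bound x (cRe _ erefl) (cIm _ erefl) (p0 t t0) hsum hw.
rewrite -normc_sqr normcM normc_real exprMn real_normK ?num_real//.
move=> h; apply: le_trans h _; rewrite ler_pM2l//.
apply: ler_pM; rewrite ?nrm_ge0//; first exact: bUw.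
apply: le_trans (nrmD (p0' t t0) (p2 t t0)) _; apply: lerD.
  apply: le_trans (bdU _ (pU H t0)) _.
  by apply: ler_wpM2l => //; exact: bU.
rewrite -(ger0_norm (nrm_ge0 (mul eta (Ux t)))) -sqrtr_sqr ler_wsqrtr//.
Qed.

End UniformBounds.

(** * The spatial weight *)

Section SpaceWeight.
Context {R : realType}.
Local Notation mu := (@lebesgue_measure R).
Implicit Types (rho : R -> R) (x y s t a b e L h : R).

Definition loc_lipschitz rho :=
  forall x : R, exists2 A : set R, nbhs x A & [lipschitz rho y | y in A].

(** Compactness of [[a, b]] yields one constant for the slopes seen from each point within its own
    neighborhood, which is the form a Dini argument uses. *)
Lemma slope_bound rho a b : loc_lipschitz rho -> exists2 L : R, 0 <= L &
  forall x, a <= x <= b -> \forall s \near x, `|rho s - rho x| <= L * `|s - x|.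
Proof.
move=> lrho.
have cK : compact (`[a, b] : set R) by exact: segment_compact.
have nc := (compact_near_coveringP _).1 cK R +oo
  (fun L x => \forall s \near x, `|rho s - rho x| <= L * `|s - x|) _.
have : \forall L \near +oo, `[a, b] `<=` (fun x => \forall s \near x, `|rho s - rho x| <= L * `|s - x|).
  apply: nc => x _; have [A nA lA] := lrho x.
  have [k kA] := @filter_ex _ _ (@proper_pinfty_nbhs R) _ lA.
  exists (interior A, [set L : R | k <= L]).
    split => /=; first exact: nbhs_interior.
    by apply: nbhs_pinfty_ge; exact: num_real.
  move=> [y L] /= [iAy kL].
  have nAy : nbhs y A by [].
  apply: filterS nAy => s As; have Ay : A y by exact: nbhs_singleton.
  have /= := kA (s, y) (conj As Ay); rewrite /self_sub/= => h.
  by apply: le_trans h _; apply: ler_wpM2r.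
move=> nL.
have [L [LK L0]] := @filter_ex _ _ (@proper_pinfty_nbhs R) _
  (filterI nL (nbhs_pinfty_ge (num_real (0 : R)))).
by exists L => // x xab; apply: LK; rewrite /= in_itv.
Qed.

Lemma loc_lipschitz_continuous rho : loc_lipschitz rho -> continuous rho.
Proof.
move=> lrho x; have [L L0 /(_ x)] := @slope_bound rho x x lrho.
rewrite lexx => /(_ isT) HL; apply/cvgrPdist_lt => /= e e0.
have L1 : 0 < L + 1 by rewrite ltr_wpDl.
have : \forall s \near x, `|x - s| < e / (L + 1).
  by apply: (@cvgr_dist_lt _ _ _ (nbhs x) _ id x); [exact: cvg_id|exact: divr_gt0].
apply: filterS2 HL => s h1 h2; rewrite distrC; apply: le_lt_trans h1 _.
rewrite distrC; rewrite ltr_pdivlMr// in h2; apply: le_lt_trans h2.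
by rewrite mulrDr mulr1 mulrC lerDl.
Qed.

(* The null set where the slope is not controlled is covered by an open set [W] of small
   measure; subtracting [L] times the measure of [W] to the left of a point makes the Dini
   derivative nonpositive there as well. *)
Lemma loc_lipschitz_increase rho (beta : R) a b : a < b -> 0 <= beta ->
  loc_lipschitz rho ->
  {ae mu, forall x, derivable rho x 1 /\ derive1 rho x < beta} ->
  rho b - rho a <= beta * (b - a).
Proof.
move=> ab beta0 lrho [N [mN N0 HN]].
have [L L0 HL] := slope_bound a b lrho.
have crho := loc_lipschitz_continuous lrho.
apply/ler_addgt0Pr => /= e e0.
(* Makes [L] times the measure of [W] at most [e], also when [L = 0]. *)
have e' : 0 < e / (L + 1) by rewrite divr_gt0// ltr_wpDl.
have Nfin : (mu N < +oo)%E by rewrite N0 ltry.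
have [W [oO NO mO]] := lebesgue_regularity_outer mN Nfin e'.
have mmO : measurable W by exact: open_measurable.
pose m s := fine (mu (W `&` `]a, a + s])).
have fin s t : mu (W `&` `]s, t]) \is a fin_num.
  rewrite ge0_fin_numE//; apply: (@le_lt_trans _ _ (mu `]s, t])).
    apply: le_measure; rewrite ?inE; [exact: measurableI|exact: measurable_itv|exact: subIsetr].
  by rewrite lebesgue_measure_itv/=; case: ifP => _; rewrite -?EFinB ltry.
have mle s t : s <= t -> fine (mu (W `&` `]s, t])) <= t - s.
  move=> st; rewrite -lee_fin fineK//; apply: (@le_trans _ _ (mu `]s, t])).
    apply: le_measure; rewrite ?inE; [exact: measurableI|exact: measurable_itv|exact: subIsetr].
  by rewrite lebesgue_measure_itv/= lte_fin; case: ifP => _; rewrite -?EFinB lee_fin ?subr_ge0.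
have add s t : 0 <= s -> s <= t -> m t = m s + fine (mu (W `&` `]a + s, a + t])).
  move=> s0 st; rewrite /m -fineD//; congr fine; rewrite -measureU//.
  - congr (mu _); apply/seteqP; split=> x /=; rewrite !in_itv/=.
      move=> [Ox /andP[h1 h2]]; have [xs|sx] := leP x (a + s); [left|right];
      by rewrite ?h1 ?h2 ?xs ?sx.
    move=> [[Ox /andP[h1 h2]]|[Ox /andP[h1 h2]]]; split => //.
      by rewrite h1 (le_trans h2)// lerD2l.
    by rewrite h2 andbT (le_lt_trans _ h1)// lerDl.
  - by apply: measurableI => //; exact: measurable_itv.
  - by apply: measurableI => //; exact: measurable_itv.
  - apply/seteqP; split => // x /= []; rewrite !in_itv/= => -[_ /andP[_ h1]] [_ /andP[h2 _]].
    by move: (le_lt_trans h1 h2); rewrite ltxx.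
pose F s := rho (a + s) - rho a - beta * s - L * m s.
have cm : cont0 m.
  move=> t t0; apply/cvgrPdist_lt => d d0; rewrite near_withinE; exists d => //= s sd.
  rewrite /= in_itv/= andbT => s0; apply: le_lt_trans sd.
  have [st|ts] := leP s t.
    have := add s t s0 st; have := mle (a + s) (a + t); rewrite lerD2l => /(_ st) h1 h2.
    have := fine_ge0 (measure_ge0 mu (W `&` `]a + s, a + t])) => h3.
    rewrite (_ : `|m t - m s| = m t - m s); last by rewrite ger0_norm//; lra.
    rewrite ger0_norm ?subr_ge0//; lra.
  have := add t s t0 (ltW ts); have := mle (a + t) (a + s); rewrite lerD2l => /(_ (ltW ts)) h1 h2.
  have := fine_ge0 (measure_ge0 mu (W `&` `]a + t, a + s])) => h3.
  rewrite distrC (_ : `|m s - m t| = m s - m t); last by rewrite ger0_norm//; lra.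
  rewrite distrC ger0_norm ?subr_ge0; [lra|exact: ltW].
have cF : cont0 F.
  apply: cont0D; last by apply: cont0N; exact: cont0Z.
  apply: cont0D; last by apply: cont0N; apply: cont0Z; exact: cont0_id.
  apply: cont0D; last exact: cont0_cst.
  move=> t t0; apply: cvg_within_filter.
  apply: (@cvg_comp _ _ _ (fun s => a + s) rho); last exact: crho.
  by apply: cvgD; [exact: cvg_cst|exact: cvg_id].
have ba0 : 0 <= b - a by rewrite subr_ge0 ltW.
have F0 : F 0 <= 0.
  rewrite /F addr0 subrr mulr0 subr0 sub0r oppr_le0 mulr_ge0// fine_ge0//.
have Fb : F (b - a) <= 0.
  apply: (@dini_le0 _ F 0) => // t /andP[t0 tb] _ d d0.
  have xab : a <= a + t <= b by rewrite lerDl t0/= -lerBrDl ltW.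
  have sx (P : R -> Prop) : (\forall s \near a + t, P s) -> \forall s \near t^'+, P (a + s).
    move=> [c /= c0 Hc]; rewrite /at_right near_withinE; exists c => //= s sc _; apply: Hc.
    by rewrite /ball_/= opprD addrACA subrr add0r.
  suff : \forall s \near t^'+, F s <= F t.
    apply: filterS2 (near_right_gt t) => s ts h; apply: le_trans h _.
    by rewrite lerDl mulr_ge0// ?add0r ?subr_ge0 ltW.
  have [Nx|nNx] := pselect (N (a + t)).
    have On : nbhs (a + t) W by apply: open_nbhs_nbhs; split => //; exact: NO.
    have [c /= c0 Oc] := On.
    have near_c : \forall s \near t^'+, s < t + c.
      by apply: nbhs_right_lt; rewrite ltrDl.
    apply: filterS3 (near_right_gt t) near_c (sx _ (HL _ xab)) => s ts sc hs.
    have Om : fine (mu (W `&` `]a + t, a + s])) = s - t.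
      rewrite setIidr; last first.
        move=> y /=; rewrite in_itv/= => /andP[y1 y2]; apply: Oc => /=.
        by rewrite ltr_norml; apply/andP; split; lra.
      rewrite lebesgue_measure_itv/= lte_fin ltrD2l ts -EFinB/=; ring.
    rewrite /F (add t s t0 (ltW ts)) Om.
    rewrite opprD addrACA subrr add0r (gtr0_norm (_ : 0 < s - t)) ?subr_gt0// in hs.
    have := le_trans (ler_norm _) hs; rewrite mulrDr.
    have : 0 <= beta * (s - t) by rewrite mulr_ge0// subr_ge0 ltW.
    lra.
  have [dx dlt] : derivable rho (a + t) 1 /\ derive1 rho (a + t) < beta.
    by apply: contrapT => h; apply: nNx; exact: HN.
  have lim : (fun h => h^-1 *: ((rho \o shift (a + t)) (h *: (1 : R)) - rho (a + t)))
      @ 0^' --> derive1 rho (a + t) by rewrite derive1E; exact: dx.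
  move/cvgrPdist_lt : lim => /(_ (beta - derive1 rho (a + t))).
  rewrite subr_gt0 => /(_ dlt); rewrite /dnbhs near_withinE => -[c /= c0 Hc].
  have near_c : \forall s \near t^'+, s < t + c.
    by apply: nbhs_right_lt; rewrite ltrDl.
  apply: filterS2 (near_right_gt t) near_c => s ts sc.
  have st0 : 0 < s - t by rewrite subr_gt0.
  have b1 : `|0 - (s - t)| < c by rewrite sub0r normrN gtr0_norm//; lra.
  have := Hc (s - t) b1; rewrite (gt_eqF st0) => /(_ isT).
  rewrite /GRing.scale/= mulr1 (_ : s - t + (a + t) = a + s); last by ring.
  rewrite ltr_norml => /andP[h _].
  have : (s - t)^-1 * (rho (a + s) - rho (a + t)) <= beta by lra.
  rewrite mulrC ler_pdivrMr// => h2.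
  rewrite /F (add t s t0 (ltW ts)).
  have : 0 <= L * fine (mu (W `&` `]a + t, a + s])) by rewrite mulr_ge0// fine_ge0.
  rewrite mulrDr; lra.
have mO' : fine (mu (W `&` `]a, a + (b - a)])) <= e / (L + 1).
  rewrite -lee_fin fineK//; apply: le_trans (ltW mO).
  apply: (@le_trans _ _ (mu W)).
    by apply: le_measure; rewrite ?inE//; apply: measurableI => //; exact: measurable_itv.
  have WE : W = N `|` (W `\` N) by rewrite setDUK.
  rewrite [leLHS](_ : _ = mu (N `|` (W `\` N))); last by rewrite -WE.
  have mD : measurable (W `\` N) by exact: measurableD.
  have N1 : (mu N <= 0)%E by rewrite le_eqVlt; apply/orP; left; apply/eqP; exact: N0.
  have h := leeD N1 (lexx (mu (W `\` N))); rewrite add0e in h.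
  exact: le_trans (measureU2 mu mN mD) h.
have : L * m (b - a) <= e.
  apply: (@le_trans _ _ (L * (e / (L + 1)))); first exact: ler_wpM2l.
  rewrite mulrA ler_pdivrMr ?ltr_wpDl// mulrDr mulr1 mulrC; lra.
by move: Fb; rewrite /F (_ : a + (b - a) = b); [lra|ring].
Qed.

(** [loc_lipschitz_increase], applied to [rho] on one side of [x] and to [- rho] on the other, turns
    the almost everywhere slope bound into a global one. *)
Lemma weight_lower_bound rho : admissible_space_weight rho ->
  exists2 beta : R, 0 < beta & forall x y, rho x - beta * `|y - x| <= rho y.
Proof.
move=> [_ lrho _ [b1 [b2 [b10 hae]]]].
have b20 : 0 < b2.
  have [|x _ [_ /andP[h1 h2]]] := ae_ex (measurable_itv `]0, 1[%R) _ hae.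
    by rewrite /= lebesgue_measure_itv/= lte_fin ltr01 -EFinB subr0 lte_fin.
  by apply: lt_trans h2; exact: lt_trans h1.
have h1 : {ae mu, forall x, derivable rho x 1 /\ derive1 rho x < b2}.
  apply: aeS hae => x [dx /andP[_ h]]; split => //.
  by apply: le_lt_trans h; exact: ler_norm.
have h2 : {ae mu, forall x, derivable (fun x => - rho x) x 1 /\ derive1 (fun x => - rho x) x < b2}.
  apply: aeS hae => x [dx /andP[_ h]]; split; first exact: derivableN.
  rewrite derive1E deriveN//; apply: le_lt_trans h.
  by rewrite -normrN -derive1E; exact: ler_norm.
have lN : loc_lipschitz (fun x => - rho x).
  move=> x; have [A nA lA] := lrho x; exists A => //.
  case: lA => k [kr Hk]; exists k; split => // k' /Hk {}Hk p /Hk.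
  by rewrite /self_sub/= -opprD normrN.
exists b2 => // x y; have [xy|yx|->] := ltgtP x y; last by rewrite subrr normr0 mulr0 subr0.
  rewrite gtr0_norm ?subr_gt0//.
  have := loc_lipschitz_increase xy (ltW b20) lN h2; lra.
rewrite ltr0_norm ?subr_lt0// opprB.
have := loc_lipschitz_increase yx (ltW b20) lrho h1; lra.
Qed.

(** Growth at both ends reduces the minimum to a compact interval. It is through this [c] that
    weighted bounds on the forcing imply unweighted ones. *)
Lemma weight_min rho : admissible_space_weight rho ->
  exists2 c : R, 0 < c & forall x, c <= rho x.
Proof.
move=> [rho0 lrho [rp rm] _].
have crho := loc_lipschitz_continuous lrho.
have [M1 [_ H1]] : \forall x \near +oo, 1 <= rho x.
  by move/cvgryPge : rp; exact.
have [M2 [_ H2]] : \forall x \near -oo, 1 <= rho x.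
  by move/cvgryPge : rm; exact.
pose A := `|M1| + `|M2| + 1.
have A0 : - A <= A by have := normr_ge0 M1; have := normr_ge0 M2; rewrite /A; lra.
have [x0 _ Hx0] := EVT_min A0 (continuous_subspaceT crho).
exists (Num.min 1 (rho x0)); first by rewrite lt_min ltr01 rho0.
move=> x; rewrite ge_min.
have [xA|Ax] := ltP A x.
  rewrite H1//; apply: le_lt_trans xA; rewrite /A.
  by have := ler_norm M1; have := normr_ge0 M2; lra.
have [xA|xA] := ltP x (- A).
  rewrite H2//; apply: lt_le_trans xA _; rewrite /A.
  by have := ler_norm (- M2); rewrite normrN; have := normr_ge0 M1; lra.
by rewrite Hx0 ?orbT// in_itv/= xA.
Qed.

(** The bump lives within [2 / k = rho x0 / (2 * beta)] of [x0], where [rho] is still at least the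
    height [rho x0 / 2]; the slope, height times [k], is [2 * beta] whatever [x0] is. *)
Lemma weight_bump rho (beta : R) x0 : (forall x, 0 < rho x) -> 0 < beta ->
  (forall x y, rho x - beta * `|y - x| <= rho y) ->
  exists eta deta : R -> R, [/\ C1b eta deta, forall x, `|deta x| <= 2 * beta,
    forall x, `|eta x| <= rho x & eta x0 = rho x0 / 2].
Proof.
move=> rho0 beta0 lrho.
have r0 := rho0 x0.
pose k : R := 4 * beta / rho x0.
have k0 : 0 < k by rewrite divr_gt0// mulr_gt0.
have hb := C1bM (C1b_cst (rho x0 / 2)) (box_C1b k0 (lexx x0)).
exists (fun x => rho x0 / 2 * box x0 x0 k x), (fun x => 0 * box x0 x0 k x + rho x0 / 2 * dbox x0 x0 k x).
split => //.
- move=> x; rewrite mul0r add0r normrM (gtr0_norm (_ : 0 < rho x0 / 2)) ?divr_gt0//.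
  have r2 : 0 <= rho x0 / 2 by rewrite divr_ge0// ltW.
  apply: le_trans (ler_wpM2l r2 (dbox_le x0 x0 x (ltW k0))) _.
  by rewrite (_ : rho x0 / 2 * k = 2 * beta)// /k; field; rewrite gt_eqF.
- move=> x; have b0 := box_ge0 x k0 (lexx x0); have b1 := box_le1 x0 x0 k x.
  rewrite ger0_norm; last by rewrite mulr_ge0// divr_ge0// ltW.
  have [near|far] := ltP `|x - x0| (2 / k).
    apply: (@le_trans _ _ (rho x0 / 2)).
      by rewrite ler_piMr// divr_ge0// ltW.
    apply: le_trans (lrho x0 x); rewrite lerBrDl.
    have : beta * `|x - x0| <= beta * (2 / k) by rewrite ler_pM2l// ltW.
    rewrite (_ : beta * (2 / k) = rho x0 / 2); last first.
      by rewrite /k; field; rewrite !gt_eqF.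
    lra.
  rewrite box0 ?mulr0//; first exact: ltW.
  move: far; have [xx|xx] := leP 0 (x - x0).
    by rewrite ger0_norm// => far; right; lra.
  by rewrite ltr0_norm// => far; left; lra.
- by rewrite box1 ?lexx// mulr1.
Qed.

End SpaceWeight.

(** * The forcing *)

Section TimeSections.
Context {R : realType}.
Local Notation mu := (@lebesgue_measure R).
Implicit Types (F : R -> R -> R) (c m th A : R -> R) (x s t k B C N : R).

(** A finite integral would make the integrals of both the positive and the negative part finite.
    Thanks to this default, scalars can be moved through the sections in Fubini's theorem even where
    these fail to be integrable. *)
Lemma rint_nitg (f : R -> R) : measurable_fun setT f -> ~ itg f -> rint f = 0.
Proof.
move=> mf nf; apply: contrapT => r0; apply: nf.
have mf' : measurable_fun setT (EFin \o f) by exact/measurable_EFinP.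
have : (\int[mu]_x (f x)%:E)%E \is a fin_num.
  by move: r0; rewrite /rint /Rintegral; case: (X in fine X).
rewrite integralE fin_numB => /andP[h1 h2].
apply/integrableP; split => //.
rewrite (_ : (fun x => `|(EFin \o f) x|)%E =
  (fun x => (EFin \o f)^\+ x + (EFin \o f)^\- x)%E); last first.
  by rewrite -fune_abse.
rewrite ge0_integralD//; last 2 first.
- exact: measurable_funepos.
- exact: measurable_funeneg.
by rewrite lte_add_pinfty// -ge0_fin_numE//; apply: integral_ge0.
Qed.

Lemma rintZ_meas k (f : R -> R) : measurable_fun setT f ->
  rint (fun x => k * f x) = k * rint f.
Proof.
move=> mf; have [hf|nf] := pselect (itg f); first exact: rintZ.
have [->|k0] := eqVneq k 0.
  by under eq_fun do rewrite mul0r; rewrite mul0r rint0.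
rewrite (rint_nitg mf nf) mulr0; apply: rint_nitg.
  exact: measurable_funM.
move=> /(itgZ k^-1) h; apply: nf; congr itg: h; apply/funext => x.
by rewrite mulKf.
Qed.

(** A bound on almost every time section gives integrability on the product only over a bounded time
    interval, hence the truncation. Time comes first, as the outer variable. *)
Definition cut N F t x : R := if 0 < t < N then F x t else 0.

Definition tmeas F :=
  measurable_fun ([set: R] `*` `]0, +oo[ : set (R * R)) (fun p : R * R => F p.1 p.2).

Definition sections_bounded c B F := {ae mu, forall t, 0 < t ->
  itg (fun x => c x * F x t) /\ rint (fun x => `|c x * F x t|) <= B}.

Definition time_wd F Ft := forall th, C1c `]0, +oo[ th -> {ae mu, forall x,
  \int[mu]_(t in `]0, +oo[) (derive1 th t * F x t) =
  - \int[mu]_(t in `]0, +oo[) (th t * Ft x t)}.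

Lemma measurable_time_restrict (I : interval R) F : (forall t, t \in I -> 0 < t) -> tmeas F ->
  measurable_fun setT ((fun p : R * R => F p.2 p.1) \_ ([set` I] `*` setT)).
Proof.
move=> I0 mF; have mD : measurable ([set` I] `*` setT : set (R * R)).
  by apply: measurableX => //; exact: measurable_itv.
apply/measurable_restrict => //; rewrite setTI.
apply: (@measurable_comp _ _ _ _ _ _ ([set: R] `*` `]0, +oo[ : set (R * R))
  (fun p : R * R => F p.1 p.2) ([set` I] `*` setT) (fun p : R * R => (p.2, p.1))) => //.
- by apply: measurableX => //; exact: measurable_itv.
- by move=> _ [[t x] /= [tI _] <-] /=; split => //; rewrite in_itv/= I0.
- by apply: measurable_funS (@measurable_swap _ _ _ _).
Qed.

Lemma measurable_cut N F : tmeas F ->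
  measurable_fun setT (fun p : R * R => cut N F p.1 p.2).
Proof.
have I0 t : t \in `]0, N[%R -> 0 < t by rewrite in_itv/= => /andP[].
move=> /(measurable_time_restrict I0); congr measurable_fun.
by apply/funext => -[t x]; rewrite /cut /patch in_setX in_setT andbT mem_setE in_itv.
Qed.

Lemma cut_itg N F c B : 0 <= B -> measurable_fun setT c -> tmeas F ->
  sections_bounded c B F ->
  ((mu \x mu)%E).-integrable setT
    (EFin \o (fun p : R * R => c p.2 * cut N F p.1 p.2)).
Proof.
move=> B0 mc mF hF; have mcut := measurable_cut N mF.
have mK : measurable_fun setT (fun p : R * R => c p.2 * cut N F p.1 p.2).
  by apply: measurable_funM => //; apply: measurableT_comp => //; exact: measurable_snd.
apply/integrable12ltyP; first exact/measurable_EFinP.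
have mK' : measurable_fun setT (fun p : R * R => `|(c p.2 * cut N F p.1 p.2)%:E|)%E.
  by apply: measurableT_comp => //; exact/measurable_EFinP.
pose g t := B * \1_(`]0, N[) t.
have mg : measurable_fun setT g.
  by apply: measurable_funM => //; apply: measurable_indic; exact: measurable_itv.
apply: (@le_lt_trans _ _ (\int[mu]_t (g t)%:E)%E).
  apply: ae_ge0_le_integral => //.
  - by move=> t _; apply: integral_ge0.
  - exact: (@measurable_fun_fubini_tonelli_F _ _ _ _ _ mu _ mK').
  - by move=> t _; rewrite lee_fin mulr_ge0// indicE ler0n.
  - exact/measurable_EFinP.
  apply: aeS hF => t ht _; rewrite /g indicE mem_setE in_itv/=.
  have [tN|tN] := boolP (0 < t < N); last first.
    rewrite mulr0; under eq_integral do rewrite /cut/= (negbTE tN) mulr0 normr0.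
    by rewrite integral0.
  rewrite mulr1.
  have t0 : 0 < t by case/andP: tN.
  have [i1 i2] := ht t0.
  under eq_integral do rewrite /cut/= tN.
  by rewrite -EFin_rint ?lee_fin//; exact: itg_norm.
rewrite (_ : (fun t => (g t)%:E) = (fun t => B%:E * (\1_(`]0, N[) t)%:E)%E)//.
rewrite ge0_integralZl//; last by apply/measurable_EFinP; apply: measurable_indic; exact: measurable_itv.
rewrite integral_indic//.
rewrite setIT; apply: lte_mul_pinfty => //.
have : (mu `]0%R, N[ < +oo)%E; last by [].
by rewrite lebesgue_measure_itv/=; case: ifP => _; rewrite -?EFinB ltry.
Qed.

Lemma cut_fubini N F c B m C : 0 <= B -> measurable_fun setT c -> tmeas F ->
  sections_bounded c B F ->
  measurable_fun setT m -> (forall t, `|m t| <= C) ->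
  rint (fun t => m t * rint (fun x => c x * cut N F t x)) =
  rint (fun x => c x * rint (fun t => m t * cut N F t x)) /\
  measurable_fun setT (fun x => c x * rint (fun t => m t * cut N F t x)).
Proof.
move=> B0 mc mF hF mm mC; have iK := cut_itg N B0 mc mF hF.
have mcut := measurable_cut N mF.
have iK' : ((mu \x mu)%E).-integrable setT
    (EFin \o (fun p : R * R => m p.1 * (c p.2 * cut N F p.1 p.2))).
  have h : ((mu \x mu)%E).-integrable setT
    (fun p => (C%:E * ((c p.2 * cut N F p.1 p.2)%R)%:E)%E).
    exact: (integrableZl measurableT C iK).
  apply: (le_integrable measurableT _ _ h).
    apply/measurable_EFinP; apply: measurable_funM.
      by apply: measurableT_comp => //; exact: measurable_fst.
    by apply: measurable_funM => //; apply: measurableT_comp => //; exact: measurable_snd.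
  move=> p _ /=; rewrite lee_fin normrM [leRHS]normrM; apply: ler_wpM2r => //.
  by apply: le_trans (mC _) _; exact: ler_norm.
have m1 t : measurable_fun setT (fun x => c x * cut N F t x).
  by apply: measurable_funM => //; exact: (measurableT_comp mcut (pair1_measurable t)).
have m2 x : measurable_fun setT (fun t => m t * cut N F t x).
  by apply: measurable_funM => //; exact: (measurableT_comp mcut (pair2_measurable x)).
have E1 : (fun t => m t * rint (fun x => c x * cut N F t x)) =
    (fun t => rint (fun x => m t * (c x * cut N F t x))).
  by apply/funext => t; rewrite rintZ_meas.
have E2 : (fun x => c x * rint (fun t => m t * cut N F t x)) =
    (fun x => rint (fun t => m t * (c x * cut N F t x))).
  by apply/funext => x; rewrite -rintZ_meas//; congr rint; apply/funext => t; ring.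
rewrite E1 E2; split; first exact: (rint_fubini iK').
have mF' : measurable_fun setT (fun x => \int[mu]_t (m t * (c x * cut N F t x))%:E)%E.
  exact: (measurable_fubini_G iK').
exact: measurableT_comp.
Qed.

(** The weak time derivative is an identity for almost every [x], with a null set that may depend on
    [th]. Multiplied by [c] and integrated in [x], it becomes by Fubini a weak derivative in time of
    the scalar pairing with [c]. *)
Lemma cut_parts N F Ft c B : 0 <= B -> measurable_fun setT c -> tmeas F -> tmeas Ft ->
  sections_bounded c B F ->
  sections_bounded c B Ft ->
  time_wd F Ft ->
  forall th, C1c `]0, N[ th ->
    rint (fun t => derive1 th t * rint (fun x => c x * cut N F t x)) =
    - rint (fun t => th t * rint (fun x => c x * cut N Ft t x)).
Proof.
move=> B0 mc mF mFt hF hFt wF th cth; have [C C0 [b1 b2 _ _]] := C1c_bound cth.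
have m1 := continuous_measurableT (C1c_cont cth).
have m2 : measurable_fun setT (derive1 th).
  by apply: continuous_measurableT; have [] := cth.
have [-> M1] := cut_fubini N B0 mc mF hF m2 b2.
have [-> M2] := cut_fubini N B0 mc mFt hFt m1 b1.
have cth' : C1c `]0, +oo[ th.
  have [d1 d2 [K [K1 K2 K3]]] := cth; split => //; exists K; split => // t /K2.
  by rewrite /= !in_itv/= => /andP[->].
have E (g : R -> R) H x : (forall t, ~ (`]0, N[ : set R) t -> g t = 0) ->
    rint (fun t => g t * cut N H t x) = \int[mu]_(t in `]0, +oo[) (g t * H x t).
  move=> g0; rewrite Rintegral_mkcond; congr rint; apply/funext => t.
  rewrite /cut /patch mem_setE in_itv/= andbT; case: ifPn => tN.
    by have /andP[-> _] := tN.
  by rewrite g0; [rewrite !mul0r; case: ifP|rewrite /= in_itv/=; exact/negP].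
rewrite -mulN1r -rintZ_meas//; apply: ae_eq_rint => //.
  exact: measurable_funM.
apply: aeS (wF th cth') => x h.
rewrite !E; first by rewrite h mulrN mulN1r.
- by move=> t /(C1c_out cth)[].
- by move=> t /(C1c_out cth)[].
Qed.

(** The pairing with [c] has a weak time derivative bounded by [B]. As [A] is its continuous
    representative, every positive time is a Lebesgue point and the fundamental theorem applies
    between any two of them. *)
Lemma cut_lip F Ft c B A : 0 <= B -> measurable_fun setT c -> tmeas F -> tmeas Ft ->
  sections_bounded c B F ->
  sections_bounded c B Ft ->
  time_wd F Ft ->
  cont0 A -> {ae mu, forall t, 0 < t -> A t = rint (fun x => c x * F x t)} ->
  forall s t, 0 < s -> s < t -> `|A t - A s| <= B * (t - s).
Proof.
move=> B0 mc mF mFt hF hFt wF cA eA s t s0 st.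
(* This [N] leaves a margin [s / 2] on both sides of [[s, t]] inside []0, N[]. *)
pose N := t + s; pose a (r : R) := A `|r|; pose a' r := rint (fun x => c x * cut N Ft r x).
have ca : continuous a by exact: cont0_abs.
have ma := continuous_measurableT ca.
have la : locint a.
  split => // k; apply: continuous_compact_integrable; first exact: segment_compact.
  exact: continuous_subspaceT.
have ia' : itg a' := itg_fubini (cut_itg N B0 mc mFt hFt).
have la' : locint a'.
  by split; [exact: itg_meas ia'|move=> k; apply: integrableS ia'].
have lp r : lebesgue_pt a r.
  apply: (@continuous_lebesgue_pt _ _ _ setT) => //; last exact: ca.
  by split => //; exact: openT.
have t0 := lt_trans s0 st.
have := @wd_FTC _ `]0, N[ a a' s t (s / 2) _ st _ la la' (lp s) (lp t) _.
rewrite divr_gt0// => /(_ isT) h.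
have {h} : a t - a s = \int[mu]_(x in `[s, t]) a' x.
  apply: h.
    by move=> r; rewrite /= !in_itv/= /N => /andP[h1 h2]; apply/andP; split; lra.
  move=> th cth; rewrite -(cut_parts B0 mc mF mFt hF hFt wF cth).
  have dm : measurable_fun setT (derive1 th).
    by apply: continuous_measurableT; have [] := cth.
  apply: ae_eq_rint.
  - exact: measurable_funM.
  - apply: measurable_funM => //.
    exact: itg_meas (itg_fubini (cut_itg N B0 mc mF hF)).
  apply: aeS eA => r er; have [rN|rN] := boolP (0 < r < N); last first.
    have [_ ->] : th r = 0 /\ derive1 th r = 0 by apply: (C1c_out cth); rewrite /= in_itv/=; exact/negP.
    by rewrite !mul0r.
  have r0 : 0 < r by case/andP: rN.
  rewrite /a (gtr0_norm r0) (er r0); congr (_ * _).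
  by congr rint; apply/funext => x; rewrite /cut rN.
rewrite /a (gtr0_norm s0) (gtr0_norm t0) => ->.
apply: (@le_trans _ _ (\int[mu]_(x in `[s, t]) `|a' x|)).
  by apply: le_normr_Rintegral => //; apply: integrableS ia'.
have ia2 : mu.-integrable `[s, t] (EFin \o (fun x => `|a' x|)).
  exact: integrableS (itg_norm ia').
rewrite -lee_fin /Rintegral fineK; last exact: integrable_fin_num ia2.
apply: (@le_trans _ _ (\int[mu]_(x in `[s, t]) (cst B%:E) x)%E); last first.
  rewrite integral_cst//= lebesgue_measure_itv/= lte_fin st -EFinB -EFinM lee_fin//.
apply: ae_ge0_le_integral => //.
- apply/measurable_EFinP; apply: measurable_funS (itg_meas (itg_norm ia')) => //.
apply: aeS hFt => r hr; rewrite /= in_itv/= => /andP[sr rt].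
have r0 := lt_le_trans s0 sr; have [i1 i2] := hr r0.
rewrite lee_fin; apply: le_trans i2.
rewrite /a' (_ : (fun x => c x * cut N Ft r x) = (fun x => c x * Ft x r)); last first.
  apply/funext => x; rewrite /cut r0 /N (_ : r < t + s)//.
  by apply: le_lt_trans rt _; rewrite ltrDl.
exact: rint_norm.
Qed.

End TimeSections.

(** * Weighted bounds on the forcing path *)

Section WeightedData.
Context {R : realType}.
Local Notation mu := (@lebesgue_measure R).
Local Notation Re := complex.Re.
Local Notation Im := complex.Im.
Implicit Types (rho eta : R -> R) (v w : R -> R[i]) (x s t k M : R).
Notation mul m v := (fun x => (m x)%:C * v x).

Lemma itg_le_fin (f : R -> R) M : measurable_fun setT f -> (forall x, 0 <= f x) ->
  (\int[mu]_x (f x)%:E <= M%:E)%E -> itg f /\ rint f <= M.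
Proof.
move=> mf f0 fM; have itf : itg f.
  apply/integrableP; split; first exact/measurable_EFinP.
  under eq_integral do rewrite /= ger0_norm//.
  by apply: le_lt_trans fM _; exact: ltry.
by split => //; rewrite -lee_fin EFin_rint.
Qed.

Lemma ip_ae v v' w : CL2 v -> CL2 v' -> CL2 w -> {ae mu, forall x, v x = v' x} ->
  ip v w = ip v' w.
Proof.
move=> hv hv' hw vv; apply: ae_eq_rint.
- exact: itg_meas (itg_cdot hv hw).
- exact: itg_meas (itg_cdot hv' hw).
by apply: aeS vv => x ->.
Qed.

Lemma nrm_ae v w : CL2 v -> CL2 w -> {ae mu, forall x, v x = w x} -> nrm v = nrm w.
Proof.
move=> hv hw vw; rewrite /nrm (ip_ae hv hw hv vw) ipC (ip_ae hv hw hw vw)//.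
Qed.

(** Domination by [k * rho * |v|]. The factor [k] is 1 for the bumps, and the inverse of a lower
    bound of [rho] for [eta = 1]. *)
Lemma weighted_CL2 rho eta v k (m : R) : 0 <= m -> 0 <= k ->
  measurable_fun setT rho -> measurable_fun setT eta -> cmeasurable v ->
  (forall x, `|eta x| <= k * rho x) -> (sqnormL2w rho v <= (m ^+ 2)%:E)%E ->
  CL2 (mul eta v) /\ nrm (mul eta v) <= k * m.
Proof.
move=> m0 k0 mr me [m1 m2] er h.
have mc : measurable_fun setT (fun x => rho x ^+ 2 * normc (v x) ^+ 2).
  apply: measurable_funM; first exact: measurable_funX.
  rewrite (_ : (fun x => _) = (fun x => Re (v x) * Re (v x) + Im (v x) * Im (v x))).
    by apply: measurable_funD; exact: measurable_funM.
  by apply/funext => x; rewrite normc_sqr.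
have [ii le] := itg_le_fin mc (fun x => mulr_ge0 (sqr_ge0 _) (sqr_ge0 _)) h.
have dom x : cdot ((eta x)%:C * v x) ((eta x)%:C * v x) <=
    k ^+ 2 * (rho x ^+ 2 * normc (v x) ^+ 2).
  rewrite cdotZl cdotC cdotZl -normc_sqr mulrA mulrA; apply: ler_wpM2r; first exact: sqr_ge0.
  rewrite -expr2 -exprMn -(real_normK (num_real (eta x))).
  by apply: ler_pM => //; rewrite ?mulr_ge0.
have cL : CL2 (mul eta v).
  have sq (p : R[i] -> R) : (forall a, p a ^+ 2 <= cdot a a) ->
      measurable_fun setT (fun x => p ((eta x)%:C * v x)) ->
      L2r (fun x => p ((eta x)%:C * v x)).
    move=> pa mp; split => //; apply: (itg_le _ _ (itgZ (k ^+ 2) ii)).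
      exact: measurable_funX.
    by move=> x; rewrite ger0_norm ?sqr_ge0//; apply: le_trans (pa _) (dom x).
  split; apply: sq.
  - by move=> a; rewrite /cdot -!expr2 lerDl sqr_ge0.
  - rewrite (_ : (fun x => _) = (fun x => eta x * Re (v x))); first exact: measurable_funM.
    by apply/funext => x; case: (v x) => [? ?] /=; ring.
  - by move=> a; rewrite /cdot -!expr2 lerDr sqr_ge0.
  - rewrite (_ : (fun x => _) = (fun x => eta x * Im (v x))); first exact: measurable_funM.
    by apply/funext => x; case: (v x) => [? ?] /=; ring.
split => //; apply: sqr_sqrt_le; first exact: mulr_ge0.
rewrite exprMn; apply: (@le_trans _ _ (k ^+ 2 * rint (fun x => rho x ^+ 2 * normc (v x) ^+ 2))).
  rewrite -rintZ//; apply: rint_le => //; first exact: itg_cdot.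
  exact: itgZ.
by apply: ler_wpM2l => //; exact: sqr_ge0.
Qed.

Lemma tmeas_section (F : R -> R -> R) t : tmeas F -> 0 < t -> measurable_fun setT (F^~ t).
Proof.
move=> mF t0; have := measurableT_comp (measurable_cut (t + 1) mF) (pair1_measurable t).
congr measurable_fun; apply/funext => x.
by rewrite /= /cut t0 ltrDl ltr01.
Qed.

(* A real-valued component of complex numbers: [p] is the real part and [e] is 1, or
   [p] is the imaginary part and [e] is 'i. *)
Record component (p : R[i] -> R) (e : R[i]) : Prop := Component {
  component_cdot : forall a k, cdot a (k%:C * e) = p a * k;
  component_scale : forall a k, p (k%:C * a) = k * p a;
  component_L2r : forall v, CL2 v -> L2r (fun x => p (v x));
  component_CL2 : forall f : R -> R, L2r f -> CL2 (fun x => (f x)%:C * e);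
  component_le : forall a, p a ^+ 2 <= cdot a a }.

Lemma component_Re : component (@complex.Re R) 1.
Proof.
split.
- by move=> [a b] k; rewrite /cdot/=; ring.
- by move=> [a b] k /=; ring.
- by move=> v [].
- move=> f hf; split.
    by congr L2r : hf; apply/funext => x /=; ring.
  by congr L2r : (@L2r0 R); apply/funext => x /=; ring.
- by move=> a; rewrite /cdot -!expr2 lerDl sqr_ge0.
Qed.

Lemma component_Im : component (@complex.Im R) 'i.
Proof.
split.
- by move=> [a b] k; rewrite /cdot/=; ring.
- by move=> [a b] k /=; ring.
- by move=> v [].
- move=> f hf; split.
    by congr L2r : (@L2r0 R); apply/funext => x /=; ring.
  by congr L2r : hf; apply/funext => x /=; ring.
- by move=> a; rewrite /cdot -!expr2 lerDr sqr_ge0.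
Qed.

Lemma component_pair (p : R[i] -> R) (e : R[i]) v (w : R -> R) : component p e ->
  CL2 v -> L2r w -> itg (fun x => w x * p (v x)) /\
  rint (fun x => `|w x * p (v x)|) <= nrm v * Num.sqrt (rint (fun x => w x ^+ 2)).
Proof.
move=> [pc _ pL2 pCL2 pl] hv hw; have hp := pL2 v hv.
have abs (g : R -> R) : L2r g -> L2r (fun x => `|g x|).
  by move=> hg; apply: (L2r_le _ _ hg) => [|x]; [exact: measurableT_comp hg.1|rewrite normr_id].
have h1 := component_CL2 component_Re (abs _ hp); have h2 := component_CL2 component_Re (abs _ hw).
split; first exact: L2r_M.
have E : ip (fun x => (`|p (v x)|)%:C * 1) (fun x => (`|w x|)%:C * 1) =
    rint (fun x => `|w x * p (v x)|).
  by congr rint; apply/funext => x; rewrite /cdot/= normrM; ring.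
rewrite -E; apply: le_trans (ler_norm _) _; apply: le_trans (ip_CS h1 h2) _.
apply: ler_pM; rewrite ?nrm_ge0//.
  apply: nrm_le => // x; rewrite (_ : cdot (_ * 1) _ = `|p (v x)| ^+ 2).
    by rewrite real_normK ?num_real.
  by rewrite /cdot/=; ring.
rewrite /nrm ler_wsqrtr// le_eqVlt; apply/orP; left; apply/eqP.
congr rint; apply/funext => x; rewrite -(real_normK (num_real (w x))) /cdot/=; ring.
Qed.

Context (f ft : R -> R -> R[i]) (G : R -> R -> R[i]) (rho : R -> R) (m : R).
Context (m0 : 0 <= m) (mrho : measurable_fun setT rho).
Context (mf : jointly_measurable f) (mft : jointly_measurable ft).
Context (bf : {ae mu, forall t, 0 < t -> (sqnormL2w rho (f^~ t) <= (m ^+ 2)%:E)%E}).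
Context (bft : {ae mu, forall t, 0 < t -> (sqnormL2w rho (ft^~ t) <= (m ^+ 2)%:E)%E}).
Context (wft : weak_time_deriv f ft).
Context (pathG : L2path G) (contG : L2cont G).
Context (fG : {ae mu, forall t, 0 < t -> {ae mu, forall x, f x t = G t x}}).

Lemma cmeasurable_section (g : R -> R -> R[i]) t : jointly_measurable g -> 0 < t ->
  cmeasurable (g^~ t).
Proof.
move=> [m1 m2] t0; split.
  exact: (@tmeas_section (fun x s => Re (g x s)) t m1 t0).
exact: (@tmeas_section (fun x s => Im (g x s)) t m2 t0).
Qed.

Section Weight.
Context (eta : R -> R) (k C : R) (k0 : 0 <= k).
Context (meta : measurable_fun setT eta) (beta : forall x, `|eta x| <= C).
Context (er : forall x, `|eta x| <= k * rho x).

Let cL (g : R -> R -> R[i]) : jointly_measurable g ->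
  {ae mu, forall t, 0 < t -> (sqnormL2w rho (g^~ t) <= (m ^+ 2)%:E)%E} ->
  {ae mu, forall t, 0 < t -> CL2 (mul eta (g^~ t)) /\ nrm (mul eta (g^~ t)) <= k * m}.
Proof.
move=> mg; apply: aeS => t h t0.
by apply: (weighted_CL2 m0 k0 mrho meta) (h t0) => //; exact: cmeasurable_section.
Qed.

Let pathW : L2path (fun s => mul eta (G s)).
Proof. by move=> s s0; apply: CL2M beta (pathG s0). Qed.

Let contW : L2cont (fun s => mul eta (G s)).
Proof. exact: L2contM beta pathG contG. Qed.

Let eqW : {ae mu, forall t, 0 < t -> {ae mu, forall x, (eta x)%:C * f x t = (eta x)%:C * G t x}}.
Proof. by apply: aeS fG => t h t0; apply: aeS (h t0) => x ->. Qed.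

(** The bound holds at almost every time, where [G] is [f]; each [t >= 0] is a limit of such times
    from the right, and [G] is continuous in L^2. *)
Lemma weighted_force_bound t : 0 <= t -> nrm (mul eta (G t)) <= k * m.
Proof.
move=> t0; have cn := cont0_nrm pathW contW.
apply/ler_addgt0Pr => /= e e0.
have [d d0 dH] := cont0P cn t0 e0.
have pos : (0 < mu `]t, (t + d)%R[)%E.
  by rewrite /= lebesgue_measure_itv/= lte_fin ltrDl d0 -EFinB lte_fin subr_gt0 ltrDl.
have [s sI [h1 h2]] := ae_ex (measurable_itv `]t, (t + d)%R[%R) pos
  (aeI (cL mf bf) eqW).
move: sI; rewrite /= in_itv/= => /andP[ts std].
have s0 := le_lt_trans t0 ts; have [c1 c2] := h1 s0.
rewrite (nrm_ae c1 (pathW (ltW s0)) (h2 s0)) in c2.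
have := dH s (ltW s0); rewrite gtr0_norm ?subr_gt0// ltrBlDl => /(_ std).
rewrite ltr_norml => /andP[h3 h4]; lra.
Qed.

(** [cut_lip] with [c = eta * w], for one real component of the forcing; Cauchy-Schwarz bounds the
    time sections. *)
Lemma component_lip (p : R[i] -> R) (e : R[i]) (w : R -> R) : component p e ->
  tmeas (fun x t => p (f x t)) -> tmeas (fun x t => p (ft x t)) ->
  time_wd (fun x t => p (f x t)) (fun x t => p (ft x t)) ->
  L2r w -> forall s t, 0 < s -> s < t ->
  `|ip (mul eta (G t)) (fun x => (w x)%:C * e) - ip (mul eta (G s)) (fun x => (w x)%:C * e)|
    <= k * m * Num.sqrt (rint (fun x => w x ^+ 2)) * (t - s).
Proof.
move=> pe m1 m2 wp hw s t s0 st.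
have hwe := component_CL2 pe hw.
have comp (g : R -> R -> R[i]) r : CL2 (mul eta (g^~ r)) -> nrm (mul eta (g^~ r)) <= k * m ->
    itg (fun x => eta x * w x * p (g x r)) /\
    rint (fun x => `|eta x * w x * p (g x r)|) <= k * m * Num.sqrt (rint (fun x => w x ^+ 2)).
  move=> h1 h2; have [i1 i2] := component_pair pe h1 hw.
  have E x : w x * p ((eta x)%:C * g x r) = eta x * w x * p (g x r).
    by rewrite (component_scale pe); ring.
  rewrite (eq_fun E) in i1; rewrite (eq_fun (fun x => congr1 Num.norm (E x))) in i2.
  split => //; apply: le_trans i2 _.
  by apply: ler_wpM2r => //; exact: sqrtr_ge0.
apply: (@cut_lip _ (fun x t => p (f x t)) (fun x t => p (ft x t))
  (fun x => eta x * w x) _ (fun r => ip (mul eta (G r)) (fun x => (w x)%:C * e))) => //.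
- by rewrite mulr_ge0 ?sqrtr_ge0// mulr_ge0.
- by apply: measurable_funM => //; exact: hw.1.
- by apply: aeS (cL mf bf) => r h r0; have [h1 h2] := h r0; exact: comp.
- by apply: aeS (cL mft bft) => r h r0; have [h1 h2] := h r0; exact: comp.
- apply: cont0_ip => //.
  move=> r r0; rewrite (_ : (fun _ => _) = fun=> 0); first exact: cvg_cst.
    apply/funext => q; rewrite (_ : (fun x => _) = (fun=> 0)).
      by rewrite /nrm /ip; under eq_fun do rewrite /cdot/= mul0r addr0; rewrite rint0 sqrtr0.
    by apply/funext => x; rewrite subrr.
apply: aeS (aeI (cL mf bf) eqW) => r [h1 h2] r0.
have [c1 c2] := h1 r0; rewrite -(ip_ae c1 (pathW (ltW r0)) hwe (h2 r0)).
congr rint; apply/funext => x; rewrite (component_cdot pe) (component_scale pe); ring.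
Qed.

(** The test function is the increment [W = eta (G(t') - G(s'))] itself: each of its components has
    squared norm at most [k * m * |W| * (t' - s')]. Adding the two gives the factor 2, and one power
    of [|W|] cancels. Time 0 is reached by shifting both times by the same small amount, which
    leaves [s - t] unchanged. *)
Lemma weighted_force_lip s t : 0 <= s -> 0 <= t ->
  nrm (fun x => (eta x)%:C * (G s x - G t x)) <= 2 * (k * m) * `|s - t|.
Proof.
have km : 0 <= k * m by exact: mulr_ge0.
have scale (q : R[i] -> R) e (g : R -> R) z x : component q e ->
    (fun t => q ((g t)%:C * z x t)) = (fun t => g t * q (z x t)).
  by move=> qe; apply/funext => r; rewrite (component_scale qe).
have wRe : time_wd (fun x t => Re (f x t)) (fun x t => Re (ft x t)).
  move=> th /wft; apply: aeS => x /(congr1 (@complex.Re R)) /= h.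
  by rewrite !(scale _ _ _ _ _ component_Re) in h.
have wIm : time_wd (fun x t => Im (f x t)) (fun x t => Im (ft x t)).
  move=> th /wft; apply: aeS => x /(congr1 (@complex.Im R)) /= h.
  by rewrite !(scale _ _ _ _ _ component_Im) in h.
have pos s' t' : 0 < s' -> s' < t' ->
    nrm (fun x => (eta x)%:C * (G t' x - G s' x)) <= 2 * (k * m) * (t' - s').
  move=> s0 st; have t0 := lt_trans s0 st.
  pose W x := (eta x)%:C * (G t' x - G s' x).
  have EW : W = (fun x => (eta x)%:C * G t' x - (eta x)%:C * G s' x).
    by apply/funext => x; rewrite /W mulrBr.
  have hW : CL2 W by rewrite EW; apply: CL2B; apply: pathW; exact: ltW.
  have part (p : R[i] -> R) e : component p e ->
      `|ip (mul eta (G t')) (fun x => (p (W x))%:C * e) - ip (mul eta (G s')) (fun x => (p (W x))%:C * e)|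
         <= k * m * Num.sqrt (rint (fun x => p (W x) ^+ 2)) * (t' - s') ->
      rint (fun x => p (W x) ^+ 2) <= k * m * nrm W * (t' - s').
    move=> pe; have hp := component_L2r pe hW.
    have hpe := component_CL2 pe hp.
    rewrite -(ipBl (pathW (ltW t0)) (pathW (ltW s0)) hpe).
    rewrite -EW (_ : ip _ _ = rint (fun x => p (W x) ^+ 2)); last first.
      by congr rint; apply/funext => x; rewrite (component_cdot pe) expr2.
    move=> h; apply: le_trans (ler_norm _) _; apply: le_trans h _.
    apply: ler_wpM2r; first by rewrite subr_ge0 ltW.
    apply: ler_wpM2l => //; rewrite /nrm ler_wsqrtr//; apply: rint_le.
    - exact: hp.2.
    - exact: itg_cdot.
    - by move=> x; exact: component_le pe _.
  have r1 := part _ _ component_Re (component_lip component_Re mf.1 mft.1 wRe hW.1 s0 st).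
  have r2 := part _ _ component_Im (component_lip component_Im mf.2 mft.2 wIm hW.2 s0 st).
  have E : nrm W ^+ 2 = rint (fun x => Re (W x) ^+ 2) + rint (fun x => Im (W x) ^+ 2).
    by rewrite nrm_sqr -rintD; [congr rint; apply/funext => x; rewrite /cdot !expr2
      |exact: hW.1.2|exact: hW.2.2].
  have : nrm W * nrm W <= 2 * (k * m) * (t' - s') * nrm W.
    rewrite -expr2 E; lra.
  have [W0|W0] := eqVneq (nrm W) 0.
    by move=> _; rewrite -/W W0 !mulr_ge0// subr_ge0 ltW.
  by rewrite ler_pM2r// lt_def W0 nrm_ge0.
have pos2 s' t' : 0 < s' -> 0 < t' ->
    nrm (fun x => (eta x)%:C * (G s' x - G t' x)) <= 2 * (k * m) * `|s' - t'|.
  move=> s0 t0; have [st|ts|->] := ltgtP s' t'.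
  - rewrite distrC gtr0_norm ?subr_gt0//; apply: le_trans (pos _ _ s0 st).
    rewrite le_eqVlt; apply/orP; left; apply/eqP; rewrite -[LHS]nrmN.
    by congr nrm; apply/funext => x; ring.
  - by rewrite gtr0_norm ?subr_gt0//; exact: pos.
  - rewrite subrr normr0 mulr0 (_ : (fun x => _) = (fun x => (0 : R)%:C * G t' x)).
      by rewrite nrmZ ?normr0 ?mul0r//; exact: pathG (ltW t0).
    by apply/funext => x; rewrite subrr mulr0 mul0r.
move=> s0 t0; pose D h := nrm (fun x => (eta x)%:C * (G (s + h) x - G (t + h) x)).
have cD : cont0 D.
  have ps r : 0 <= r -> L2path (fun h => mul eta (G (h + r))).
    by move=> r0 h h0; apply: pathW; rewrite addr_ge0.
  have cs r : 0 <= r -> L2cont (fun h => mul eta (G (h + r))).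
    by move=> r0; exact: (L2cont_shift r0 contW).
  rewrite (_ : D = (fun h => nrm (fun x => (eta x)%:C * G (h + s) x - (eta x)%:C * G (h + t) x))).
    apply: cont0_nrm; first by apply: L2pathB; exact: ps.
    by apply: L2contB; [exact: ps|exact: ps|exact: cs|exact: cs].
  apply/funext => h; rewrite /D; congr nrm; apply/funext => x.
  by rewrite mulrBr (addrC s) (addrC t).
apply/ler_addgt0Pr => /= e e0; have [d d0 dH] := cont0P cD (lexx 0) e0.
have d2 : 0 < d / 2 by rewrite divr_gt0.
have := dH (d / 2) (ltW d2); rewrite subr0 gtr0_norm// => /(_ _).
rewrite ltr_pdivrMr// ltr_pMr// ltr1n => /(_ isT).
rewrite ltr_norml {2}/D !addr0 => /andP[h1 _].
have := pos2 (s + d / 2) (t + d / 2) (ltr_wpDl s0 d2) (ltr_wpDl t0 d2).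
rewrite (_ : s + d / 2 - (t + d / 2) = s - t); last by ring.
rewrite -/(D (d / 2)); lra.
Qed.

End Weight.

(** The inner integrals agree at almost every time; the measurability in time of the one with [f],
    from Tonelli's theorem, allows the outer integrals to be compared. *)
Lemma decay_integral (phi : R -> R) : cont0 phi ->
  (\int[mu]_(t in `]0%R, +oo[) \int[mu]_x ((phi t) ^+ 2 * (normc (f x t)) ^+ 2)%:E < +oo)%E ->
  (\int[mu]_(t in `]0%R, +oo[) ((phi t) ^+ 2 * ip (G t) (G t))%:E < +oo)%E.
Proof.
move=> cphi; apply: le_lt_trans; rewrite le_eqVlt; apply/orP; left; apply/eqP.
have mphi := cont0_measurable cphi.
have mF : tmeas (fun x t => phi t ^+ 2 * normc (f x t) ^+ 2).
  have mT : measurable_fun ([set: R] `*` `]0, +oo[ : set (R * R)) (fun p : R * R => phi p.2).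
    apply: (@measurable_comp _ _ _ _ _ _ (`]0%R, +oo[ : set R) phi
      ([set: R] `*` `]0, +oo[ : set (R * R)) (fun p : R * R => p.2)) => //.
    - by move=> _ [[x t] /= [_ tI] <-].
    - by apply: measurable_funS (@measurable_snd _ _ _ _).
  apply: measurable_funM; first exact: measurable_funX.
  rewrite (_ : (fun p : R * R => _) = (fun p : R * R => Re (f p.1 p.2) * Re (f p.1 p.2)
     + Im (f p.1 p.2) * Im (f p.1 p.2))).
    by apply: measurable_funD; apply: measurable_funM; [exact: mf.1|exact: mf.1|exact: mf.2|exact: mf.2].
  by apply/funext => p; rewrite normc_sqr.
have I0 t : t \in `]0, +oo[%R -> 0 < t by rewrite in_itv/= andbT.
have mH := measurable_time_restrict I0 mF.
have mE : measurable_fun setT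
    (fun p => ((fun p : R * R => phi p.1 ^+ 2 * normc (f p.2 p.1) ^+ 2) \_ (`]0, +oo[ `*` setT) p)%:E).
  exact/measurable_EFinP.
have mI := @measurable_fun_fubini_tonelli_F _ _ _ _ _ mu _ mE.
have {}mI : measurable_fun setT (fubini_F mu
    (fun p => ((fun p : R * R => phi p.1 ^+ 2 * normc (f p.2 p.1) ^+ 2) \_ (`]0, +oo[ `*` setT) p)%:E)).
  apply: mI => p; rewrite lee_fin /patch; case: ifP => _; last exact: lexx.
  by rewrite mulr_ge0 ?sqr_ge0.
have cG : cont0 (fun t => phi t ^+ 2 * ip (G t) (G t)).
  under eq_fun do rewrite expr2.
  by apply: cont0M; [exact: cont0M|exact: cont0_ip].
symmetry; apply: ge0_ae_eq_integral => //.
- have mI' := measurable_funS measurableT (@subsetT _ (`]0%R, +oo[ : set R)) mI.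
  apply: eq_measurable_fun mI' => t.
  rewrite inE/= in_itv/= andbT => t0; rewrite /fubini_F/=; apply: eq_integral => x _.
  by rewrite /patch in_setX in_setT andbT mem_setE in_itv/= t0.
- by apply/measurable_EFinP; exact: cont0_measurable.
- by move=> t _; apply: integral_ge0 => x _; rewrite lee_fin mulr_ge0 ?sqr_ge0.
- by move=> t _; rewrite lee_fin mulr_ge0 ?sqr_ge0// ip_ge0.
apply: aeS fG => t h; rewrite /= in_itv/= andbT => t0.
have hG := pathG (ltW t0).
rewrite -rintZ; last exact: itg_cdot.
rewrite EFin_rint; last by apply: itgZ; exact: itg_cdot.
apply: ae_eq_integral => //.
- by apply/measurable_EFinP; exact: (tmeas_section mF t0).
- by apply/measurable_EFinP; apply: measurable_funM => //; exact: itg_meas (itg_cdot hG hG).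
by apply: aeS (h t0) => x /= -> _; rewrite normc_sqr.
Qed.

End WeightedData.

(** * The time weight *)

Section TimeWeight.
Context {R : realType}.
Local Notation mu := (@lebesgue_measure R).
Implicit Types (phi : R -> R) (s t e T : R).

Lemma time_deriv_cvg phi t : time_derivable phi t ->
  time_quotient phi t s @[s --> within `[0, +oo[ t^'] --> time_deriv phi t.
Proof. by []. Qed.

Lemma time_deriv_rder phi t : 0 <= t -> time_derivable phi t ->
  rder phi t (time_deriv phi t).
Proof.
move=> t0 /time_deriv_cvg h; apply/cvgrPdist_lt => /= e e0.
move/cvgrPdist_lt : h => /(_ e e0) /(right_within' t0); apply: filterS => s.
by rewrite /time_quotient mulrC.
Qed.

Lemma time_derivable_cont0 phi : (forall t, 0 <= t -> time_derivable phi t) -> cont0 phi.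
Proof.
move=> dphi t t0; have h := time_deriv_cvg (dphi t t0).
set l := time_deriv phi t in h.
have [d /= d0 dH] : \forall s \near t, s != t -> 0 <= s -> `|l - time_quotient phi t s| < 1.
  move/cvgrPdist_lt : h => /(_ 1 ltr01) h.
  have {}h : \forall s \near t, s != t -> (`[0, +oo[ : set R) s ->
    `|l - time_quotient phi t s| < 1 by exact: h.
  by apply: filterS h => s hs st s0; apply: hs => //; rewrite /= in_itv/= andbT.
have L0 : 0 < `|l| + 1 by rewrite ltr_wpDl.
apply/cvgrPdist_lt => /= e e0; rewrite near_withinE.
exists (Num.min d (e / (`|l| + 1))) => /=; first by rewrite lt_min d0 divr_gt0.
move=> s /=; rewrite lt_min => /andP[sd se]; rewrite in_itv/= andbT => s0.
have [->|st] := eqVneq s t; first by rewrite subrr normr0.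
have q := dH s sd st s0.
have qb : `|time_quotient phi t s| <= `|l| + 1.
  by have := ler_distD l 0 (time_quotient phi t s); rewrite !sub0r !normrN; lra.
have E : phi t - phi s = time_quotient phi t s * (t - s).
  by rewrite /time_quotient; field; rewrite subr_eq0.
rewrite E normrM; apply: (@le_lt_trans _ _ ((`|l| + 1) * `|t - s|)).
  exact: ler_wpM2r.
by rewrite mulrC -ltr_pdivlMr.
Qed.

Lemma time_weight_min phi : cont0 phi -> (forall t, 0 <= t -> 0 < phi t) ->
  phi t @[t --> +oo] --> +oo -> exists2 c : R, 0 < c & forall t, 0 <= t -> c <= phi t.
Proof.
move=> cphi phi0 phioo.
have [T [_ HT]] : \forall t \near +oo, 1 <= phi t by move/cvgryPge : phioo; exact.
have T0 : 0 <= `|T| by [].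
have [t0 _ Ht0] := EVT_min T0 (continuous_subspaceT (cont0_abs cphi)).
exists (Num.min 1 (phi `|t0|)); first by rewrite lt_min ltr01 phi0.
move=> t t_ge0; rewrite ge_min; have [tT|tT] := leP t `|T|.
  have := Ht0 t; rewrite in_itv/= t_ge0 tT => /(_ isT).
  by rewrite (ger0_norm t_ge0) => ->; rewrite orbT.
by rewrite HT//; apply: le_lt_trans tT; exact: ler_norm.
Qed.

(** In type (A) the slope stays below [delta2] while [phi] eventually exceeds [delta2 / gamma]; in
    type (B) the condition [delta2 <= gamma] gives it from time 0 on. *)
Lemma time_weight_growth phi (gamma : R) : 0 < gamma -> phi t @[t --> +oo] --> +oo ->
  (forall t, 0 <= t -> 0 < phi t) ->
  (exists delta1 delta2, typeA phi delta1 delta2) \/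
  (exists delta1 delta2, typeB phi delta1 delta2 /\ delta2 <= gamma) ->
  exists2 T, 0 <= T & forall t, T <= t -> time_deriv phi t <= gamma * phi t.
Proof.
move=> g0 phioo phi0 [[d1 [d2 [_ h]]]|[d1 [d2 [[_ h] d2g]]]]; last first.
  exists 0 => // t t0; have /andP[_ ht] := h t t0.
  apply: le_trans (ler_norm _) _; apply: le_trans (ltW ht) _.
  by rewrite gtr0_norm ?phi0// ler_pM2r// phi0.
have [T [_ HT]] : \forall t \near +oo, d2 / gamma <= phi t.
  by move/cvgryPge : phioo; exact.
exists (`|T| + 1); first by rewrite ltW// ltr_wpDl.
move=> t tT; have t0 : 0 <= t by apply: le_trans tT; rewrite ltW// ltr_wpDl.
have /andP[_ ht] := h t t0.
apply: le_trans (ler_norm _) _; apply: le_trans (ltW ht) _.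
rewrite mulrC -ler_pdivrMr//; apply: HT; apply: lt_le_trans tT.
by apply: le_lt_trans (ler_norm T) _; rewrite ltrDl.
Qed.

Lemma rder_sqrt phi t (l : R) : 0 <= t -> (forall s, 0 <= s -> 0 < phi s) -> rder phi t l ->
  rder (fun s => Num.sqrt (phi s)) t (l / (2 * Num.sqrt (phi t))).
Proof.
move=> t0 phi0 dphi; have st0 : 0 < Num.sqrt (phi t) by rewrite sqrtr_gt0 phi0.
have h1 := rder_cvg dphi.
have h2 : Num.sqrt (phi s) @[s --> t^'+] --> Num.sqrt (phi t).
  exact: (cvg_comp _ _ h1 (@sqrt_continuous R _)).
have h3 : (Num.sqrt (phi s) + Num.sqrt (phi t))^-1 @[s --> t^'+] -->
    (Num.sqrt (phi t) + Num.sqrt (phi t))^-1.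
  apply: cvgV; first by rewrite gt_eqF// addr_gt0.
  by apply: cvgD => //; exact: cvg_cst.
have h4 : (phi s - phi t) / (s - t) * (Num.sqrt (phi s) + Num.sqrt (phi t))^-1 @[s --> t^'+]
    --> l * (Num.sqrt (phi t) + Num.sqrt (phi t))^-1 by exact: cvgM.
rewrite (_ : l / (2 * Num.sqrt (phi t)) = l * (Num.sqrt (phi t) + Num.sqrt (phi t))^-1); last first.
  by congr (_ / _); ring.
rewrite /rder; apply: cvg_trans h4; apply: near_eq_cvg; near=> s.
have ts : t < s by near: s; exact: near_right_gt.
have s0 : 0 <= s by apply: le_trans t0 (ltW ts).
have q1 := sqr_sqrtr (ltW (phi0 s s0)); have q2 := sqr_sqrtr (ltW (phi0 t t0)).
have ss0 : 0 < Num.sqrt (phi s) by rewrite sqrtr_gt0 phi0.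
rewrite /= -{1}q1 -{1}q2; field.
by rewrite subr_eq0 !gt_eqF// addr_gt0.
Unshelve. all: by end_near. Qed.

End TimeWeight.

(** * Decay of the mass and of the sup norm against the time weight *)

Section TemporalDecay.
Context {R : realType}.
Local Notation mu := (@lebesgue_measure R).
Implicit Types (x s t T c : R) (phi dphi : R -> R).
Context (gamma : R) (U Ux Uxx Ut G : R -> R -> R[i]).
Context (H : nls_path gamma U Ux Uxx Ut G) (g0 : 0 < gamma).

(** Here Young's inequality may spend only a quarter of the damping: the remaining rate
    [3 / 2 * gamma] is exactly what the logarithmic derivative of [psi^3], namely
    [3 / 2 * phi' / phi], can use up. *)
Lemma mass_slope t : 0 <= t -> exists2 N' : R, rder (fun s => ip (U s) (U s)) t N' &
  N' <= - (3 / 2) * gamma * ip (U t) (U t) + 2 / gamma * ip (G t) (G t).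
Proof.
move=> t0; exists (- 2 * gamma * ip (U t) (U t) - 2 * ip (U t) (fun x => 'i * G t x)).
  exact: (mass_rder1 H).
have := ip_CS (pU H t0) (CL2i (pG H t0)); rewrite nrmi ler_norml => /andP[h _].
have := sqr_ge0 (gamma / 2 * nrm (U t) - nrm (G t)).
have gi : 0 <= 2 / gamma by rewrite divr_ge0// ltW.
move=> /(mulr_ge0 gi).
rewrite -!nrm_sqr in h *.
rewrite (_ : 2 / gamma * (gamma / 2 * nrm (U t) - nrm (G t)) ^+ 2 =
   gamma / 2 * nrm (U t) ^+ 2 - 2 * (nrm (U t) * nrm (G t)) + 2 / gamma * nrm (G t) ^+ 2);
  last by field; rewrite gt_eqF.
lra.
Qed.

(* With [psi = sqrt phi], the exponent 3 is what [phi' <= gamma phi] lets the damping absorb,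
   and [|u|_oo^2 <= C N^(3/4)] turns it into decay like [phi^(-9/8)]. *)
Lemma weighted_mass_bounded phi dphi T c : 0 <= T -> 0 < c -> cont0 phi ->
  (forall t, 0 <= t -> c <= phi t) -> (forall t, 0 <= t -> rder phi t (dphi t)) ->
  (forall t, T <= t -> dphi t <= gamma * phi t) ->
  (\int[mu]_(t in `]0%R, +oo[) ((phi t) ^+ 2 * ip (G t) (G t))%:E < +oo)%E ->
  exists2 C : R, 0 <= C & forall t, T <= t ->
    Num.sqrt (phi t) ^+ 3 * ip (U t) (U t) <= C.
Proof.
move=> T0 c0 cphi phic dphi_rder dphiT hint.
have phi0 t : 0 <= t -> 0 < phi t by move=> t0; exact: lt_le_trans (phic t t0).
have ck : cont0 (fun t => phi t ^+ 2 * ip (G t) (G t)).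
  under eq_fun do rewrite expr2.
  apply: cont0M; first exact: cont0M.
  by apply: cont0_ip; [exact: (pG H)|exact: (pG H)|exact: (cG H)|exact: (cG H)].
have k0 t : 0 <= t -> 0 <= phi t ^+ 2 * ip (G t) (G t).
  by move=> _; rewrite mulr_ge0 ?sqr_ge0 ?ip_ge0.
have [P [cP dP [J bP]]] := primitive ck k0 hint.
pose psi t := Num.sqrt (phi t).
have cpsi : cont0 psi.
  by move=> t t0; apply: (cvg_comp _ _ (cphi t t0) (@sqrt_continuous R _)).
have psi0 t : 0 <= t -> 0 < psi t by move=> t0; rewrite sqrtr_gt0 phi0.
have psic t : 0 <= t -> Num.sqrt c <= psi t.
  by move=> t0; rewrite ler_wsqrtr// phic.
have psi2 t : 0 <= t -> psi t * psi t = phi t.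
  by move=> t0; rewrite -expr2 sqr_sqrtr// ltW// phi0.
have sc0 : 0 < Num.sqrt c by rewrite sqrtr_gt0.
(* Since [sqrt c <= psi], one has [psi^3 <= phi^2 / sqrt c], so the forcing term is at most [b]
   times the derivative of [P]. *)
pose b := 2 / gamma / Num.sqrt c.
have b0 : 0 <= b by rewrite !divr_ge0 ?ltW.
pose Z t := psi t * (psi t * psi t) * ip (U t) (U t) + - (b * P t).
have cZ : cont0 Z.
  apply: cont0D; last by apply: cont0N; exact: cont0Z.
  apply: cont0M; last by apply: cont0_ip; [exact: (pU H)|exact: (pU H)|exact: (cU H)|exact: (cU H)].
  by apply: cont0M => //; exact: cont0M.
have ZT t : T <= t -> Z t <= Z T.
  apply: dini_noninc => // {}t Tt; have t0 := le_trans T0 Tt.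
  have [N' dN N'le] := mass_slope t0.
  have dpsi := rder_sqrt t0 phi0 (dphi_rder t t0).
  have d3 := rderM (rderM dpsi (rderM dpsi dpsi)) dN.
  have dbP := rderZ (k := - b) (dP t t0).
  have := rder_udini (rderD d3 dbP).
  under eq_fun do rewrite mulNr.
  apply: udini_le; rewrite -/(psi t).
  set q := psi t; have q0 : 0 < q by exact: psi0.
  set n := ip (U t) (U t); set k := ip (G t) (G t).
  have n0 : 0 <= n by exact: ip_ge0.
  have kk0 : 0 <= k by exact: ip_ge0.
  have qq : q * q = phi t by exact: psi2.
  have dT : dphi t <= gamma * (q * q) by rewrite qq; exact: dphiT.
  rewrite (_ : _ + _ = 3 / 2 * (q * n) * dphi t + q * (q * q) * N' - b * (phi t ^+ 2 * k)); last first.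
    by field; rewrite gt_eqF.
  have e1 := ler_wpM2l (mulr_ge0 (_ : 0 <= 3 / 2 :> R) (mulr_ge0 (ltW q0) n0)) dT.
  have q3 : 0 <= q * (q * q) by rewrite !mulr_ge0 ?ltW.
  have e2 := ler_wpM2l q3 N'le.
  have e3 : 2 / gamma * (q * (q * q)) * k <= b * (phi t ^+ 2 * k).
    rewrite (mulrA b); apply: ler_wpM2r => //.
    rewrite -qq /b (_ : 2 / gamma / Num.sqrt c * (q * q) ^+ 2 =
       2 / gamma * (q * (q * q)) * (q / Num.sqrt c)); last first.
      by field; rewrite !gt_eqF.
    rewrite ler_peMr//; first by rewrite mulr_ge0// divr_ge0// ltW.
    by rewrite ler_pdivlMr// mul1r psic.
  have {e1}e1 : 3 / 2 * (q * n) * dphi t <= 3 / 2 * (q * n) * (gamma * (q * q)).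
    by apply: e1; rewrite divr_ge0.
  rewrite -/n -/k in e2; lra.
exists (Num.max 0 (Z T + b * J)); first by rewrite le_max lexx.
move=> t Tt; have t0 := le_trans T0 Tt; have := ZT t Tt.
have /andP[_ PJ] := bP t t0; have := ler_wpM2l b0 PJ.
rewrite {1}/Z -/(psi t) (_ : psi t ^+ 3 = psi t * (psi t * psi t)); last by ring.
rewrite le_max => h1 h2; apply/orP; right; lra.
Qed.

Context (L M : R).
Context (lip : forall s t, 0 <= s -> 0 <= t -> nrm (fun x => G s x - G t x) <= L * `|s - t|).
Context (bG : forall t, 0 <= t -> nrm (G t) <= M).
Context (intG : (\int[mu]_(t in `]0%R, +oo[) (ip (G t) (G t))%:E < +oo)%E).

(** The fourth power of [y = supU * phi] clears the fractional exponents: with [n = |U|] and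
    [q = sqrt phi], [y^4 <= 16 Z^2 n^6 q^8 = 16 Z^2 (q^3 n^2)^3 / q], where [q >= sqrt c]. On
    [[0, T]] continuity provides the bound. *)
Lemma temporal_decay phi dphi T c : 0 <= T -> 0 < c -> cont0 phi ->
  (forall t, 0 <= t -> c <= phi t) -> (forall t, 0 <= t -> rder phi t (dphi t)) ->
  (forall t, T <= t -> dphi t <= gamma * phi t) ->
  (\int[mu]_(t in `]0%R, +oo[) ((phi t) ^+ 2 * ip (G t) (G t))%:E < +oo)%E ->
  exists2 K : R, 0 < K & forall x t, 0 <= t -> normc (U t x) ^+ 2 <= K / phi t.
Proof.
move=> T0 c0 cphi phic dphi_rder dphiT hint.
have phi0 t : 0 <= t -> 0 < phi t by move=> t0; exact: lt_le_trans (phic t t0).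
have [C C0 HC] := weighted_mass_bounded T0 c0 cphi phic dphi_rder dphiT hint.
have [Z Z0 HZ] : exists2 Z : R, 0 <= Z & forall t, 0 <= t -> nrm (Uxx t) <= Z :=
  Uxx_bounded H g0 lip bG intG.
have cS : cont0 (fun t => supU U Ux t * phi t) by apply: cont0M => //; exact: (cont0_supU H).
have [D D0 HD] := cont0_bounded cS T0.
have sc0 : 0 < Num.sqrt c by rewrite sqrtr_gt0.
pose Q := 16 * Z ^+ 2 * C ^+ 3 / Num.sqrt c.
have Z2 : 0 <= 16 * Z ^+ 2 by apply: mulr_ge0 => //; exact: sqr_ge0.
have Q0 : 0 <= Q by apply: divr_ge0; [apply: mulr_ge0 => //; exact: exprn_ge0|exact: ltW].
have late t : T <= t -> supU U Ux t * phi t <= 1 + Q.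
  move=> Tt; have t0 := le_trans T0 Tt.
  set q := Num.sqrt (phi t); have q0 : 0 < q by rewrite sqrtr_gt0 phi0.
  have qq : q ^+ 2 = phi t by rewrite sqr_sqrtr// ltW// phi0.
  set n := nrm (U t); set y := supU U Ux t * phi t.
  have n0 : 0 <= n by exact: nrm_ge0.
  have S0 : 0 <= supU U Ux t by exact: supU_ge0.
  have h1 : supU U Ux t ^+ 2 <= 4 * n ^+ 3 * Z.
    apply: le_trans (supU_sqr_le H t0) _.
    by apply: ler_wpM2l (HZ t t0); rewrite mulr_ge0// exprn_ge0.
  have h2 : q ^+ 3 * n ^+ 2 <= C by rewrite nrm_sqr; exact: HC.
  have h3 : (supU U Ux t ^+ 2) ^+ 2 <= (4 * n ^+ 3 * Z) ^+ 2.
    by rewrite ler_pXn2r ?nnegrE ?sqr_ge0// !mulr_ge0// exprn_ge0.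
  have h4 : (q ^+ 3 * n ^+ 2) ^+ 3 <= C ^+ 3.
    by rewrite ler_pXn2r ?nnegrE// mulr_ge0// exprn_ge0// ltW.
  have y4 : y ^+ 4 <= Q.
    rewrite (_ : y ^+ 4 = (supU U Ux t ^+ 2) ^+ 2 * q ^+ 8); last by rewrite /y -qq; ring.
    have q8 : 0 <= q ^+ 8 by rewrite exprn_ge0// ltW.
    apply: le_trans (ler_wpM2r q8 h3) _.
    rewrite (_ : _ * q ^+ 8 = 16 * Z ^+ 2 * (q ^+ 3 * n ^+ 2) ^+ 3 / q); last first.
      by field; rewrite gt_eqF.
    apply: ler_pM.
    - by rewrite mulr_ge0// exprn_ge0// mulr_ge0// exprn_ge0// ltW.
    - by rewrite invr_ge0 ltW.
    - exact: ler_wpM2l.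
    - by rewrite lef_pV2 ?posrE// ler_wsqrtr// phic.
  have [y1|y1] := leP y 1; first by apply: le_trans y1 _; rewrite lerDl.
  apply: le_trans (_ : y <= y ^+ 4) _; first by rewrite ler_eXnr// ltW.
  by apply: le_trans y4 _; rewrite lerDr.
exists (D + 1 + Q); first by rewrite ltr_wpDr// ltr_wpDl.
move=> x t t0; apply: le_trans (supU_le H x t0) _.
rewrite ler_pdivlMr ?phi0//; have [Tt|tT] := leP T t.
  by have := late t Tt; lra.
have : supU U Ux t * phi t <= D by apply: HD; rewrite t0 ltW.
lra.
Qed.

End TemporalDecay.

(** * From the given solution and initial value to path data *)

Section Solution.
Context {R : realType}.
Local Notation mu := (@lebesgue_measure R).
Implicit Types (rho eta deta : R -> R) (v w : R -> R[i]) (x s t k m : R).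
Notation mul m v := (fun x => (m x)%:C * v x).

Lemma nls_solution_path (gamma : R) (u0 : R -> R[i]) (f u : R -> R -> R[i]) :
  nls_solution gamma u0 f u -> exists Ux Uxx Ut G,
  [/\ nls_path gamma (fun s => u^~ s) Ux Uxx Ut G,
      {ae mu, forall t, 0 < t -> {ae mu, forall x, f x t = G t x}}
    & {ae mu, forall x, u x 0 = u0 x}].
Proof.
move=> [ux [uxx [ut [[h2 cu cux cuxx] [du cut] reg eqn u0E]]]].
have [pu' cu'] := cont_L2P cu; have [pux cux'] := cont_L2P cux.
have [puxx cuxx'] := cont_L2P cuxx; have [put cut'] := cont_L2P cut.
have du' := deriv_L2P du.
have half : (2^-1)%:C = 2^-1 :> R[i] by rewrite fmorphV/= rmorph_nat.
exists (fun s => ux^~ s), (fun s => uxx^~ s), (fun s => ut^~ s),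
  (fun s x => 'i * ut x s + (2^-1)%:C * uxx x s + cube (u x s) + 'i * (gamma%:C * u x s)).
split => //.
  split=> //.
  - by move=> s s0; have [_ _ _ h _] := h2 s s0.
  - by move=> s s0; have [_ _ _ _ h] := h2 s s0.
  - by move=> s s0; have [] := reg s s0.
  - by move=> s s0; have [] := reg s s0.
apply: aeS eqn => t h t0; apply: aeS (h t0) => x E.
by rewrite half /cube E mulrA subrK.
Qed.

Lemma inL2w_sqnorm rho v : inL2w rho v -> cmeasurable v /\
  exists2 m : R, 0 <= m & (sqnormL2w rho v <= (m ^+ 2)%:E)%E.
Proof.
move=> [mv fin]; split => //; exists (Num.sqrt (fine (sqnormL2w rho v))).
  exact: sqrtr_ge0.
have s0 : (0 <= sqnormL2w rho v)%E.
  by apply: integral_ge0 => x _; rewrite lee_fin mulr_ge0 ?sqr_ge0.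
by rewrite sqr_sqrtr ?fine_ge0// fineK// ge0_fin_numE.
Qed.

(* [w] and [v1] agree a.e.; it is enough to compare them tested against [eta^2 v1]. *)
Lemma weighted_gradient eta deta v v1 v2 u0 w : C1b eta deta ->
  CL2 v -> CL2 v1 -> CL2 v2 -> weak_deriv v v1 -> weak_deriv v1 v2 ->
  CL2 u0 -> CL2 w -> weak_deriv u0 w -> {ae mu, forall x, v x = u0 x} ->
  nrm (mul eta v1) <= nrm (mul eta w).
Proof.
move=> he hv hv1 hv2 d1 d2 hu hw dw vu.
have [e1 e2] := CL2_C1b he hv1; have [e3 _] := CL2_C1b he hv2.
have [ew _] := CL2_C1b he hw.
have dz1 := weak_derivM he hv1 hv2 d2.
have hz1' := CL2D e2 e3.
have [z1 z2] := CL2_C1b he e1; have [z3 _] := CL2_C1b he hz1'.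
have dz := weak_derivM he e1 hz1' dz1.
have hz' := CL2D z2 z3.
have i1 := cibp hv hv1 z1 hz' d1 dz; have i2 := cibp hu hw z1 hz' dw dz.
have E : nrm (mul eta v1) ^+ 2 = ip (mul eta w) (mul eta v1).
  by rewrite nrm_sqr (ipM eta v1) i1 (ip_ae hv hu hz' vu) -i2 (ipM eta w).
have := le_trans (ler_norm _) (ip_CS ew e1); rewrite -E expr2.
have [->|n0] := eqVneq (nrm (mul eta v1)) 0; first by rewrite nrm_ge0.
by rewrite ler_pM2r// lt_def n0 nrm_ge0.
Qed.

End Solution.

(** * Assembly: constants from the data, then the two estimates *)

Unset Implicit Arguments.

Theorem mainTheorem1 (R : realType) (gamma : R) (rho phi : R -> R)
    (u0 : R -> R[i]) (f ft u : R -> R -> R[i])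
    (gamma_gt0 : 0 < gamma)
    (rho_adm : admissible_space_weight rho)
    (phi_adm : admissible_time_weight phi)
    (u0_H2 : inH2 u0) (u0_H1rho : inH1w rho u0)
    (f_bdd : inLoo_L2w rho f)
    (ft_deriv : weak_time_deriv f ft) (ft_bdd : inLoo_L2w rho ft)
    (f_decay : (\int[@lebesgue_measure R]_(t in `]0%R, +oo[)
                 \int[@lebesgue_measure R]_x
                   ((phi t) ^+ 2 * (normc (f x t)) ^+ 2)%:E < +oo)%E)
    (u_sol : nls_solution gamma u0 f u) :
  (exists2 K1 : R, 0 < K1 &
     forall x t, 0 <= t -> (normc (u x t)) ^+ 2 <= K1 / (rho x) ^+ 2)
  /\
  ((exists delta1 delta2, typeA phi delta1 delta2) \/
   (exists delta1 delta2, typeB phi delta1 delta2 /\ delta2 <= gamma) ->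
   exists2 K2 : R, 0 < K2 &
     forall x t, 0 < t -> (normc (u x t)) ^+ 2 <= K2 / phi t).
Proof.
have [Ux [Uxx [Ut [G [H fG u0E]]]]] := nls_solution_path u_sol.
have [rho0 lrho _ _] := rho_adm.
have mrho := continuous_measurableT (loc_lipschitz_continuous lrho).
have [beta beta0 rho_lower] := weight_lower_bound rho_adm.
have [c c0 rhoc] := weight_min rho_adm.
have [phi0 dphi phioo _] := phi_adm.
have cphi := time_derivable_cont0 dphi.
have [c' c'0 phic] := time_weight_min cphi phi0 phioo.
have [mf [M1 bf1]] := f_bdd; have [mft [M2 bft1]] := ft_bdd.
(* [M1] and [M2] bound squared norms; [1 <= m] gives [m <= m ^+ 2], so both are at most [m ^+ 2]. *)
pose m := 1 + `|M1| + `|M2|.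
have n1 := normr_ge0 M1; have n2 := normr_ge0 M2.
have m1 : 1 <= m by rewrite /m; lra.
have m0 : 0 <= m by apply: le_trans m1.
have mm : m <= m ^+ 2 by rewrite expr2 ler_peMl.
have bf : {ae @lebesgue_measure R, forall t, 0 < t -> (sqnormL2w rho (f^~ t) <= (m ^+ 2)%:E)%E}.
  apply: aeS bf1 => t h t0; apply: le_trans (h t0) _; rewrite lee_fin; apply: le_trans mm.
  by have := ler_norm M1; rewrite /m; lra.
have bft : {ae @lebesgue_measure R, forall t, 0 < t -> (sqnormL2w rho (ft^~ t) <= (m ^+ 2)%:E)%E}.
  apply: aeS bft1 => t h t0; apply: le_trans (h t0) _; rewrite lee_fin; apply: le_trans mm.
  by have := ler_norm M2; rewrite /m; lra.
have pathG := pG H; have contG := cG H.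
have FB := weighted_force_bound m0 mrho mf bf pathG contG fG.
have FL := weighted_force_lip m0 mrho mf mft bf bft ft_deriv pathG contG fG.
have ci0 : 0 <= c^-1 by rewrite invr_ge0 ltW.
(* With [k = c^-1] the constant 1 is itself an admissible cut-off; the unweighted bounds are this
   instance of the weighted ones. *)
have one_le (x : R) : `|1 : R| <= c^-1 * rho x.
  by rewrite normr1 mulrC ler_pdivlMr// mul1r.
have bG t : 0 <= t -> nrm (G t) <= c^-1 * m.
  by move=> t0; have := FB (fun=> 1) _ 1 ci0 _ _ one_le t t0; rewrite mul1C; apply=> // x; rewrite normr1.
have lip s t : 0 <= s -> 0 <= t ->
    nrm (fun x => G s x - G t x) <= 2 * (c^-1 * m) * `|s - t|.
  move=> s0 t0; have := FL (fun=> 1) _ 1 ci0 _ _ one_le s t s0 t0.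
  by rewrite mul1C; apply=> // x; rewrite normr1.
have hK := decay_integral mf pathG contG fG cphi f_decay.
have intG : (\int[@lebesgue_measure R]_(t in `]0%R, +oo[) (ip (G t) (G t))%:E < +oo)%E.
  have ckG : cont0 (fun t => ip (G t) (G t)) by exact: cont0_ip.
  have ck : cont0 (fun t => phi t ^+ 2 * ip (G t) (G t)).
    by under eq_fun do rewrite expr2; apply: cont0M => //; exact: cont0M.
  have mk := cont0_measurable ck.
  have kk0 : 0 <= (c' ^+ 2)^-1 by rewrite invr_ge0 sqr_ge0.
  apply: (@le_lt_trans _ _ (\int[@lebesgue_measure R]_(t in `]0%R, +oo[)
     ((c' ^+ 2)^-1 * (phi t ^+ 2 * ip (G t) (G t)))%:E)%E).
    apply: ge0_le_integral => //.
    - by move=> t _; rewrite lee_fin ip_ge0.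
    - by apply/measurable_EFinP; exact: cont0_measurable.
    - by apply/measurable_EFinP; apply: measurable_funM.
    move=> t; rewrite /= in_itv/= andbT => t0; rewrite lee_fin mulrA.
    rewrite ler_peMl ?ip_ge0// mulrC ler_pdivlMr ?exprn_gt0// mul1r.
    by rewrite ler_pXn2r ?nnegrE ?phic ?ltW ?phi0//; exact: ltW.
  under eq_integral do rewrite EFinM.
  rewrite ge0_integralZl//.
  - by apply: lte_mul_pinfty => //.
  - exact/measurable_EFinP.
  - by move=> t _; rewrite lee_fin mulr_ge0 ?sqr_ge0 ?ip_ge0.
split.
  have [_ [w [dw hw]]] := u0_H1rho.
  have [mu0 [n0 n00 bu0]] := inL2w_sqnorm u0_H1rho.1.
  have [mw [a0 a00 bw]] := inL2w_sqnorm hw.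
  have cL0 : CL2 u0.
    have [u1 [u2 [hu0 _ _ _ _]]] := u0_H2; exact: (inL2P _).1.
  have mone : measurable_fun setT ((fun=> 1) : R -> R) by [].
  have cLw : CL2 w.
    by have [] := weighted_CL2 a00 ci0 mrho mone mw one_le bw; rewrite mul1C.
  have [K HK] := weighted_bound H gamma_gt0 lip bG intG (n0 := n0) (a0 ^+ 2)
    (mulr_ge0 (ler0n R 2) (ltW beta0)) m0 (mulr_ge0 (ler0n R 2) m0) n00.
  (* [K] is fixed before the point [x] at which the bump is centred. The 4 undoes its height
     [rho x / 2], and the 1 makes the constant positive. *)
  exists (4 * `|K| + 1); first by rewrite ltr_wpDl// mulr_ge0.
  move=> x t t0; have [eta [deta [he db er ex]]] := weight_bump x rho0 beta0 rho_lower.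
  have [C [me md b1 b2]] := C1b_meas he.
  have er1 y : `|eta y| <= 1 * rho y by rewrite mul1r.
  have := HK eta deta he db _ _ _ _ x t t0.
  rewrite ex => K_ub.
  have {}K_ub : (rho x / 2) ^+ 2 * normc (u x t) ^+ 2 <= K.
    apply: K_ub.
    - move=> s r s0 r0; have := FL eta 1 C ler01 me b1 er1 s r s0 r0.
      by rewrite mul1r.
    - by move=> s s0; have := FB eta 1 C ler01 me b1 er1 s s0; rewrite mul1r.
    - have [h1 h2] := weighted_CL2 n00 ler01 mrho me mu0 er1 bu0.
      have hU := CL2M me b1 (pU H (lexx 0)).
      rewrite (nrm_ae hU h1) ?mul1r//; first by rewrite mul1r in h2.
      by apply: aeS u0E => y ->.
    (* The weighted bound is given for [w], the derivative of [u0], and has to be carried over to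
       [Ux 0]. *)
    - have [h1 h2] := weighted_CL2 a00 ler01 mrho me mw er1 bw.
      rewrite mul1r in h2.
      have h3 := weighted_gradient he (pU H (lexx 0)) (pUx H (lexx 0)) (pUxx H (lexx 0))
        (wU H (lexx 0)) (wUx H (lexx 0)) cL0 cLw dw u0E.
      by rewrite ler_pXn2r ?nnegrE ?nrm_ge0//; exact: le_trans h2.
  rewrite ler_pdivlMr ?exprn_gt0//.
  have := ler_norm K; rewrite expr_div_n in K_ub; lra.
move=> phiAB; have [T T0 HT] := time_weight_growth gamma_gt0 phioo phi0 phiAB.
have [K2 K20 HK2] := temporal_decay H gamma_gt0 lip bG intG T0 c'0 cphi phic
  (fun t t0 => time_deriv_rder t0 (dphi t t0)) HT hK.
by exists K2 => // x t /ltW; exact: HK2.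
Qed.
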